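(* Let $p$ be a prime number of the form $p=1+4a^2$ with $a$ an integer. Then there exists a hemisystem of the Hermitian surface $\mathcal{U}_3$ of $\mathrm{PG}(3,p^2)$ which is left invariant by a subgroup of $\mathrm{PGU}(4,p)$ isomorphic to $\mathrm{PSL}(2,p)\times C_{\frac{p+1}{2}}$.
   Context: The Hermitian surface $\mathcal{U}_3$ of $\mathrm{PG}(3,q^2)$ ($q$ odd) is the set of points $(X_0,X_1,X_2,X_3)$ with $X_0^{q+1}+X_1^{q+1}+X_2^{q+1}+X_3^{q+1}=0$; here $q=p$. A generator of $\mathcal{U}_3$ is a line of $\mathrm{PG}(3,q^2)$ contained in $\mathcal{U}_3$; each point of $\mathcal{U}_3$ lies on exactly $q+1$ generators. A hemisystem of $\mathcal{U}_3$ is a set of $\frac12(q^3+1)(q+1)$ generators of $\mathcal{U}_3$ such that every point of $\mathcal{U}_3$ lies on exactly $\frac12(q+1)$ of them. $\mathrm{PGU}(4,q)$ is the group of projectivities preserving $\mathcal{U}_3$, and $C_n$ denotes the cyclic group of order $n$. *)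

(* Defs.v *)
From HB Require Import structures.
From mathcomp Require Import all_boot all_order all_algebra all_fingroup all_solvable.

Set Implicit Arguments.
Unset Strict Implicit.
Unset Printing Implicit Defensive.

Import GRing.Theory.
Local Open Scope ring_scope.

(* This module holds the subType instance of {vspace vT}. *)
Import VectorInternalTheory.

HB.instance Definition _ (K : finFieldType) (vT : vectType K) :=
  [Countable of {vspace vT} by <:].
HB.instance Definition _ (K : finFieldType) (vT : vectType K) :=
  [Finite of {vspace vT} by <:].

Section ProjectiveSpace.

Variable F : finFieldType.

(* PG(3, F); vectors are row vectors and matrices act on the right. *)
Definition point : Type := {P : {vspace 'rV[F]_4} | \dim P == 1}.
HB.instance Definition _ := Finite.on point.

(* Lines are identified with the sets of points on them. *)
Definition lines : {set {set point}} :=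
  [set [set P : point | (val P <= V)%VS]
     | V : {vspace 'rV[F]_4} & \dim V == 2].

Lemma move_point_subproof (P : point) (g : {'GL_4[F]}) :
  \dim (linfun (mulmxr (val g : 'M[F]_4) : 'rV[F]_4 -> 'rV[F]_4) @: val P)%VS
    == 1.
Proof.
rewrite limg_dim_eq; first exact: (valP P).
apply/eqP; rewrite -subv0; apply/subvP=> v; rewrite memv_cap => /andP[_].
rewrite memv_ker lfunE /= memv0 => /eqP vg0.
by rewrite -[v](mulmxK (GL_unitmx g)) vg0 mul0mx.
Qed.

Definition move_point (P : point) (g : {'GL_4[F]}) : point :=
  Sub (linfun (mulmxr (val g : 'M[F]_4) : 'rV[F]_4 -> 'rV[F]_4) @: val P)%VS
      (move_point_subproof P g).

Lemma move_point1 : move_point^~ 1%g =1 id.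
Proof.
move=> P; apply: val_inj => /=.
rewrite -[RHS]lim1g; congr (_ @: _)%VS; apply/lfunP=> v.
by rewrite !lfunE /= mulmx1.
Qed.

Lemma move_pointM P : act_morph move_point P.
Proof.
move=> g h; apply: val_inj => /=.
rewrite -limg_comp; congr (_ @: _)%VS; apply/lfunP=> v.
by rewrite !lfunE /= !lfunE /= mulmxA.
Qed.

Canonical point_action := TotalAction move_point1 move_pointM.

(* The group of projectivities of PG(3, F), as permutations of the points. *)
Definition PGL4 : {group {perm point}} :=
  (actperm point_action @* 'GL_4[F])%G.

(* The definitions below are meant for #|F| = q ^ 2. *)
Variable q : nat.

(* The defining equation does not depend on the representative of a point
   (including 0), hence the quantification over all v in P. *)
Definition hermitian_surface : {set point} :=
  [set P : point | [forall v : 'rV[F]_4,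
     (v \in val P) ==> (\sum_(i < 4) v 0 i ^+ q.+1 == 0)]].

Definition generators : {set {set point}} :=
  [set L in lines | L \subset hermitian_surface].

(* Both halves are exact when q is odd. *)
Definition is_hemisystem (S : {set {set point}}) : Prop :=
  [/\ S \subset generators,
      #|S| = (((q ^ 3).+1 * q.+1)./2)%N
    & forall P : point, P \in hermitian_surface ->
        #|[set L in S | P \in L]| = q.+1./2].

(* The setwise stabiliser, in PGL4, of the Hermitian surface. *)
Definition PGU4 : {group {perm point}} :=
  ('N_PGL4(hermitian_surface | 'P))%G.

End ProjectiveSpace.

Section ProjectiveSpecialLinear.

Variable K : finFieldType.

Definition SL2_set : {set {'GL_2[K]}} :=
  [set g : {'GL_2[K]} | \det (val g) == 1].

Lemma SL2_group_set : group_set SL2_set.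
Proof.
apply/group_setP; split=> [|g h]; first by rewrite inE /= det1.
by rewrite !inE => /eqP dg /eqP dh; rewrite /= det_mulmx dg dh mulr1.
Qed.

Definition SL2 : {group {'GL_2[K]}} := Group SL2_group_set.

Definition PSL2 : {group coset_of 'Z(SL2)} := (SL2 / 'Z(SL2))%G.

End ProjectiveSpecialLinear.

(* Main.v *)
(* Let q = p = 4m + 1, and write the points of PG(3, q^2) as (x, t) with t a scalar and x a binary
   quadratic form. If B is the polar form of the discriminant and h(x, y) = B(x, y^q), the surface
   is h(x, x) + t^(q+1) = 0. A generator joins (x, 0) to (w, 1), where x is isotropic, w is
   orthogonal to x and h(w, w) = -1. It gets the sign V(x) sg(L(x, w)), where L(x, w) is the
   coordinate of w on x^perp / x, sg is the quadratic character of the group of elements of norm 1,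
   and V is a function with values 1 and -1 on the isotropic forms such that V(c x) = chi(c) V(x),
   chi being the quadratic character of the field. The generators of sign 1 through (x, 0) are half
   of all, because L(x, -w) = -L(x, w) and sg(-1) = -1. For the points (w, 1) the same
   holds if and only if the sum f_V(w) of V(x) sg(L(x, w)) over the isotropic x orthogonal to w
   vanishes.

   Take V = V1 + e VO + V2, with one summand for each quadratic character of the discriminant, all
   of them invariant under SL(2, q).
   - V1 and VO are even invariant under GL(2, q). If w is orthogonal to a nondegenerate form over
     F_q, the half turn about that form maps w to -w, so that f_V1(w) = f_VO(w) = 0. The remaining w
     are in one orbit, up to scalars of norm 1, and there f_V1 and f_VO are (q^2 - 1) C1 and
     (q^2 - 1) s with s = 1 or -1. The character sum C1 is odd and C1^2 + C2^2 = q for an integer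
     C2. As q = 1 + 4a^2, this forces C1 = 1 or -1, and e = - s C1 makes f_V1 + e f_VO vanish.
   - The sum of f_V2(w)^2 over all w is a quadratic form in V2, given by the matrix chi(h(x, y)) of
     the unitary two-graph. V2 is an eigenvector of this matrix for the eigenvalue (q^2 - 1) q^2,
     and for such a vector the quadratic form is 0. *)

From HB Require Import structures.
Require Import Defs.
From mathcomp Require Import all_boot all_order all_algebra all_fingroup all_solvable all_field.
From mathcomp Require Import ring zify.

Set Implicit Arguments.
Unset Strict Implicit.
Unset Printing Implicit Defensive.

Import Order.TTheory GRing.Theory Num.Theory.
Local Open Scope ring_scope.

(** * A field of order q^2 and its characters *)

(** Why V2 needs an argument of its own: a substitution of determinant d multiplies it by [psi d],
    which on F_q is the quadratic character, and a half turn about v has determinant [- bil v v].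
    Where this is a nonsquare, the half turn says nothing about f_V2(w). Why V2 is an eigenvector:
    the two-graph commutes with substitutions, so the image of V2 transforms as V2 does. This forces
    the value 0 where the discriminant is 0 or a square; the remaining isotropic forms are one orbit
    up to scalars, hence the image is a multiple [kap] of V2. A quadratic equation for the matrix
    leaves (q^2 - 1) q^2 and -(q^2 - 1) q for [kap]. They differ modulo 4 (q^2 - 1), and a symmetry
    with orbits of length 4 decides. Where C1 and C2 come from: up to sign they are the imaginary
    and the real part of the sum of a quartic character of K over the elements t + 2 tau, t in F_q;
    hence the norm q. The group: SL(2, q) acts on the forms with kernel 1 and -1, and (x, t) goes to
    (x, c t) with c of odd order dividing (q + 1)/2, so that sg(c) = 1. *)

Record quadext := QuadExt {
  qe_field :> finFieldType;
  qe_m : nat;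
  qe_prime : prime (4 * qe_m + 1);
  qe_card : #|qe_field| = ((4 * qe_m + 1) ^ 2)%N }.

Definition ord_q (K : quadext) : nat := 4 * qe_m K + 1.

Lemma prime_q (K : quadext) : prime (ord_q K). Proof. exact: qe_prime. Qed.

Lemma card_quadext (K : quadext) : #|K| = (ord_q K ^ 2)%N.
Proof. exact: qe_card. Qed.

Lemma pchar_quadext (K : quadext) : ord_q K \in [pchar K].
Proof.
have [r rp charK] := finPcharP K.
have /= cK := card_pprimeChar charK.
have : (r %| ord_q K ^ 2)%N.
  rewrite -card_quadext cK dvdn_exp ?dvdnn // lt0n; apply/negP=> /eqP d0.
  move: cK; rewrite d0 card_quadext => /eqP.
  by rewrite (eqn_exp2l _ 0) ?prime_gt1 ?prime_q.
rewrite Euclid_dvdX // andbT dvdn_prime2 ?prime_q // => /eqP <- //.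
Qed.

Definition cj (K : quadext) : K -> K := pFrobenius_aut (pchar_quadext K).
HB.instance Definition _ (K : quadext) :=
  GRing.RMorphism.copy (@cj K) (pFrobenius_aut (pchar_quadext K)).

(** For norm and trace, root counting bounds each fibre from above; since the bounds add up to the
    size of the domain, none of them is strict. *)
Lemma eq_card_fiber (T T' : finType) (f : T -> T') (A : {set T}) (B : {set T'}) k :
    {in A, forall x, f x \in B} ->
    {in B, forall y, #|[set x in A | f x == y]| <= k}%N ->
    #|A| = (#|B| * k)%N ->
  {in B, forall y, #|[set x in A | f x == y]| = k}.
Proof.
move=> fAB le_k cardA.
have sumA : (\sum_(y in B) #|[set x in A | f x == y]| = #|A|)%N.
  rewrite -[RHS]sum1_card (partition_big f (mem B)) //=.
  by apply: eq_bigr => y _; rewrite sum1dep_card.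
have sumk : (\sum_(y in B) (k - #|[set x in A | f x == y]|) = 0)%N.
  apply: (@addIn #|A|); rewrite -{1}sumA -big_split /= add0n cardA -sum_nat_const.
  by apply: eq_bigr => y By; rewrite subnK ?le_k.
move=> y By; apply/eqP; rewrite eqn_leq le_k //= -subn_eq0.
by move/eqP: sumk; rewrite sum_nat_eq0 => /forall_inP/(_ _ By).
Qed.

Lemma card_root_le (R : finFieldType) (P : {poly R}) :
  P != 0 -> (#|[set x | root P x]| < size P)%N.
Proof.
move=> nzP; rewrite cardE max_poly_roots ?enum_uniq //.
by apply/allP => x; rewrite mem_enum inE.
Qed.

Section QuadraticExtension.
Variable K : quadext.
Implicit Types x y z c s l : K.
Local Notation q := (ord_q K).
Local Notation m := (qe_m K).

Lemma qE : q = (4 * m).+1. Proof. by rewrite /ord_q addn1. Qed.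

Lemma m_gt0 : (0 < m)%N.
Proof. by case E: m (prime_q K) => //; rewrite qE E. Qed.

Lemma q_gt1 : (1 < q)%N. Proof. exact: prime_gt1 (prime_q K). Qed.

Lemma card_units : (q ^ 2 - 1 = 8 * m * (2 * m + 1))%N.
Proof. by rewrite qE expnS expn1; lia. Qed.

Lemma units_gt0 : (0 < q ^ 2 - 1)%N.
Proof. by rewrite subn_gt0 -[X in (X < _)%N](exp1n 2) ltn_exp2r ?q_gt1. Qed.

Lemma card_nonzero : #|[set c : K | c != 0]| = (q ^ 2 - 1)%N.
Proof.
have -> : [set c : K | c != 0] = [set~ 0] by apply/setP=> c; rewrite !inE.
by rewrite cardsC1 card_quadext subn1.
Qed.

Lemma natr_neq0 n : (0 < n < q)%N -> n%:R != 0 :> K.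
Proof.
case/andP=> n0 nq; rewrite -(dvdn_pcharf (pchar_quadext K)).
by apply/negP => /(dvdn_leq n0); rewrite leqNgt nq.
Qed.

Lemma two_neq0 : 2 != 0 :> K.
Proof. by apply: natr_neq0; rewrite qE; have := m_gt0; lia. Qed.

Lemma four_neq0 : 4 != 0 :> K.
Proof. by apply: natr_neq0; rewrite qE; have := m_gt0; lia. Qed.

Lemma cjE x : cj x = x ^+ q. Proof. by []. Qed.

Lemma cjK : involutive (@cj K).
Proof. by move=> x; rewrite !cjE -exprM mulnn -card_quadext expf_card. Qed.

Lemma cj_eq0 x : (cj x == 0) = (x == 0). Proof. exact: fmorph_eq0. Qed.

Lemma expf_units x : x != 0 -> x ^+ (8 * m * (2 * m + 1)) = 1.
Proof.
move=> x0; apply: (mulfI x0); rewrite -exprS mulr1 -card_units -[RHS]expf_card.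
by rewrite card_quadext subn1 prednK // expn_gt0 prime_gt0 ?prime_q.
Qed.

Definition real : pred K := fun x => cj x == x.

Lemma realP x : reflect (cj x = x) (real x). Proof. exact: eqP. Qed.

Lemma real_nat n : real n%:R. Proof. by apply/realP; rewrite rmorph_nat. Qed.

Lemma card_real : #|[set x | real x]| = q.
Proof.
apply/eqP; rewrite eqn_leq; apply/andP; split.
  have sz : size ('X^q - 'X : {poly K}) = q.+1.
    by rewrite size_polyDl ?size_polyXn // size_polyN size_polyX ltnS q_gt1.
  rewrite -ltnS -sz; have nz : ('X^q - 'X : {poly K}) != 0 by rewrite -size_poly_eq0 sz.
  apply: leq_ltn_trans (card_root_le nz); apply: subset_leq_card.
  apply/subsetP=> x; rewrite !inE /real cjE rootE !hornerE => /eqP ->.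
  by rewrite subrr.
(* The multiples of 1 are q distinct fixed points of the Frobenius map, so they are all of them. *)
pose f (i : 'I_q) : K := (val i)%:R.
have injf : injective f.
  suff inj_le (i j : 'I_q) : (i <= j)%N -> f i = f j -> i = j.
    move=> i j fij; case: (leqP i j) => [|/ltnW] le_ij; first exact: inj_le.
    by rewrite (inj_le _ _ le_ij).
  move=> le_ij /eqP; rewrite eq_sym -subr_eq0 -natrB // => fij.
  apply: val_inj => /=; apply/eqP; rewrite eqn_leq le_ij -subn_eq0 /=.
  apply: contraTT fij; rewrite -lt0n => lt_ij; apply: natr_neq0; rewrite lt_ij /=.
  exact: leq_ltn_trans (leq_subr _ _) (ltn_ord j).
rewrite -[X in (X <= _)%N](card_ord q) -(card_imset _ injf) subset_leq_card //.
by apply/subsetP=> _ /imsetP[i _ ->]; rewrite inE real_nat.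
Qed.

Lemma exists_nonreal : exists x : K, ~~ real x.
Proof.
apply/existsP; rewrite -negb_forall; apply/negP => /forallP allreal.
have : [set x : K | real x] = setT by apply/setP=> x; rewrite !inE allreal.
move/(congr1 (fun A : {set K} => #|A|)); rewrite card_real cardsT card_quadext.
move/eqP; rewrite -{1}(expn1 q) eqn_exp2l ?q_gt1 //.
Qed.

Lemma exists_skew : exists t : K, (t != 0) && (cj t == - t).
Proof.
have [z nrz] := exists_nonreal; exists (z - cj z).
by rewrite rmorphB /= cjK opprB eqxx andbT subr_eq0 eq_sym.
Qed.

Definition tau : K := xchoose exists_skew.

Lemma tau_neq0 : tau != 0. Proof. by have /andP[] := xchooseP exists_skew. Qed.

Lemma cj_tau : cj tau = - tau. Proof. by have /andP[_ /eqP] := xchooseP exists_skew. Qed.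

Lemma tau_exp : tau ^+ (4 * m) = -1.
Proof. by apply: (mulIf tau_neq0); rewrite -exprSr -qE -cjE cj_tau mulN1r. Qed.

Lemma exists_ii : exists i : K, (i ^+ 2 == -1) && (cj i == i).
Proof.
(* As [tau ^+ (4 * m) = -1], the square of [i] is an odd power of -1; conjugation fixes [i] because
   4 divides q - 1. *)
pose i := tau ^+ (2 * m * (2 * m + 1)); exists i.
have i2 : i ^+ 2 = -1.
  rewrite /i -exprM; have -> : (2 * m * (2 * m + 1) * 2 = 4 * m * (2 * m + 1))%N by lia.
  by rewrite exprM tau_exp -signr_odd oddD mul2n odd_double expr1.
rewrite i2 eqxx /= cjE qE exprS; have -> : (4 * m = 2 * (2 * m))%N by lia.
by rewrite exprM i2 exprM sqrrN !expr1n mulr1.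
Qed.

Definition ii : K := xchoose exists_ii.

Lemma ii_sq : ii ^+ 2 = -1. Proof. by have /andP[/eqP] := xchooseP exists_ii. Qed.

Lemma cj_ii : cj ii = ii. Proof. by have /andP[_ /eqP] := xchooseP exists_ii. Qed.

Lemma ii_neq0 : ii != 0.
Proof. by apply/eqP=> i0; move/eqP: ii_sq; rewrite i0 expr0n eq_sym oppr_eq0 oner_eq0. Qed.

(** * Quadratic and quartic characters, by Euler's criterion *)

Definition sgx e x : int := if x ^+ e == 1 then 1 else -1.

Lemma sgxM e x y : x ^+ (2 * e) = 1 -> y ^+ (2 * e) = 1 ->
  sgx e (x * y) = sgx e x * sgx e y.
Proof.
rewrite ![(2 * e)%N]mulnC !exprM /sgx exprMn => /eqP; rewrite sqrf_eq1 => /orP[]/eqP->.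
  by rewrite eqxx !mul1r.
have N1 : (-1 == 1 :> K) = false.
  by rewrite eq_sym -subr_eq0 opprK; apply/negbTE/two_neq0.
by move/eqP; rewrite sqrf_eq1 => /orP[]/eqP->; rewrite ?mulr1 ?mulrNN ?mulr1 N1 eqxx.
Qed.

Lemma neg1_neq1 : -1 != 1 :> K.
Proof. by rewrite eq_sym -subr_eq0 opprK two_neq0. Qed.

Lemma sgx_sq e x : sgx e x * sgx e x = 1.
Proof. by rewrite /sgx; case: ifP. Qed.

Definition chi x : int := if x == 0 then 0 else sgx (4 * m * (2 * m + 1)) x.

Lemma chi0 : chi 0 = 0. Proof. by rewrite /chi eqxx. Qed.

Lemma chi_neq0 x : x != 0 -> chi x * chi x = 1.
Proof. by rewrite /chi => /negbTE->; rewrite sgx_sq. Qed.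

Lemma chi_eq0 x : (chi x == 0) = (x == 0).
Proof. by rewrite /chi; case: (x == 0); rewrite // /sgx; case: (_ == 1). Qed.

Lemma chiM x y : chi (x * y) = chi x * chi y.
Proof.
rewrite /chi mulf_eq0; case: eqP => [_|/eqP x0]; first by rewrite mul0r.
case: eqP => [_|/eqP y0] /=; first by rewrite mulr0.
by apply: sgxM; rewrite !mulnA -/(2 * 4)%N expf_units.
Qed.

Lemma chi1 : chi 1 = 1.
Proof. by rewrite /chi oner_eq0 /sgx expr1n eqxx. Qed.

Lemma chi_sqr x : x != 0 -> chi (x ^+ 2) = 1.
Proof. by move=> x0; rewrite expr2 chiM chi_neq0. Qed.

(** The exponent (q^2 - 1)/2 is a multiple of q - 1: all elements of F_q are squares in K. *)
Lemma chi_real x : real x -> x != 0 -> chi x = 1.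
Proof.
move=> /realP rx x0; rewrite /chi (negbTE x0) /sgx.
suff -> : x ^+ (4 * m * (2 * m + 1)) = 1 by rewrite eqxx.
by rewrite exprM; have -> : x ^+ (4 * m) = 1; rewrite ?expr1n //; apply: (mulIf x0); rewrite -exprSr -qE -cjE rx mul1r.
Qed.

Lemma chi_tau : chi tau = -1.
Proof.
rewrite /chi (negbTE tau_neq0) /sgx exprM tau_exp -signr_odd oddD mul2n odd_double expr1.
by rewrite (negbTE neg1_neq1).
Qed.

Lemma chi_ii : chi ii = 1.
Proof. by rewrite chi_real ?ii_neq0 //; apply/realP; rewrite cj_ii. Qed.

Lemma chiN x : chi (- x) = chi x.
Proof.
rewrite -mulN1r chiM chi_real ?mul1r ?oppr_eq0 ?oner_eq0 //.
by apply/realP; rewrite rmorphN1.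
Qed.

Lemma odd_q : odd q.
Proof. by rewrite qE /= oddM. Qed.

Lemma sgx_cj e x : x ^+ (2 * e) = 1 -> sgx e (cj x) = sgx e x.
Proof.
rewrite mulnC exprM => /eqP; rewrite sqrf_eq1 /sgx => xe.
rewrite cjE -exprM mulnC exprM; case/orP: xe => /eqP->; rewrite ?expr1n //.
by rewrite -signr_odd odd_q expr1.
Qed.

Lemma chi_cj x : chi (cj x) = chi x.
Proof.
rewrite /chi cj_eq0; case: eqP => // /eqP x0; apply: sgx_cj.
by rewrite !mulnA -/(2 * 4)%N expf_units.
Qed.

Lemma chiV x : chi x^-1 = chi x.
Proof.
have [->|x0] := eqVneq x 0; first by rewrite invr0.
have nz : chi x != 0 by rewrite chi_eq0.
apply: (mulfI nz); rewrite -chiM mulfV // chi_neq0 // chi1 //.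
Qed.

Lemma chi_neq1 x : x != 0 -> chi x != 1 -> chi x = -1.
Proof. by move=> x0; rewrite /chi (negbTE x0) /sgx; case: ifP. Qed.

Lemma chi_square x : chi x = 1 -> exists2 d : K, d != 0 & x = d ^+ 2.
Proof.
have [->|x0] := eqVneq x 0; first by rewrite chi0.
have /cyclicP[g Dg] := field_unit_group_cyclic [set: {unit K}].
have /cycleP[k Dk] : FinRing.unit K (etrans (unitfE x) x0) \in <[g]>%g by rewrite -Dg inE.
have og : #[g]%g = (q ^ 2 - 1)%N.
  by rewrite orderE -Dg -card_quadext card_finField_unit subn1.
have {Dk} xE : x = val g ^+ k by rewrite -FinRing.val_unitX -Dk.
have g0 : val g != 0 by rewrite -unitfE (valP g).
move=> chix; have {chix} : x ^+ (4 * m * (2 * m + 1)) == 1.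
  by move: chix; rewrite /chi (negbTE x0) /sgx; case: ifP.
rewrite xE -exprM -FinRing.val_unitX => /eqP gk.
have : (#[g]%g %| k * (4 * m * (2 * m + 1)))%N.
  by rewrite order_dvdn; apply/eqP/val_inj; rewrite /= FinRing.val_unitX.
rewrite og card_units -[(8 * _ * _)%N]/(2 * 4 * m * (2 * m + 1))%N -!mulnA dvdn_pmul2r; last first.
  by rewrite !muln_gt0 m_gt0 addn1.
case/dvdnP=> j ->; exists (val g ^+ j); first by rewrite expf_neq0.
by rewrite FinRing.val_unitX exprM.
Qed.

(* The quartic character, cut off to the squares, on which it has the values 1 and -1. *)
Definition psi z : int := if chi z == 1 then sgx (2 * m * (2 * m + 1)) z else 0.

(** On the nonzero elements of F_q this makes [psi] the quadratic character of F_q: a square has a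
    root in F_q, where [chi] is 1, and a nonsquare has a root that is [tau] times an element of F_q,
    where [chi] is -1. *)
Lemma psi_sqr d : psi (d ^+ 2) = chi d.
Proof.
have [->|d0] := eqVneq d 0; first by rewrite expr0n /= /psi chi0.
rewrite /psi chi_sqr // eqxx /chi (negbTE d0) /sgx -exprM.
by have -> : (2 * (2 * m * (2 * m + 1)) = 4 * m * (2 * m + 1))%N by lia.
Qed.

Lemma psi_nonsquare z : chi z != 1 -> psi z = 0.
Proof. by rewrite /psi => /negbTE ->. Qed.

Lemma psiM x y : chi x = 1 -> psi (x * y) = psi x * psi y.
Proof.
move=> chix; case: (eqVneq (chi y) 1) => [chiy|nchiy].
  have [d _ ->] := chi_square chix; have [e _ ->] := chi_square chiy.
  by rewrite -exprMn !psi_sqr chiM.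
by rewrite !(psi_nonsquare nchiy) ?mulr0 // psi_nonsquare // chiM chix mul1r.
Qed.

Lemma psi_neq0 z : chi z = 1 -> psi z * psi z = 1.
Proof. by case/chi_square=> d d0 ->; rewrite psi_sqr chi_neq0. Qed.

Lemma psiV z : psi z^-1 = psi z.
Proof.
case: (eqVneq (chi z) 1) => [/chi_square[d _ ->]|nchi].
  by rewrite -exprVn !psi_sqr chiV.
by rewrite !psi_nonsquare ?chiV.
Qed.

Lemma psi_cj z : psi (cj z) = psi z.
Proof.
case: (eqVneq (chi z) 1) => [/chi_square[d _ ->]|nchi].
  by rewrite rmorphXn /= !psi_sqr chi_cj.
by rewrite !psi_nonsquare ?chi_cj.
Qed.

Lemma psi1 : psi 1 = 1. Proof. by rewrite -(expr1n _ 2) psi_sqr chi1. Qed.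

Lemma psi0 : psi 0 = 0. Proof. by rewrite psi_nonsquare ?chi0. Qed.

Lemma psiN1 : psi (-1) = 1. Proof. by rewrite -ii_sq psi_sqr chi_ii. Qed.

Lemma psiN z : psi (- z) = psi z.
Proof. by rewrite -mulN1r psiM ?psiN1 ?mul1r // chiN chi1. Qed.

Lemma psi_tau2 : psi (tau ^+ 2) = -1.
Proof. by rewrite psi_sqr chi_tau. Qed.

Lemma real_tau2 : real (tau ^+ 2).
Proof. by apply/realP; rewrite rmorphXn /= cj_tau sqrrN. Qed.

(* The quadratic character of the group of elements of norm 1, which has order q + 1. *)
Definition sg (l : K) : int := sgx (2 * m + 1) l.

Lemma circle_exp l : l * cj l = 1 -> l ^+ (2 * (2 * m + 1)) = 1.
Proof.
rewrite cjE -exprS qE => <-; congr (_ ^+ _); lia.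
Qed.

Lemma sgM l l' : l * cj l = 1 -> l' * cj l' = 1 -> sg (l * l') = sg l * sg l'.
Proof. by move=> /circle_exp ? /circle_exp ?; exact: sgxM. Qed.

Lemma sg_exp l : l ^+ (2 * m + 1) = 1 -> sg l = 1.
Proof. by rewrite /sg /sgx => ->; rewrite eqxx. Qed.

(** [2 * m + 1] is (q + 1)/2, which is odd because q is 1 modulo 4. *)
Lemma sgN1 : sg (-1) = -1.
Proof.
by rewrite /sg /sgx -signr_odd oddD mul2n odd_double expr1 (negbTE neg1_neq1).
Qed.

Lemma sgN l : l * cj l = 1 -> sg (- l) = - sg l.
Proof.
by move=> Nl; rewrite -mulN1r sgM ?sgN1 ?mulN1r //; ring.
Qed.

(** [c / cj c] is c^(1 - q), and raising it to the power (q + 1)/2 gives the inverse of c^((q^2 -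
    1)/2). This link between the two characters makes the sign of a generator independent of the
    scaling of x. *)
Lemma sg_div c : c != 0 -> sg (c / cj c) = chi c.
Proof.
move=> c0; rewrite -chiV /sg /chi invr_eq0 (negbTE c0) /sgx exprM; congr (if _ ^+ _ == _ then _ else _).
by rewrite cjE qE exprS invfM mulrA mulfV // mul1r exprVn.
Qed.

Lemma sum_chi : \sum_x chi x = 0.
Proof.
set s := \sum_x _; suff : s = - s by lia.
rewrite {1}/s (reindex_inj (mulfI tau_neq0)) /=.
by rewrite -sumrN; apply: eq_bigr => x _; rewrite chiM chi_tau mulN1r.
Qed.

(** * Norm and trace to the subfield of order q *)

Lemma real_norm x : real (x * cj x).
Proof. by apply/realP; rewrite rmorphM /= cjK mulrC. Qed.

Lemma real_trace x : real (x + cj x).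
Proof. by apply/realP; rewrite rmorphD /= cjK addrC. Qed.

Lemma card_norm c : real c -> c != 0 -> #|[set s | s * cj s == c]| = q.+1.
Proof.
move=> rc c0; pose A := [set s : K | s != 0]; pose B := [set c : K | real c] :\ 0.
have cardA : #|A| = (q ^ 2 - 1)%N.
  have -> : A = [set~ 0] by apply/setP=> x; rewrite !inE.
  by rewrite cardsC1 card_quadext subn1.
have cardB : #|B| = (q - 1)%N.
  have := cardsD1 (0 : K) [set c : K | real c]; rewrite card_real inE /real rmorph0 eqxx -/B /=.
  by lia.
have -> : [set s | s * cj s == c] = [set s in A | s * cj s == c].
  apply/setP=> s; rewrite !inE; case: (eqVneq s 0) => //= ->.
  by rewrite mul0r eq_sym (negbTE c0).
apply: (@eq_card_fiber _ _ _ A B) => [s|y|| ].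
- by rewrite !inE real_norm mulf_eq0 cj_eq0 orbb andbT.
- rewrite !inE => /andP[y0 _]; have sz : size ('X^(q.+1) - y%:P) = q.+2.
    by rewrite size_polyDl ?size_polyXn // size_polyN size_polyC y0.
  have nz : ('X^(q.+1) - y%:P) != 0 by rewrite -size_poly_eq0 sz.
  rewrite -ltnS -sz; apply: leq_ltn_trans (card_root_le nz); apply: subset_leq_card.
  by apply/subsetP=> s; rewrite !inE rootE !hornerE exprS cjE subr_eq0 => /andP[].
- by rewrite cardA cardB; have := q_gt1; rewrite expnS expn1; nia.
- by rewrite !inE c0 rc.
Qed.

Lemma card_trace c : real c -> #|[set s | s + cj s == c]| = q.
Proof.
move=> rc.
have -> : [set s | s + cj s == c] = [set s in [set: K] | s + cj s == c].
  by apply/setP=> s; rewrite !inE.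
apply: (@eq_card_fiber _ _ _ [set: K] [set c : K | real c]) => [s|y|| ].
- by rewrite !inE real_trace.
- rewrite !inE => _; have sz : size ('X^q + ('X - y%:P)) = q.+1.
    by rewrite size_polyDl ?size_polyXn // size_XsubC ltnS q_gt1.
  have nz : ('X^q + ('X - y%:P)) != 0 by rewrite -size_poly_eq0 sz.
  rewrite -ltnS -sz; apply: leq_ltn_trans (card_root_le nz); apply: subset_leq_card.
  apply/subsetP=> s; rewrite !inE rootE hornerD hornerXn hornerXsubC cjE => /eqP <-.
  by rewrite opprD (addrA s) subrr add0r subrr.
- by rewrite cardsT card_real card_quadext.
- by rewrite !inE.
Qed.

Definition re x := (x + cj x) / 2.
Definition im x := (x - cj x) / (2 * tau).

Lemma re_real x : real (re x).
Proof.
by apply/realP; rewrite /re rmorphM fmorphV rmorph_nat rmorphD /= cjK [cj x + x]addrC.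
Qed.

Lemma im_real x : real (im x).
Proof.
apply/realP; rewrite /im rmorphM fmorphV rmorphM rmorph_nat rmorphB /= cj_tau cjK.
by field; rewrite ?oppr_eq0 tau_neq0 two_neq0.
Qed.

Lemma re_im x : x = re x + tau * im x.
Proof. by rewrite /re /im; field; rewrite two_neq0 tau_neq0. Qed.

End QuadraticExtension.

(** * Binary quadratic forms *)

(* The triple (a, b, c) stands for the binary quadratic form a S^2 + b S T + c T^2. *)
Definition vec (K : quadext) : finType := (K * K * K)%type.

Section BinaryForms.
Variable K : quadext.
Implicit Types (x y z w v : vec K) (c d s : K).

Definition vzero : vec K := (0, 0, 0).
Definition scv c x : vec K := (c * x.1.1, c * x.1.2, c * x.2).
Definition vadd x y : vec K := (x.1.1 + y.1.1, x.1.2 + y.1.2, x.2 + y.2).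
Definition cjv x : vec K := (cj x.1.1, cj x.1.2, cj x.2).

(* Half of the polarization of the discriminant b ^ 2 - 4 a c. *)
Definition bil x y : K := x.1.2 * y.1.2 - 2 * (x.1.1 * y.2 + x.2 * y.1.1).
Definition her x y : K := bil x (cjv y).
Definition det3 x y z : K :=
  x.1.1 * (y.1.2 * z.2 - y.2 * z.1.2) - x.1.2 * (y.1.1 * z.2 - y.2 * z.1.1)
  + x.2 * (y.1.1 * z.1.2 - y.1.2 * z.1.1).
(** The cross product for [bil]; as a form, it is minus one half of the Jacobian determinant of the
    two forms. *)
Definition crs x y : vec K :=
  (y.1.1 * x.1.2 - x.1.1 * y.1.2, 2 * (x.2 * y.1.1 - x.1.1 * y.2),
   x.2 * y.1.2 - x.1.2 * y.2).

Lemma vec_eqP x y : [/\ x.1.1 = y.1.1, x.1.2 = y.1.2 & x.2 = y.2] -> x = y.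
Proof. by move: x y => [[? ?] ?] [[? ?] ?] /= [-> -> ->]. Qed.

Lemma scvA c d x : scv c (scv d x) = scv (c * d) x.
Proof. by rewrite /scv /= !mulrA. Qed.

Lemma scv1 x : scv 1 x = x.
Proof. by apply: vec_eqP; rewrite /= !mul1r. Qed.

Lemma scv0 x : scv 0 x = vzero.
Proof. by rewrite /scv !mul0r. Qed.

Lemma scv_vzero c : scv c vzero = vzero.
Proof. by rewrite /scv !mulr0. Qed.

Lemma scvK c : c != 0 -> cancel (scv c) (scv c^-1).
Proof. by move=> c0 x; rewrite scvA mulVf // scv1. Qed.

Lemma scv_inj c : c != 0 -> injective (scv c).
Proof. by move/scvK/can_inj. Qed.

Lemma scv_eq0 c x : c != 0 -> (scv c x == vzero) = (x == vzero).
Proof. by move=> c0; rewrite -{1}(scv_vzero c) (inj_eq (scv_inj c0)). Qed.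

Lemma scv_injl x : x != vzero -> injective (scv^~ x).
Proof.
move=> x0 c d [e1 e2 e3]; apply/eqP; rewrite -subr_eq0; apply: contraTT x0 => cd.
rewrite negbK; apply/eqP/vec_eqP; split; apply: (mulfI cd); rewrite mulrBl mulr0.
- by rewrite e1 subrr.
- by rewrite e2 subrr.
- by rewrite e3 subrr.
Qed.

Lemma scv_cjv c x : cjv (scv c x) = scv (cj c) (cjv x).
Proof. by rewrite /cjv /scv /= !rmorphM. Qed.

Lemma cjvK : involutive cjv.
Proof. by move=> [[? ?] ?]; rewrite /cjv /= !cjK. Qed.

Lemma bilC x y : bil x y = bil y x.
Proof. by rewrite /bil; ring. Qed.

Lemma bil_scl c x y : bil (scv c x) y = c * bil x y.
Proof. by rewrite /bil /=; ring. Qed.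

Lemma bil_scr c x y : bil x (scv c y) = c * bil x y.
Proof. by rewrite /bil /=; ring. Qed.

Lemma bil_addl x y z : bil (vadd x y) z = bil x z + bil y z.
Proof. by rewrite /bil /=; ring. Qed.

Lemma bil_cj x y : cj (bil x y) = bil (cjv x) (cjv y).
Proof. by rewrite /bil /=; ring. Qed.

Lemma her_cj x y : cj (her x y) = her y x.
Proof. by rewrite /her bil_cj cjvK bilC. Qed.

Lemma her_real x : real (her x x).
Proof. by apply/realP/her_cj. Qed.

Lemma her_scl c x y : her (scv c x) y = c * her x y.
Proof. exact: bil_scl. Qed.

Lemma her_scr c x y : her x (scv c y) = cj c * her x y.
Proof. by rewrite /her scv_cjv bil_scr. Qed.

Lemma her_addl x y z : her (vadd x y) z = her x z + her y z.
Proof. exact: bil_addl. Qed.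

Lemma her_addr x y z : her x (vadd y z) = her x y + her x z.
Proof. by rewrite -her_cj her_addl rmorphD /= !her_cj. Qed.

Lemma her0l x : her vzero x = 0. Proof. by rewrite -(scv0 vzero) her_scl mul0r. Qed.

Lemma her_eq0C x y : (her x y == 0) = (her y x == 0).
Proof. by rewrite -her_cj cj_eq0. Qed.

Lemma bil_crs x y z : bil (crs x y) z = 2 * det3 x y z.
Proof. by rewrite /bil /det3 /=; ring. Qed.

Lemma bil_crs_crs x y z w :
  bil (crs x y) (crs z w) = - (bil x z * bil y w - bil x w * bil y z).
Proof. by rewrite /bil /=; ring. Qed.

Lemma crs_cjv x y : cjv (crs x y) = crs (cjv x) (cjv y).
Proof. by rewrite /cjv /crs /=; congr (_, _, _); ring. Qed.

Lemma det3_gram x y z x' y' z' : - 4 * (det3 x y z * det3 x' y' z') =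
  bil x x' * (bil y y' * bil z z' - bil y z' * bil z y')
  - bil x y' * (bil y x' * bil z z' - bil y z' * bil z x')
  + bil x z' * (bil y x' * bil z y' - bil y y' * bil z x').
Proof. by rewrite /bil /det3 /=; ring. Qed.

Lemma det3_cramer x y z v : scv (det3 x y z) v =
  vadd (scv (det3 v y z) x) (vadd (scv (det3 x v z) y) (scv (det3 x y v) z)).
Proof. by apply: vec_eqP; rewrite /det3 /=; split; ring. Qed.

Lemma det3_cj x y z : cj (det3 x y z) = det3 (cjv x) (cjv y) (cjv z).
Proof. by rewrite /det3 /=; ring. Qed.

Lemma crs_eq0 x y : x != vzero -> crs x y = vzero -> exists c, y = scv c x.
Proof.
move: x y => [[xa xb] xc] [[ya yb] yc] nz [/eqP e1 /eqP e2 /eqP e3].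
move: e1 e2 e3; rewrite mulf_eq0 (negbTE (two_neq0 K)) /= !subr_eq0 => /eqP e1 /eqP e2 /eqP e3.
have [a0|a0] := eqVneq xa 0; last first.
  have E (z : K) : xa * (ya / xa * z) = ya * z by field.
  exists (ya / xa); apply: vec_eqP; split; apply: (mulfI a0); rewrite /= E.
  - exact: mulrC.
  - by rewrite e1.
  - by rewrite -e2 mulrC.
have [b0|b0] := eqVneq xb 0; last first.
  have E (z : K) : xb * (yb / xb * z) = yb * z by field.
  exists (yb / xb); apply: vec_eqP; split; apply: (mulfI b0); rewrite /= E.
  - by rewrite mulrC e1 mulrC.
  - exact: mulrC.
  - by rewrite -e3 mulrC.
have c0 : xc != 0 by apply: contraNneq nz => c0; rewrite a0 b0 c0.
have E (z : K) : xc * (yc / xc * z) = yc * z by field.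
exists (yc / xc); apply: vec_eqP; split; apply: (mulfI c0); rewrite /= E.
- by rewrite e2 mulrC.
- by rewrite e3 mulrC.
- exact: mulrC.
Qed.

Definition iso x := (x != vzero) && (her x x == 0).

Lemma iso_sc c x : c != 0 -> iso (scv c x) = iso x.
Proof.
by move=> c0; rewrite /iso scv_eq0 // her_scl her_scr !mulf_eq0 cj_eq0 (negbTE c0).
Qed.

Lemma nondegenerate x : (forall y, her y x = 0) -> x = vzero.
Proof.
move=> ort; have two0 := two_neq0 K.
have := ort (1, 0, 0); have := ort (0, 1, 0); have := ort (0, 0, 1).
move: x {ort} => [[a b] c]; rewrite /her /bil /= !(mul0r, mul1r, add0r, addr0, mulr0, subr0, sub0r).
move=> /eqP e1 /eqP e2 /eqP e3; move: e1 e2 e3.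
by rewrite !oppr_eq0 !mulf_eq0 (negbTE two0) /= !cj_eq0 => /eqP-> /eqP-> /eqP->.
Qed.

(** The Witt index is 1: the Gram determinant of x, y and any z vanishes, hence so does [det3 x y z]
    for every z, and with it [crs x y]. *)
Lemma isotropic_dependent x y : x != vzero -> her x x = 0 -> her y y = 0 -> her x y = 0 ->
  exists c, y = scv c x.
Proof.
move=> x0 hx hy hxy; apply: crs_eq0 => //.
suff E : cjv (crs x y) = vzero by rewrite -(cjvK (crs x y)) E /cjv /= !rmorph0.
apply: nondegenerate => z; rewrite /her cjvK bilC bil_crs.
apply/eqP; rewrite mulf_eq0 (negbTE (two_neq0 K)) /=.
have hyx : her y x = 0 by rewrite -her_cj hxy rmorph0.
have : - 4 * (det3 x y z * det3 (cjv x) (cjv y) (cjv z)) = 0.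
  by rewrite det3_gram -!/(her _ _) hx hy hxy hyx; ring.
move/eqP; rewrite -det3_cj !mulf_eq0 cj_eq0 orbb oppr_eq0.
by rewrite (negbTE (four_neq0 K)).
Qed.

End BinaryForms.

(** * The sign of a generator *)

Section Generators.
Variable K : quadext.
Implicit Types (x y z w v u t : vec K) (c d s : K).
Local Notation q := (ord_q K).
Local Notation ii := (ii K).
Local Notation two0 := (two_neq0 K).

Definition comb x y u t := vadd (scv t.1.1 x) (vadd (scv t.1.2 y) (scv t.2 u)).

Lemma comb_inj x y u : det3 x y u != 0 -> injective (comb x y u).
Proof.
move=> D0 t t' E; apply: vec_eqP; split; apply: (mulIf D0).
- have e t0 : det3 (comb x y u t0) y u = t0.1.1 * det3 x y u by rewrite /det3 /=; ring.
  by rewrite -!e E.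
- have e t0 : det3 x (comb x y u t0) u = t0.1.2 * det3 x y u by rewrite /det3 /=; ring.
  by rewrite -!e E.
- have e t0 : det3 x y (comb x y u t0) = t0.2 * det3 x y u by rewrite /det3 /=; ring.
  by rewrite -!e E.
Qed.

Lemma comb_onto x y u v : det3 x y u != 0 -> exists t, v = comb x y u t.
Proof.
move=> D0; have /injF_onto/(_ v) := comb_inj D0.
by case/codomP=> t ->; exists t.
Qed.

Lemma her_comb x y u t z :
  her (comb x y u t) z = t.1.1 * her x z + t.1.2 * her y z + t.2 * her u z.
Proof. by rewrite /comb !her_addl !her_scl addrA. Qed.

Lemma her_combr x y u t z :
  her z (comb x y u t) = cj t.1.1 * her z x + cj t.1.2 * her z y + cj t.2 * her z u.
Proof. by rewrite /comb !her_addr !her_scr addrA. Qed.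

(** Conjugating the arguments turns orthogonality for [bil] into orthogonality for [her]. It
    completes a nonorthogonal isotropic pair to a basis. *)
Definition nrm x y := crs (cjv x) (cjv y).

Lemma her_nrml x y : her (nrm x y) x = 0.
Proof. by rewrite /her /nrm bil_crs /det3; ring. Qed.

Lemma her_nrmr x y : her (nrm x y) y = 0.
Proof. by rewrite /her /nrm bil_crs /det3; ring. Qed.

Lemma her_nrm_nrm x y : her x x = 0 -> her (nrm x y) (nrm x y) = her x y * cj (her x y).
Proof.
move=> hx; rewrite /her /nrm crs_cjv !cjvK bil_crs_crs (bilC (cjv x) x) -/(her x x) hx.
by rewrite mul0r sub0r opprK [in RHS]bil_cj cjvK mulrC (bilC (cjv y) x).
Qed.

Lemma det3_nrm x y : her x x = 0 -> her x y != 0 -> det3 x y (nrm x y) != 0.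
Proof.
move=> hx hxy; apply: contraNneq hxy => D.
have : bil (crs x y) (nrm x y) = 0 by rewrite bil_crs D mulr0.
rewrite /nrm bil_crs_crs -!/(her _ _) hx mul0r sub0r opprK => /eqP.
by rewrite mulf_eq0 [her y x == 0]her_eq0C orbb.
Qed.

(** An auxiliary form that is not orthogonal to the isotropic form x; by [LamE] its choice does not
    affect [Lam]. *)
Definition wit x : vec K := if x.1.1 != 0 then (0, 0, 1) else (1, 0, 0).

Lemma her_wit x : iso x -> her (wit x) x != 0.
Proof.
case/andP=> x0 /eqP hx; rewrite /wit; case: (eqVneq x.1.1 0) => [a0|a0] /=; last first.
  by rewrite /her /bil /= !(mul0r, mul1r, sub0r, add0r, addr0) oppr_eq0 mulf_eq0 negb_or two0 cj_eq0.
rewrite /her /bil /= !(mul0r, mul1r, sub0r, add0r, addr0) oppr_eq0 mulf_eq0 negb_or two0.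
rewrite cj_eq0; apply: contraNneq x0 => c0.
move: hx; rewrite /her /bil /= a0 c0 !(mul0r, addr0, mulr0, subr0) => /eqP.
by rewrite mulf_eq0 cj_eq0 orbb => /eqP b0; apply/eqP/vec_eqP.
Qed.

Lemma iso_neq0 x : iso x -> x != vzero K. Proof. by case/andP. Qed.

Lemma iso_her x : iso x -> her x x = 0. Proof. by case/andP=> _ /eqP. Qed.

(* The coordinate of w on the line x^perp / x; it rests on the canonical pairing given by the
   determinant, and makes the generator <(x, 0), (w, 1)> comparable with the others. *)
Definition Lam x w := 2 * ii * det3 w x (wit x) / her (wit x) x.

(** Pairing Cramer's relation between x, z, [wit x] and w with x leaves only the terms of z and
    [wit x], which shows that [det3 w x z / her z x] is the same for both. *)
Lemma LamE z x w : iso x -> her w x = 0 -> her z x != 0 ->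
  Lam x w = 2 * ii * det3 w x z / her z x.
Proof.
move=> ix hw hz; have hz0 := her_wit ix; have hx := iso_her ix.
have E : det3 w x (wit x) * her z x = det3 w x z * her (wit x) x.
  have /(congr1 (fun v => her v x)) := det3_cramer x z (wit x) w.
  rewrite !her_addl !her_scl hw hx !mulr0 add0r => /esym/eqP; rewrite addr_eq0 => /eqP.
  have -> : det3 x w (wit x) = - det3 w x (wit x) by rewrite /det3; ring.
  have -> : det3 x z w = det3 w x z by rewrite /det3; ring.
  by rewrite mulNr => /oppr_inj.
by rewrite /Lam -!mulrA; congr (_ * (_ * _)); apply/eqP; rewrite eqr_div // E.
Qed.

(** The Gram determinant of w, x and z is -4 times the norm of [det3 w x z]. As [ii] lies in F_q,
    the factor [2 * ii] in [Lam] has norm -4 and compensates for this. *)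
Lemma Lam_norm x w : iso x -> her w x = 0 -> her w w = -1 -> Lam x w * cj (Lam x w) = 1.
Proof.
move=> ix hw hww; have hz := her_wit ix; have hx := iso_her ix.
rewrite /Lam; set z := wit x; have hcz : cj (her z x) != 0 by rewrite cj_eq0.
have : - 4 * (det3 w x z * cj (det3 w x z)) = her z x * cj (her z x).
  have hxw : her x w = 0 by rewrite -her_cj hw rmorph0.
  rewrite det3_cj det3_gram -!/(her _ _) hx hw hww hxw -[cj _]/(cj (her z x)) her_cj; ring.
rewrite !rmorphM !fmorphV rmorph_nat /= cj_ii => E.
set a := det3 w x z in E *; have i2 := ii_sq K; rewrite -/z in hz.
have -> : 2 * ii * a / her z x * (2 * ii * cj a / cj (her z x)) =
    4 * ii ^+ 2 * (a * cj a) / (her z x * cj (her z x)) by field; rewrite hcz hz.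
rewrite i2 -E mulrN1; apply: divff.
by rewrite E mulf_neq0.
Qed.

Lemma Lam_scl c x w : c != 0 -> iso x -> her w x = 0 -> Lam (scv c x) w = c / cj c * Lam x w.
Proof.
move=> c0 ix hw; rewrite (@LamE (wit x) (scv c x)) ?iso_sc // her_scr ?hw ?mulr0 //.
  have -> : det3 w (scv c x) (wit x) = c * det3 w x (wit x) by rewrite /det3 /=; ring.
  by rewrite /Lam; field; rewrite cj_eq0 c0 her_wit.
by rewrite mulf_neq0 ?cj_eq0 ?her_wit.
Qed.

Lemma Lam_scr c x w : Lam x (scv c w) = c * Lam x w.
Proof.
have -> : Lam x (scv c w) = 2 * ii * (c * det3 w x (wit x)) / her (wit x) x.
  by rewrite /Lam; congr (_ * _ / _); rewrite /det3 /=; ring.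
by rewrite /Lam; ring.
Qed.

Lemma Lam_addr c x w : Lam x (vadd w (scv c x)) = Lam x w.
Proof.
by rewrite /Lam; congr (_ * _ / _); rewrite /det3 /=; ring.
Qed.

Definition sgL x w := sg (Lam x w).

(** With y as auxiliary form for x, and x for y, the two coordinates of w differ by the factor
    [- her x y / cj (her x y)]. [sg_div] turns the quotient into [chi], and the minus sign is
    [sg (-1)]; this is how the two-graph enters. *)
Lemma sgL_mul x y w : iso x -> iso y -> her x y != 0 -> her w x = 0 -> her w y = 0 ->
  her w w = -1 -> sgL x w * sgL y w = - chi (her x y).
Proof.
move=> ix iy hxy hwx hwy hww; have hyx : her y x != 0 by rewrite her_eq0C.
have E : Lam x w = - (her x y / cj (her x y) * Lam y w).
  rewrite (LamE ix hwx hyx) (LamE iy hwy hxy) her_cj.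
  have -> : det3 w y x = - det3 w x y by rewrite /det3; ring.
  by field; rewrite hxy hyx.
have Ny := Lam_norm iy hwy hww.
have Nc : her x y / cj (her x y) * cj (her x y / cj (her x y)) = 1.
  by rewrite rmorphM fmorphV /= her_cj her_cj; field; rewrite hxy hyx.
rewrite /sgL E sgN; last by rewrite rmorphM /= mulrACA Nc Ny mulr1.
by rewrite (sgM Nc Ny) sg_div // mulNr -mulrA sgx_sq mulr1.
Qed.

Lemma sgL_sq x w : sgL x w * sgL x w = 1. Proof. exact: sgx_sq. Qed.

Lemma sgL_scl c x w : c != 0 -> iso x -> her w x = 0 -> her w w = -1 ->
  sgL (scv c x) w = chi c * sgL x w.
Proof.
move=> c0 ix hw hww; rewrite /sgL Lam_scl // sgM ?sg_div ?Lam_norm //.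
by rewrite rmorphM fmorphV /= cjK; field; rewrite cj_eq0 c0.
Qed.

Lemma sgL_opp x w : iso x -> her w x = 0 -> her w w = -1 -> sgL x (scv (-1) w) = - sgL x w.
Proof. by move=> ix hw hww; rewrite /sgL Lam_scr mulN1r sgN ?Lam_norm. Qed.

Lemma card_perp_pair x y : iso x -> iso y -> her x y != 0 ->
  #|[set w | [&& her w x == 0, her w y == 0 & her w w == -1]]| = q.+1.
Proof.
move=> ix iy hxy; pose u := nrm x y; have hx := iso_her ix; have hy := iso_her iy.
have hyx : her y x != 0 by rewrite her_eq0C.
have hu : her u u != 0 by rewrite her_nrm_nrm // mulf_neq0 ?cj_eq0.
have u0 : u != vzero K by apply: contraNneq hu => ->; rewrite her0l.
have rc : real (- (her u u)^-1) by apply/realP; rewrite rmorphN fmorphV /= her_cj.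
rewrite -(card_norm rc) ?oppr_eq0 ?invr_eq0 //.
rewrite -(card_imset _ (@scv_injl _ u u0)); apply: eq_card => w; apply/idP/imsetP.
  rewrite inE => /and3P[/eqP hwx /eqP hwy /eqP hww].
  have [t wE] := comb_onto w (det3_nrm hx hxy).
  move: hwx hwy; rewrite wE !her_comb hx hy her_nrml her_nrmr !mulr0 !addr0 add0r => /eqP.
  rewrite mulf_eq0 (negbTE hyx) orbF => /eqP t2 /eqP.
  rewrite mulf_eq0 (negbTE hxy) orbF => /eqP t1.
  have wE' : w = scv t.2 u by rewrite wE /comb t1 t2 !scv0; apply: vec_eqP; rewrite /= !add0r.
  exists t.2; last by rewrite -wE wE'.
  rewrite inE; move: hww; rewrite wE' her_scl her_scr mulrA => /(canRL (mulfK hu)) ->.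
  by rewrite mulN1r.
case=> c; rewrite !inE => /eqP Nc ->; rewrite !her_scl her_scr her_nrml her_nrmr !mulr0 !eqxx /=.
by rewrite mulrA Nc mulNr mulVf.
Qed.

Lemma card_perp_iso x : iso x ->
  #|[set w | (her w x == 0) && (her w w == -1)]| = (q ^ 2 * q.+1)%N.
Proof.
move=> ix; pose y := wit x; pose u := nrm x y; have hx := iso_her ix.
have hxy : her x y != 0 by rewrite her_eq0C her_wit.
have hyx : her y x != 0 by rewrite her_eq0C.
have hu : her u u != 0 by rewrite her_nrm_nrm // mulf_neq0 ?cj_eq0.
have hux : her u x = 0 := her_nrml x y.
have hxu : her x u = 0 by rewrite -her_cj hux rmorph0.
have rc : real (- (her u u)^-1) by apply/realP; rewrite rmorphN fmorphV /= her_cj.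
rewrite -(card_norm rc) ?oppr_eq0 ?invr_eq0 // -card_quadext -cardsT -cardsX.
pose f (p : K * K) := comb x y u (p.1, 0, p.2).
have f_inj : injective f by move=> [a b] [a' b'] /(comb_inj (det3_nrm hx hxy)) [-> ->].
have herf p : her (f p) (f p) = p.2 * cj p.2 * her u u.
  by rewrite her_comb !her_combr /= hx hux hxu rmorph0; ring.
rewrite -(card_imset _ f_inj); apply: eq_card => w; apply/idP/imsetP.
  rewrite inE => /andP[/eqP hwx /eqP hww].
  have [t wE] := comb_onto w (det3_nrm hx hxy).
  move: hwx; rewrite wE her_comb hx her_nrml !mulr0 addr0 add0r => /eqP.
  rewrite mulf_eq0 (negbTE hyx) orbF => /eqP t2.
  have wE' : w = f (t.1.1, t.2) by rewrite wE /f; case: (t) t2 => [[a b] c] /= ->.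
  exists (t.1.1, t.2); last by rewrite -wE wE'.
  rewrite !inE /=; move: hww; rewrite wE' herf => /(canRL (mulfK hu)) /= ->.
  by rewrite mulN1r.
case=> p; rewrite !inE /= => /eqP Nc ->; rewrite herf Nc mulNr mulVf // eqxx andbT.
by rewrite her_comb hx hux !mulr0 mul0r !addr0.
Qed.

End Generators.

(** * Counting isotropic forms *)

Section Counting.
Variable K : quadext.
Implicit Types (x y z w v u t : vec K) (c d s : K) (V : vec K -> int).
Local Notation q := (ord_q K).
Local Notation two0 := (two_neq0 K).

Lemma q_gt0 : (0 < q)%N. Proof. exact: ltnW (q_gt1 K). Qed.

Lemma card_norm_eq c : real c -> #|[set s : K | s * cj s == c]| = (if c == 0%R then 1 else q.+1)%N.
Proof.
move=> rc; case: eqVneq => [->|c0]; last exact: card_norm.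
rewrite -(cards1 (0 : K)); apply: eq_card => s.
by rewrite !inE mulf_eq0 cj_eq0 orbb.
Qed.

Lemma big_vec (R : Type) (idx : R) (op : Monoid.com_law idx) (f : vec K -> R) :
  \big[op/idx]_x f x =
    \big[op/idx]_(a : K) \big[op/idx]_(b : K) \big[op/idx]_(c : K) f (a, b, c).
Proof.
rewrite pair_bigA pair_bigA /=.
by apply: eq_bigr => -[[a b] c].
Qed.

Lemma card_sum (T : finType) (P : pred T) : #|[set x | P x]| = (\sum_x P x)%N.
Proof. by rewrite -sum1dep_card big_mkcond; apply: eq_bigr => x _; case: (P x). Qed.

(** If a = 0, the equation forces b = 0 and leaves c free; otherwise it prescribes the trace of
    [a * cj c], so that each b admits q values of c. *)
Lemma card_isotropic : (#|[set x : vec K | her x x == 0%R]| + q ^ 3 = q ^ 5 + q ^ 2)%N.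
Proof.
rewrite card_sum big_vec /=.
have row0 : (\sum_(b : K) \sum_(c : K) (her ((0%R, b, c) : vec K) (0%R, b, c) == 0%R) = q ^ 2)%N.
  rewrite (bigD1 0) //= [X in (_ + X)%N]big1 => [|b b0].
    rewrite addn0 -card_quadext -sum1_card; apply: eq_bigr => c _.
    by rewrite /her /bil /= rmorph0 !(mulr0, mul0r, addr0, subr0) eqxx.
  apply: big1 => c _; rewrite /her /bil /= rmorph0 !(mulr0, mul0r, addr0, subr0).
  by rewrite mulf_eq0 cj_eq0 orbb (negbTE b0).
have rowa a b : a != 0 -> (\sum_(c : K) (her ((a, b, c) : vec K) (a, b, c) == 0%R) = q)%N.
  move=> a0; have rN : real (b * cj b / 2).
    by apply/realP; rewrite rmorphM fmorphV rmorph_nat /= rmorphM /= cjK [cj b * b]mulrC.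
  rewrite -card_sum -(card_trace rN).
  have inj_cja : injective (fun c => cj c * a).
    by move=> c d /(mulIf a0)/(can_inj (@cjK K)).
  rewrite -(card_imset _ inj_cja); apply: eq_card => s; rewrite !inE; apply/imsetP/idP.
    case=> c; rewrite inE /her /bil /= subr_eq0 => /eqP e ->.
    rewrite e rmorphM /= cjK; apply/eqP; field; exact: two0.
  move/eqP=> e; exists (cj (s / a)); last by rewrite cjK divfK.
  rewrite inE /her /bil /= cjK rmorphM fmorphV /= subr_eq0; apply/eqP.
  have -> : b * cj b = 2 * (s + cj s) by rewrite e; field; exact: two0.
  by field; rewrite cj_eq0 a0.
rewrite (bigD1 0) //= row0.
rewrite (eq_bigr (fun=> q ^ 3)%N) => [|a a0]; last first.
  rewrite (eq_bigr (fun=> q)) => [|b _]; last exact: rowa.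
  by rewrite sum_nat_const card_quadext -expnSr.
rewrite sum_nat_const cardC1 card_quadext.
have : (0 < q ^ 2)%N by rewrite expn_gt0 q_gt0.
by case: (q ^ 2)%N (expnD q 2 3) => // k /= -> _; rewrite mulSn; lia.
Qed.

Lemma card_iso : #|[set x : vec K | iso x]| = ((q ^ 2 - 1) * (q ^ 3 + 1))%N.
Proof.
have := cardsD1 (vzero K) [set x : vec K | her x x == 0].
rewrite inE her0l eqxx /=.
have -> : [set x : vec K | her x x == 0] :\ vzero K = [set x | iso x].
  by apply/setP=> x; rewrite !inE.
have := card_isotropic; have := q_gt1 K; rewrite !expnS !expn0.
by set n := #|_|; set n' := #|_|; nia.
Qed.

Lemma card_iso_perp w : her w w = -1 ->
  #|[set x | iso x && (her w x == 0)]| = ((q ^ 2 - 1) * q.+1)%N.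
Proof.
move=> hw; pose P := [set x | her w x == 0].
pose f (p : vec K * K) := vadd p.1 (scv p.2 w).
pose g v : vec K * K := (vadd v (scv (her v w) w), - her v w).
have fK p : p.1 \in P -> g (f p) = p.
  rewrite inE her_eq0C => /eqP h; rewrite /g /f her_addl h her_scl hw.
  case: p {h} => x c /=; rewrite add0r mulrN1 opprK; congr pair.
  by apply: vec_eqP; rewrite /= !mulNr !addrK.
have gK v : f (g v) = v by apply: vec_eqP; rewrite /f /g /= !mulNr !addrK.
have gP v : (g v).1 \in P.
  by rewrite inE her_eq0C /g /= her_addl her_scl hw mulrN1 subrr.
have herf p : p.1 \in P -> her (f p) (f p) = her p.1 p.1 - p.2 * cj p.2.
  rewrite inE => /eqP h; have h' : her p.1 w = 0 by rewrite -her_cj h rmorph0.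
  by rewrite /f !her_addl !her_addr !her_scl !her_scr h h' hw; ring.
have finj : {in setX P [set: K] &, injective f}.
  by move=> p p'; rewrite !inE !andbT => Pp Pp' /(congr1 g); rewrite !fK ?inE.
have cardP : #|P| = (q ^ 4)%N.
  have : (#|P| * q ^ 2 = q ^ 4 * q ^ 2)%N.
    rewrite -[in LHS]card_quadext -cardsT -cardsX -(card_in_imset finj).
    have -> : f @: setX P [set: K] = [set: vec K].
      by apply/setP=> v; rewrite inE; apply/imsetP; exists (g v); rewrite ?gK // inE gP inE.
    by rewrite cardsT !card_prod card_quadext -!expnD.
  by move/eqP; rewrite eqn_pmul2r ?expn_gt0 ?q_gt0 // => /eqP.
pose n0 := #|[set x in P | her x x == 0]|.
(* Every vector is x + c w with x orthogonal to w, and it is isotropic when c has norm [her x x]: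
   one c if x is isotropic, q + 1 otherwise. Comparing with the known total gives [n0]. *)
have E : #|[set v : vec K | her v v == 0%R]| = (n0 + (q ^ 4 - n0) * q.+1)%N.
  have finj' : {in [set p | (p.1 \in P) && (p.2 * cj p.2 == her p.1 p.1)] &, injective f}.
    by move=> p p'; rewrite !inE => /andP[Pp _] /andP[Pp' _]; apply: finj; rewrite !inE andbT.
  have -> : [set v : vec K | her v v == 0] =
      f @: [set p | (p.1 \in P) && (p.2 * cj p.2 == her p.1 p.1)].
    apply/setP=> v; rewrite inE; apply/idP/imsetP => [hv|[p]].
      exists (g v); rewrite ?gK // inE gP eq_sym -subr_eq0 -herf ?gP // gK hv //.
    by rewrite inE => /andP[Pp /eqP hp] ->; rewrite herf // hp subrr.
  rewrite (card_in_imset finj') -sum1dep_card -(pair_big_dep (mem P) (fun x c => c * cj c == her x x) (fun _ _ => 1%N)) /=.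
  rewrite (eq_bigr (fun x => if her x x == 0%R then 1 else q.+1)%N) => [|x _]; last first.
    by rewrite sum1dep_card card_norm_eq ?her_real.
  rewrite (bigID (fun x => her x x == 0)) /=; congr (_ + _)%N.
    rewrite /n0 -sum1dep_card; apply: eq_big => [x|x /andP[_ ->]] //.
  rewrite (eq_bigr (fun=> q.+1)) => [|x /andP[_ /negbTE->]] //.
  rewrite sum_nat_const; congr (_ * _)%N; rewrite -cardP.
  rewrite -(cardID (fun x => her x x == 0) P) /n0.
  have -> : #|[predI P & fun x => her x x == 0]| = #|[set x in P | her x x == 0]|.
    by apply: eq_card => x; rewrite !inE.
  by rewrite addKn; apply: eq_card => x; rewrite !inE [in LHS]unfold_in /= inE andbC.
have n0le : (n0 <= q ^ 4)%N.
  by rewrite -cardP subset_leq_card //; apply/subsetP=> x; rewrite inE => /andP[].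
have n0E : (n0 + q = q ^ 3 + q ^ 2)%N.
  have := card_isotropic; rewrite E => {}E; have := q_gt0 => q0.
  apply/eqP; rewrite -(eqn_pmul2r q0); apply/eqP.
  move: E n0le; rewrite !expnS !expn0 !muln1.
  by set r := (q * (q * (q * q)))%N; nia.
have -> : [set x | iso x && (her w x == 0)] = [set x in P | her x x == 0] :\ vzero K.
  by apply/setP=> x; rewrite !inE /iso -andbA [(her x x == 0) && _]andbC.
have := cardsD1 (vzero K) [set x in P | her x x == 0]; rewrite -/n0.
rewrite !inE her_eq0C !her0l eqxx /=; move: n0E; rewrite !expnS !expn0.
by have := q_gt0; nia.
Qed.

Definition homog V := forall c x, c != 0 -> iso x -> V (scv c x) = chi c * V x.

Definition esum V w : int := \sum_(x | iso x && (her w x == 0)) V x * sgL x w.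

Definition twograph V x : int := \sum_(y | iso y) chi (her x y) * V y.

Lemma esumD V V' w : esum (fun x => V x + V' x) w = esum V w + esum V' w.
Proof. by rewrite /esum -big_split; apply: eq_bigr => x _; rewrite mulrDl. Qed.

Lemma esumZ k V w : esum (fun x => k * V x) w = k * esum V w.
Proof. by rewrite /esum mulr_sumr; apply: eq_bigr => x _; rewrite mulrA. Qed.

Lemma card_scv_iso x : iso x -> #|[set y | iso y && (her x y == 0)]| = (q ^ 2 - 1)%N.
Proof.
move=> ix; have x0 := iso_neq0 ix.
rewrite -card_nonzero -(card_imset _ (@scv_injl _ x x0)); apply: eq_card => y; apply/idP/imsetP.
  rewrite inE => /andP[iy /eqP hxy].
  have [c yE] := isotropic_dependent x0 (iso_her ix) (iso_her iy) hxy.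
  exists c; rewrite // !inE; apply: contraTneq iy => c0.
  by rewrite yE c0 scv0 /iso eqxx.
case=> c; rewrite !inE => c0 ->; rewrite iso_sc // ix her_scr (iso_her ix) mulr0 eqxx //.
Qed.

(* A vector V of signs gives a hemisystem when esum V vanishes, so that the sum of squares below
   turns this into an eigenvalue equation for the unitary two-graph. *)
Lemma sum_esum_sqr V : homog V ->
  \sum_(w | her w w == -1) esum V w ^+ 2 =
  \sum_(x | iso x) (V x ^+ 2 * ((q ^ 2 - 1) * q ^ 2 * q.+1)%N%:Z - q.+1%:Z * (V x * twograph V x)).
Proof.
move=> hV.
pose P x y w := [&& her w x == 0, her w y == 0 & her w w == -1].
transitivity (\sum_(x | iso x) \sum_(y | iso y)
    V x * V y * \sum_(w | P x y w) sgL x w * sgL y w).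
  transitivity (\sum_(w | her w w == -1) \sum_(x | iso x && (her w x == 0))
      \sum_(y | iso y && (her w y == 0)) V x * V y * (sgL x w * sgL y w)).
    apply: eq_bigr => w _; rewrite expr2 /esum big_distrlr /=.
    by apply: eq_bigr => x _; apply: eq_bigr => y _; rewrite mulrACA.
  rewrite (exchange_big_dep (fun x => iso x)) /=; last by move=> w x _ /andP[].
  apply: eq_bigr => x ix; rewrite (exchange_big_dep (fun y => iso y)) /=; last first.
    by move=> w x' _ /andP[].
  apply: eq_bigr => y iy; rewrite mulr_sumr; apply: eq_bigl => w.
  by rewrite /P ix iy /= -!andbA andbCA; congr (_ && _); rewrite andbC.
apply: eq_bigr => x ix.
pose R : int := (q ^ 2 * q.+1)%N%:Z.
(* For a nonorthogonal pair, all q + 1 common perpendiculars w of norm -1 give the same product. *)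
have far y : iso y -> her x y != 0 ->
    \sum_(w | P x y w) sgL x w * sgL y w = - (q.+1%:Z * chi (her x y)).
  move=> iy hxy; rewrite (eq_bigr (fun=> - chi (her x y))) => [|w]; last first.
    by case/and3P=> /eqP ? /eqP ? /eqP ?; apply: sgL_mul.
  rewrite sumr_const -(card_perp_pair ix iy hxy) -mulr_natl mulrN natz.
  by congr (- (Posz _ * _)); apply: eq_card => w; rewrite !inE.
(* Orthogonal isotropic forms are proportional; the factor [chi c] then occurs both in [V y] and in
   [sgL y w] and cancels. *)
have near y : iso y -> her x y = 0 ->
    V x * V y * (\sum_(w | P x y w) sgL x w * sgL y w) = V x ^+ 2 * R.
  move=> iy hxy; have [c yE] := isotropic_dependent (iso_neq0 ix) (iso_her ix) (iso_her iy) hxy.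
  have c0 : c != 0 by apply: contraTneq iy => c0; rewrite yE c0 scv0 /iso eqxx.
  have -> : \sum_(w | P x y w) sgL x w * sgL y w = chi c * R.
    rewrite (eq_bigl (fun w => (her w x == 0) && (her w w == -1))) => [|w]; last first.
      by rewrite /P yE her_scr mulf_eq0 cj_eq0 (negbTE c0) /= andbA andbb.
    rewrite (eq_bigr (fun=> chi c)) => [|w /andP[/eqP hwx /eqP hww]]; last first.
      by rewrite yE sgL_scl // mulrCA sgL_sq mulr1.
    rewrite sumr_const /R -(card_perp_iso ix) -mulr_natr natz.
    by congr (_ * Posz _); apply: eq_card => w; rewrite !inE.
  rewrite yE hV //; have := chi_neq0 c0; move: (chi c) (V x) => a e a1.
  by transitivity (a * a * (e ^+ 2 * R)); [ring | rewrite a1 mul1r].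
rewrite (bigID (fun y => her x y == 0)) /=; congr (_ + _).
  rewrite (eq_bigr (fun=> V x ^+ 2 * R)) => [|y /andP[iy /eqP h]]; last exact: near.
  rewrite sumr_const -mulr_natr natz -mulrA; congr (_ * _).
  have -> : #|[pred y | iso y & her x y == 0]| = (q ^ 2 - 1)%N.
    by rewrite -(card_scv_iso ix); apply: eq_card => y; rewrite !inE.
  by rewrite /R -PoszM; congr Posz; rewrite mulnC !mulnA.
rewrite /twograph !mulr_sumr -sumrN [in RHS](bigID (fun y => her x y == 0)) /=.
rewrite [X in _ = X + _]big1 => [|y /andP[_ /eqP->]]; last by rewrite chi0 mul0r !mulr0 oppr0.
by rewrite add0r; apply: eq_bigr => y /andP[iy h]; rewrite far //; ring.
Qed.

End Counting.

(** * Substitutions and the three kinds of isotropic forms *)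

Section Substitution.
Variable K : quadext.
Implicit Types (x y z w v u r : vec K) (c d s e : K) (V : vec K -> int) (g : K * K * K * K).
Local Notation two0 := (two_neq0 K).
Local Notation tau := (tau K).
Local Notation tau0 := (tau_neq0 K).

Definition gdet g := let: (al, be, ga, de) := g in al * de - be * ga.

Definition realg g := let: (al, be, ga, de) := g in [&& real al, real be, real ga & real de].

(* The form x after the substitution S -> al S + be T, T -> ga S + de T, divided by the
   determinant, which makes it an isometry of the discriminant. *)
Definition act g x : vec K := let: (al, be, ga, de) := g in
  scv (al * de - be * ga)^-1
    (x.1.1 * al ^+ 2 + x.1.2 * (al * ga) + x.2 * ga ^+ 2,
     2 * x.1.1 * (al * be) + x.1.2 * (al * de + be * ga) + 2 * x.2 * (ga * de),
     x.1.1 * be ^+ 2 + x.1.2 * (be * de) + x.2 * de ^+ 2).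

Definition ginv g : K * K * K * K := let: (al, be, ga, de) := g in (de, - be, - ga, al).

Lemma act_scv g c x : act g (scv c x) = scv c (act g x).
Proof. by case: g => [[[al be] ga] de]; apply: vec_eqP; split; rewrite /=; ring. Qed.

Lemma act_add g x y : act g (vadd x y) = vadd (act g x) (act g y).
Proof. by case: g => [[[al be] ga] de]; apply: vec_eqP; split; rewrite /=; ring. Qed.

Lemma actK g : gdet g != 0 -> cancel (act g) (act (ginv g)).
Proof.
case: g => [[[al be] ga] de] /= D x.
by apply: vec_eqP; split; rewrite /=; field.
Qed.

Lemma bil_act g x y : gdet g != 0 -> bil (act g x) (act g y) = bil x y.
Proof. by case: g => [[[al be] ga] de] /= D; rewrite /bil /=; field. Qed.

Lemma det3_act g x y z : gdet g != 0 -> det3 (act g x) (act g y) (act g z) = det3 x y z.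
Proof. by case: g => [[[al be] ga] de] /= D; rewrite /det3 /=; field. Qed.

Lemma cjv_act g x : realg g -> cjv (act g x) = act g (cjv x).
Proof.
case: g => [[[al be] ga] de] /= /and4P[/realP e1 /realP e2 /realP e3 /realP e4].
by apply: vec_eqP; rewrite /= !(rmorph_nat, rmorphM, fmorphV, rmorphB, rmorphD, rmorphXn) /= e1 e2 e3 e4.
Qed.

Lemma real_gdet g : realg g -> real (gdet g).
Proof.
case: g => [[[al be] ga] de] /= /and4P[/realP e1 /realP e2 /realP e3 /realP e4].
by apply/realP; rewrite rmorphB !rmorphM /= e1 e2 e3 e4.
Qed.

Lemma her_act g x y : realg g -> gdet g != 0 -> her (act g x) (act g y) = her x y.
Proof. by move=> rg D; rewrite /her cjv_act // bil_act. Qed.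

Lemma act_inj g : gdet g != 0 -> injective (act g).
Proof. by move/actK/can_inj. Qed.

Lemma act_neq0 g x : gdet g != 0 -> (act g x != vzero K) = (x != vzero K).
Proof.
move=> D; have E : act g (vzero K) = vzero K.
  by rewrite -[X in act g X](scv0 (vzero K)) act_scv scv0.
by rewrite -{1}E (inj_eq (act_inj D)).
Qed.

Lemma iso_act g x : realg g -> gdet g != 0 -> iso (act g x) = iso x.
Proof. by move=> rg D; rewrite /iso act_neq0 // her_act. Qed.

Lemma sgL_act g x w : realg g -> gdet g != 0 -> iso x -> her w x = 0 ->
  sgL (act g x) (act g w) = sgL x w.
Proof.
move=> rg D ix hw; rewrite /sgL (@LamE _ (act g (wit x))) ?iso_act ?her_act ?her_wit //.
by rewrite det3_act.
Qed.

Lemma esum_act V g (k : int) w : realg g -> gdet g != 0 ->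
    (forall x, iso x -> V (act g x) = k * V x) ->
  esum V (act g w) = k * esum V w.
Proof.
move=> rg D hV; rewrite /esum (reindex_inj (act_inj D)) mulr_sumr /=.
apply: eq_big => [x|x]; first by rewrite iso_act ?her_act.
by rewrite iso_act ?her_act // => /andP[ix /eqP hw]; rewrite sgL_act // hV // mulrA.
Qed.

Lemma twograph_act V g (k : int) x : realg g -> gdet g != 0 ->
    (forall y, iso y -> V (act g y) = k * V y) ->
  twograph V (act g x) = k * twograph V x.
Proof.
move=> rg D hV; rewrite /twograph (reindex_inj (act_inj D)) mulr_sumr /=.
apply: eq_big => [y|y]; first by rewrite iso_act.
by rewrite iso_act // => iy; rewrite her_act // hV // mulrCA.
Qed.

Lemma twograph_scv V c x : twograph V (scv c x) = chi c * twograph V x.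
Proof.
by rewrite /twograph mulr_sumr; apply: eq_bigr => y _; rewrite her_scl chiM mulrA.
Qed.

Lemma esum_scv V c w : c * cj c = 1 -> her w w = -1 -> esum V (scv c w) = sg c * esum V w.
Proof.
move=> Nc hww; have c0 : c != 0.
  by apply/negP=> /eqP c0; move/eqP: Nc; rewrite c0 mul0r eq_sym oner_eq0.
rewrite /esum mulr_sumr; apply: eq_big => [x|x].
  by rewrite her_scl mulf_eq0 (negbTE c0).
rewrite her_scl mulf_eq0 (negbTE c0) => /andP[ix /eqP hw].
by rewrite /sgL Lam_scr sgM ?Lam_norm // mulrCA.
Qed.

(* The matrix of trace 0 that induces the rotation through pi about v. *)
Definition halfturn v : K * K * K * K := (v.1.2, 2 * v.2, - 2 * v.1.1, - v.1.2).

Lemma gdet_halfturn v : gdet (halfturn v) = - bil v v.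
Proof. by rewrite /= /bil; ring. Qed.

Lemma act_halfturn v x : bil v v != 0 -> bil x v = 0 -> act (halfturn v) x = scv (-1) x.
Proof.
move=> v0 xv.
(* Minus the reflection in the plane orthogonal to v. *)
suff -> : act (halfturn v) x = vadd (scv (2 * bil x v / bil v v) v) (scv (-1) x).
  by rewrite xv mulr0 mul0r scv0; apply: vec_eqP; rewrite /= !add0r.
have D := gdet_halfturn v; move: D v0; rewrite /= /bil => D v0.
by apply: vec_eqP; split; rewrite /=; field; rewrite D oppr_eq0 v0.
Qed.

Lemma cjv_entries r : cjv r = r -> [/\ cj r.1.1 = r.1.1, cj r.1.2 = r.1.2 & cj r.2 = r.2].
Proof. by case: r => [[a b] c] [e1 e2 e3]. Qed.

Lemma real_entries r : cjv r = r -> [/\ real r.1.1, real r.1.2 & real r.2].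
Proof. by case/cjv_entries => *; split; apply/realP. Qed.

Lemma realg_halfturn v : cjv v = v -> realg (halfturn v).
Proof.
case/cjv_entries=> e1 e2 e3.
by rewrite /= /real !(rmorphM, rmorphN, rmorph_nat) /= e1 e2 e3 !eqxx.
Qed.

(* V1, VO and V2 are supported on the isotropic forms whose discriminant is a nonzero square, zero
   and a nonsquare; a null isotropic form is a multiple of a real one. *)
Definition V1 x : int := psi (bil x x).

Definition VO x : int :=
  if bil x x == 0 then (if x.1.1 != 0 then chi x.1.1 else chi x.2) else 0.

Lemma V1_homog : homog V1.
Proof.
move=> c x c0 _; rewrite /V1 bil_scl bil_scr mulrA -expr2.
by rewrite psiM ?psi_sqr ?chi_sqr.
Qed.

Lemma VO_homog : homog VO.
Proof.
move=> c x c0 _; rewrite /VO bil_scl bil_scr !mulf_eq0 (negbTE c0) /=.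
by case: ifP => _; rewrite ?mulr0 //; case: ifP; rewrite chiM.
Qed.

Lemma V1_act g x : gdet g != 0 -> V1 (act g x) = V1 x.
Proof. by move=> D; rewrite /V1 bil_act. Qed.

Lemma null_entry r : r != vzero K -> bil r r = 0 -> (r.1.1 != 0) || (r.2 != 0).
Proof.
case: r => [[a b] c] r0; rewrite /bil /= => Q; rewrite -negb_and; apply: contraNN r0.
case/andP=> /eqP a0 /eqP c0; move: Q; rewrite a0 c0 !(mulr0, mul0r, addr0, subr0) => /eqP.
by rewrite mulf_eq0 orbb => /eqP ->.
Qed.

Lemma cjv_scale x c : x != vzero K -> cjv x = scv c x ->
  exists s r, [/\ s != 0, cjv r = r & x = scv s r].
Proof.
move=> x0 E.
suff [s s0 Es] : exists2 s, s != 0 & cj s = c * s.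
  exists s, (scv s^-1 x); split => //; last by rewrite scvA mulfV // scv1.
  have c0 : c != 0 by apply: contraNneq s0 => c0; rewrite -cj_eq0 Es c0 mul0r.
  rewrite scv_cjv E scvA fmorphV /= Es; congr (scv _ _).
  by field; rewrite s0 c0.
case: E => e1 e2 e3.
have [a0|a0] := eqVneq x.1.1 0; last by exists x.1.1.
have [b0|b0] := eqVneq x.1.2 0; last by exists x.1.2.
exists x.2 => //; apply: contraNneq x0 => c0; apply/eqP/vec_eqP; split=> //.
Qed.

(** [bil x x = 0] says that x is orthogonal to its conjugate for [her]. Both are isotropic, so they
    are proportional. *)
Lemma null_real x : iso x -> bil x x = 0 ->
  exists s r, [/\ s != 0, cjv r = r, r != vzero K, bil r r = 0 & x = scv s r].
Proof.
move=> ix Q; have x0 := iso_neq0 ix; have hx := iso_her ix.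
have [c E] : exists c, cjv x = scv c x.
  apply: isotropic_dependent => //; last by rewrite /her cjvK.
  by rewrite /her cjvK -[LHS](@cjK K) bil_cj cjvK -[cjv x]/(cjv x) -/(her x x) hx rmorph0.
have [s [r [s0 rr xE]]] := cjv_scale x0 E; exists s, r; split=> //.
  by apply: contraNneq x0 => r0; rewrite xE r0 scv_vzero.
by move/eqP: Q; rewrite xE bil_scl bil_scr !mulf_eq0 (negbTE s0) /= => /eqP.
Qed.

(** The outer coefficients of r lie in F_q, where [chi] is trivial, so it does not matter which
    nonzero one [VO] reads. *)
Lemma VO_real s r : cjv r = r -> r != vzero K -> bil r r = 0 -> s != 0 -> VO (scv s r) = chi s.
Proof.
move=> rr r0 Q s0; have := null_entry r0 Q.
rewrite /VO bil_scl bil_scr Q !mulr0 eqxx /= mulf_eq0 (negbTE s0) /=; have [e1 _ e3] := real_entries rr.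
by case: eqVneq => [_|a0 _] /= => [c0|]; rewrite chiM ?(chi_real e1) ?(chi_real e3) ?mulr1 //.
Qed.

Lemma VO_act g x : realg g -> gdet g != 0 -> iso x -> VO (act g x) = VO x.
Proof.
move=> rg D ix; have [Q|Q] := eqVneq (bil x x) 0; last first.
  by rewrite /VO bil_act // (negbTE Q).
have [s [r [s0 rr r0 Qr ->]]] := null_real ix Q.
by rewrite act_scv !VO_real ?cjv_act ?rr ?act_neq0 ?bil_act.
Qed.

(** A real null form is a constant times the square of a linear form over F_q; this is the quadratic
    character of that constant in F_q, read off from a nonzero outer coefficient. *)
Definition theta r : int := if r.1.1 != 0 then psi r.1.1 else psi r.2.

Lemma theta_opp r : theta (scv (-1) r) = theta r.
Proof. by rewrite /theta /= !mulN1r oppr_eq0 !psiN. Qed.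

Lemma psi_realM c d : real c -> c != 0 -> psi (c * d) = psi c * psi d.
Proof. by move=> rc c0; rewrite psiM ?chi_real. Qed.

Lemma psi_real_sqr c : real c -> c != 0 -> psi (c ^+ 2) = 1.
Proof. by move=> rc c0; rewrite psi_sqr chi_real. Qed.

Lemma realM c d : real c -> real d -> real (c * d).
Proof. by move=> /realP e1 /realP e2; apply/realP; rewrite rmorphM /= e1 e2. Qed.

Lemma realD c d : real c -> real d -> real (c + d).
Proof. by move=> /realP e1 /realP e2; apply/realP; rewrite rmorphD /= e1 e2. Qed.

Lemma realV c : real c -> real c^-1.
Proof. by move=> /realP e1; apply/realP; rewrite fmorphV /= e1. Qed.

Lemma realN c : real c -> real (- c).
Proof. by move=> /realP e1; apply/realP; rewrite rmorphN /= e1. Qed.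

(* All the nonzero values of a null form lie in the same square class. *)
Lemma psi_value r s c : cjv r = r -> r != vzero K -> bil r r = 0 -> real s -> real c ->
  let k := r.1.1 * s ^+ 2 + r.1.2 * (s * c) + r.2 * c ^+ 2 in k != 0 -> psi k = theta r.
Proof.
move=> rr r0 Q rs rc k k0; have [ra rb rd] := real_entries rr.
have rk : real k by rewrite /k !realD ?realM ?exprS ?expr0 ?mulr1.
have key e f : real e -> real f -> e != 0 -> e * k = f ^+ 2 -> psi k = psi e.
  move=> re rf e0 E; have f0 : f != 0.
    by apply: contraNneq (mulf_neq0 e0 k0) => f0; rewrite E f0 expr0n.
  have := psi_real_sqr rf f0; rewrite -E psi_realM // => E1.
  by rewrite -[LHS]mul1r -(psi_neq0 (chi_real re e0)) -mulrA E1 mulr1.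
have Q4 : r.1.2 ^+ 2 = 4 * (r.1.1 * r.2).
  by apply/eqP; rewrite -subr_eq0 -Q /bil; apply/eqP; ring.
have half := realV (real_nat K 2).
have := null_entry r0 Q; rewrite /theta; case: eqVneq => [a0 /= c0|a0 _] /=.
  apply: (key _ (r.1.2 * s / 2 + r.2 * c)) => //; first by rewrite !realD ?realM.
  have b0 : r.1.2 = 0 by move/eqP: Q4; rewrite a0 mul0r mulr0 expf_eq0 => /eqP.
  by rewrite /k a0 b0; field; exact: two0.
apply: (key _ (r.1.1 * s + r.1.2 * c / 2)) => //; first by rewrite !realD ?realM.
transitivity ((r.1.1 * s) ^+ 2 + r.1.1 * r.1.2 * (s * c) + 4 * (r.1.1 * r.2) / 4 * c ^+ 2).
  by rewrite /k; field; exact: four_neq0.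
by rewrite -Q4; field; rewrite two0 four_neq0.
Qed.

(** Before the division in [act], the outer coefficients of the transformed form are values of r, so
    [psi_value] applies; the factor comes from dividing by the determinant. *)
Lemma theta_act g r : realg g -> gdet g != 0 -> cjv r = r -> r != vzero K -> bil r r = 0 ->
  theta (act g r) = psi (gdet g) * theta r.
Proof.
move=> rg D rr r0 Q; have rD := real_gdet rg.
have := null_entry (_ : act g r != vzero K) (_ : bil (act g r) (act g r) = 0).
rewrite act_neq0 // bil_act // => /(_ r0 Q).
rewrite {1}/theta; case: g rg D rD => [[[al be] ga] de] /= /and4P[ral rbe rga rde] D rD.
case: eqVneq => [_ /= e|e _] /=; rewrite psi_realM ?realV ?invr_eq0 // psiV; congr (_ * _).
  by apply: psi_value => //; apply: contraNneq e => ->; rewrite mulr0.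
by apply: psi_value => //; apply: contraNneq e => ->; rewrite mulr0.
Qed.

Definition rev x : vec K := (re x.1.1, re x.1.2, re x.2).
Definition imv x : vec K := (im x.1.1, im x.1.2, im x.2).

Lemma cjv_rev x : cjv (rev x) = rev x.
Proof. by apply: vec_eqP; split; apply/realP/re_real. Qed.

Lemma cjv_imv x : cjv (imv x) = imv x.
Proof. by apply: vec_eqP; split; apply/realP/im_real. Qed.

Lemma rev_imv x : x = vadd (rev x) (scv tau (imv x)).
Proof. by apply: vec_eqP; split; apply: re_im. Qed.

Lemma bil_real r u : cjv r = r -> cjv u = u -> real (bil r u).
Proof. by move=> rr ru; apply/realP; rewrite bil_cj rr ru. Qed.

Lemma real_tau_eq0 c d : real c -> real d -> c + tau * d = 0 -> c = 0 /\ d = 0.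
Proof.
move=> /realP rc /realP rd E; have E' : c - tau * d = 0.
  by move/(congr1 (@cj K)): E; rewrite rmorphD rmorphM rmorph0 /= rc rd cj_tau mulNr.
have c0 : c = 0.
  apply: (mulfI two0); rewrite mulr0; transitivity (c + tau * d + (c - tau * d)); first ring.
  by rewrite E E' addr0.
by split=> //; apply: (mulfI tau0); rewrite mulr0 -E c0 add0r.
Qed.

Lemma cjv_tau_comb r u : cjv r = r -> cjv u = u ->
  cjv (vadd r (scv tau u)) = vadd r (scv (- tau) u).
Proof.
move=> /cjv_entries[e1 e2 e3] /cjv_entries[e4 e5 e6].
by apply: vec_eqP; rewrite /= !rmorphD !rmorphM /= cj_tau e1 e2 e3 e4 e5 e6.
Qed.

(** For y = r + tau u, [bil y y] has real part [bil r r + tau ^+ 2 * bil u u], while [her y y] is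
    [bil r r - tau ^+ 2 * bil u u]; both vanish here. *)
Lemma normalized_parts y : her y y = 0 -> bil y y = tau ->
  [/\ bil (rev y) (rev y) = 0, bil (imv y) (imv y) = 0 & 2 * bil (rev y) (imv y) = 1].
Proof.
move=> hy Qy; set r := rev y; set u := imv y.
have rr := cjv_rev y; have ru := cjv_imv y.
have Q : (bil r r + tau ^+ 2 * bil u u) + tau * (2 * bil r u - 1) = 0.
  transitivity (bil y y - tau); last by rewrite Qy subrr.
  by rewrite (rev_imv y) -/r -/u /bil /=; ring.
have Hh : bil r r - tau ^+ 2 * bil u u = 0.
  rewrite -hy (rev_imv y) -/r -/u /her.
  by rewrite (cjv_tau_comb rr ru) /bil /=; ring.
have [] := real_tau_eq0 _ _ Q.
- by apply: realD; [exact: bil_real | exact: realM (real_tau2 K) (bil_real ru ru)].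
- by apply: realD; [exact: realM (real_nat K 2) (bil_real rr ru) | apply/realN/realP; rewrite rmorph1].
move=> Q1 /eqP; rewrite subr_eq0 => /eqP Q2.
have R0 : bil r r = 0.
  apply: (mulfI two0); rewrite mulr0.
  transitivity (bil r r + tau ^+ 2 * bil u u + (bil r r - tau ^+ 2 * bil u u)); first ring.
  by rewrite Q1 Hh addr0.
split=> //; move/eqP: Q1; rewrite R0 add0r mulf_eq0 expf_eq0 /= (negbTE tau0).
by move/eqP.
Qed.

Lemma rev_neq0 y : her y y = 0 -> bil y y = tau -> rev y != vzero K.
Proof.
move=> hy Qy; have [_ _ B] := normalized_parts hy Qy.
apply/negP=> /eqP r0; move/eqP: B; rewrite r0 -(scv0 (vzero K)) bil_scl mul0r mulr0.
by rewrite eq_sym oner_eq0.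
Qed.

(** Dividing by [d] normalises the discriminant to [tau]; the real part is then a nonzero null form
    and has a [theta]. Replacing [d] by [- d] changes nothing, as [chi] and [theta] are even
    ([V2E]). *)
Definition V2 x : int :=
  if [pick d | (d != 0) && (bil x x == tau * d ^+ 2)] is Some d
  then chi d * theta (rev (scv d^-1 x)) else 0.

Lemma rev_scv_real c x : real c -> rev (scv c x) = scv c (rev x).
Proof.
move/realP=> rc; apply: vec_eqP; rewrite /= /re !rmorphM /= rc; split; ring.
Qed.

Lemma V2E d x : d != 0 -> bil x x = tau * d ^+ 2 -> V2 x = chi d * theta (rev (scv d^-1 x)).
Proof.
move=> d0 Q; rewrite /V2; case: pickP => [e /andP[e0 /eqP]|/(_ d)]; last by rewrite d0 Q eqxx.
rewrite Q => /(mulfI tau0)/eqP; rewrite eqf_sqr => /orP[]/eqP-> //.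
have -> : (- e)^-1 = -1 * e^-1 by rewrite invrN mulN1r.
rewrite -scvA chiN (@rev_scv_real (-1)) ?theta_opp //.
by apply/realP; rewrite rmorphN rmorph1.
Qed.

Lemma V2_square x : chi (bil x x) != -1 -> V2 x = 0.
Proof.
rewrite /V2; case: pickP => // d /andP[d0 /eqP->].
by rewrite chiM chi_sqr // mulr1 chi_tau eqxx.
Qed.

Lemma type2 x : chi (bil x x) = -1 -> exists2 d : K, d != 0 & bil x x = tau * d ^+ 2.
Proof.
move=> h; have [|d d0 E] := @chi_square K (tau^-1 * bil x x).
  by rewrite chiM chiV chi_tau h mulrNN mulr1.
by exists d => //; rewrite -E mulrA mulfV ?tau0 // mul1r.
Qed.

Lemma normalize d x : d != 0 -> bil x x = tau * d ^+ 2 -> bil (scv d^-1 x) (scv d^-1 x) = tau.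
Proof. by move=> d0 Q; rewrite bil_scl bil_scr Q; field. Qed.

Lemma V2_act g x : realg g -> gdet g != 0 -> iso x -> V2 (act g x) = psi (gdet g) * V2 x.
Proof.
move=> rg D ix; have [h|h] := eqVneq (chi (bil x x)) (-1); last first.
  by rewrite !V2_square ?bil_act ?mulr0.
have [d d0 Q] := type2 h; rewrite (V2E d0 Q) (@V2E d) ?bil_act // -act_scv.
set y := scv d^-1 x; have Qy : bil y y = tau by exact: normalize.
have hy : her y y = 0 by rewrite her_scl her_scr (iso_her ix) !mulr0.
have -> : rev (act g y) = act g (rev y).
  rewrite {1}(rev_imv y) act_add act_scv.
  have := cjv_act (rev y) rg; rewrite cjv_rev => r1.
  have := cjv_act (imv y) rg; rewrite cjv_imv => r2.
  move: (act g (rev y)) (act g (imv y)) r1 r2 => r u /cjv_entries[e1 e2 e3] /cjv_entries[e4 e5 e6].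
  by apply: vec_eqP; rewrite /= /re !rmorphD !rmorphM /= cj_tau e1 e2 e3 e4 e5 e6; split; field; exact: two0.
have [r1 _ _] := normalized_parts hy Qy.
by rewrite theta_act ?cjv_rev ?rev_neq0 // mulrCA.
Qed.

Lemma V2_homog : homog V2.
Proof.
move=> c x c0 ix; have [h|h] := eqVneq (chi (bil x x)) (-1); last first.
  rewrite !V2_square ?mulr0 // bil_scl bil_scr !chiM.
  by rewrite mulrA chi_neq0 // mul1r.
have [d d0 Q] := type2 h; rewrite (V2E d0 Q) (@V2E (c * d)) ?mulf_neq0 //; last first.
  by rewrite bil_scl bil_scr Q; ring.
by rewrite chiM -mulrA scvA; congr (_ * (_ * theta (rev (scv _ _)))); field; rewrite d0 c0.
Qed.

Lemma theta_sqr r : cjv r = r -> r != vzero K -> bil r r = 0 -> theta r * theta r = 1.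
Proof.
move=> rr r0 Q; have [ra _ rc] := real_entries rr; have := null_entry r0 Q.
by rewrite /theta; case: eqVneq => [_ c0|a0 _] /=; rewrite psi_neq0 ?chi_real.
Qed.

Lemma V2_sqr x : iso x -> chi (bil x x) = -1 -> V2 x * V2 x = 1.
Proof.
move=> ix h; have [d d0 Q] := type2 h; rewrite (V2E d0 Q) mulrACA chi_neq0 // mul1r.
have Qy := normalize d0 Q; have hy : her (scv d^-1 x) (scv d^-1 x) = 0.
  by rewrite her_scl her_scr (iso_her ix) !mulr0.
have [r1 _ _] := normalized_parts hy Qy.
by rewrite theta_sqr ?cjv_rev ?rev_neq0.
Qed.

End Substitution.

(** * Forms whose discriminant is a square *)

(** Each orbit of s contributes k times the value at its root. It serves to compute character sums
    modulo 2 and modulo 4. *)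
Lemma dvd_sum_orbits (T : finType) (A : {set T}) (s : T -> T) (phi : T -> int) k :
    injective s -> {in A, forall x, s x \in A} -> {in A, forall x, phi (s x) = phi x} ->
    {in A, forall x, fingraph.order s x = k} ->
  exists c, \sum_(x in A) phi x = k%:Z * c.
Proof.
move=> sI sA sphi sk.
have iterA n x : x \in A -> (iter n s x \in A) && (phi (iter n s x) == phi x).
  by move=> Ax; elim: n => [|n /andP[An /eqP e]]; rewrite /= ?Ax ?eqxx // sA //= sphi // e.
have rootA x : x \in A -> froot s x \in A.
  by move=> Ax; have /iter_findex <- := connect_root (frel s) x; have /andP[] := iterA (findex s x (froot s x)) x Ax.
exists (\sum_(r in A | froot s r == r) phi r).
rewrite (partition_big (froot s) (fun r => (r \in A) && (froot s r == r))) => [|x Ax] /=; last first.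
  by rewrite rootA //= (root_root (fconnect_sym sI)).
rewrite mulr_sumr; apply: eq_bigr => r /andP[Ar /eqP rr].
rewrite (eq_bigr (fun=> phi r)) => [|x /andP[Ax /eqP xr]]; last first.
  have /iter_findex E : fconnect s r x by rewrite (fconnect_sym sI) -xr connect_root.
  by have /andP[_ /eqP] := iterA (findex s r x) r Ar; rewrite E.
rewrite sumr_const -mulr_natl natz; congr (Posz _ * _).
rewrite -(sk r Ar) -size_orbit -(card_uniqP (orbit_uniq s r)).
apply: eq_card => x; rewrite [in LHS]unfold_in -fconnect_orbit; apply/andP/idP.
  by case=> Ax /eqP xr; rewrite (fconnect_sym sI) -xr connect_root.
move=> rx; have /iter_findex E := rx.
have Ax : x \in A by rewrite -E; have /andP[] := iterA (findex s r x) r Ar.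
by split=> //; rewrite -rr eq_sym (root_connect (fconnect_sym sI)).
Qed.

(** Uniqueness of a prime as a sum of two squares, proved by composing the representations 1 +
    (2a)^2 and x^2 + y^2; oddness tells which of the two squares x^2 is. *)
Lemma odd_two_squares (a x y : int) (p : nat) : prime p -> p%:Z = 1 + 4 * a ^+ 2 ->
  x ^+ 2 + y ^+ 2 = p%:Z -> (forall c, x <> 2 * c) -> x ^+ 2 = 1.
Proof.
move=> pp pE xyE xodd.
have p0 : p%:Z != 0 by case: (p) pp.
suff key (b : int) : b ^+ 2 = a ^+ 2 -> (p%:Z %| 2 * b * x - y)%Z -> x ^+ 2 = 1.
  have D : (p%:Z %| (2 * a * x - y) * (2 * a * x + y))%Z.
    apply/dvdzP; exists (x ^+ 2 - 1).
    transitivity (4 * a ^+ 2 * x ^+ 2 - y ^+ 2); first by ring.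
    have -> : y ^+ 2 = p%:Z - x ^+ 2 by rewrite -xyE; ring.
    by rewrite pE; ring.
  move: D; rewrite dvdzE abszM Euclid_dvdM // => /orP[] D; first by apply: (key a) => //; rewrite dvdzE.
  apply: (key (- a)); first by rewrite sqrrN.
  have -> : 2 * - a * x - y = - (2 * a * x + y) by ring.
  by rewrite dvdzE abszN.
move=> ba /dvdzP[k kE].
(* Brahmagupta's identity. As p divides the first root, its quotient k is 0, 1 or -1; k = 0 gives
   the claim, and k^2 = 1 makes the second root 0 and x even. *)
have E : (2 * b * x - y) ^+ 2 + (x + 2 * b * y) ^+ 2 = p%:Z ^+ 2.
  transitivity ((1 + 4 * b ^+ 2) * (x ^+ 2 + y ^+ 2)); first by ring.
  by rewrite ba -pE xyE -expr2.
have k2 : k ^+ 2 <= 1.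
  have p2 : 0 < p%:Z ^+ 2 by rewrite exprn_even_gt0.
  rewrite -(ler_pM2r p2) mul1r -exprMn -kE -E lerDl sqr_ge0 //.
have [k0|k0] := eqVneq k 0.
  have yE : y = 2 * b * x by apply/eqP; rewrite eq_sym -subr_eq0 kE k0 mul0r.
  apply: (mulIf p0); rewrite mul1r -[RHS]xyE yE pE -ba; ring.
have k1 : k ^+ 2 = 1.
  by apply/eqP; rewrite eq_le k2 /= -gtz0_ge1 exprn_even_gt0.
have : (x + 2 * b * y) ^+ 2 == 0.
  move: E; rewrite kE exprMn k1 mul1r => E; apply/eqP/(@addrI _ (p%:Z ^+ 2)).
  by rewrite E addr0.
rewrite expf_eq0 /= => /eqP E0; exfalso; apply: (xodd (- b * y)).
by transitivity (x + 2 * b * y + 2 * (- b * y)); [ring | rewrite E0 add0r].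
Qed.

Section InvariantPart.
Variable K : quadext.
Implicit Types (x y z w v u r : vec K) (c d s e t : K) (V : vec K -> int) (g : K * K * K * K).
Local Notation q := (ord_q K).
Local Notation two0 := (two_neq0 K).
Local Notation tau := (tau K).
Local Notation tau0 := (tau_neq0 K).
Local Notation ii := (ii K).
Local Notation ii0 := (ii_neq0 K).

Definition invariant V := forall g x, realg g -> gdet g != 0 -> iso x -> V (act g x) = V x.

Lemma inv_V1 : invariant (@V1 K). Proof. by move=> g x _ D _; rewrite V1_act. Qed.

Lemma inv_VO : invariant (@VO K). Proof. by move=> g x rg D ix; rewrite VO_act. Qed.

Lemma esum_inv V g w : invariant V -> realg g -> gdet g != 0 -> esum V (act g w) = esum V w.
Proof.
by move=> iV rg D; rewrite (@esum_act _ _ _ 1) ?mul1r // => x ix; rewrite iV ?mul1r.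
Qed.

Lemma esum_opp V w : her w w = -1 -> esum V (scv (-1) w) = - esum V w.
Proof. by move=> hww; rewrite esum_scv ?sgN1 ?mulN1r //; ring. Qed.

Lemma esum_halfturn V w v : invariant V -> her w w = -1 -> cjv v = v -> bil v v != 0 ->
  bil w v = 0 -> esum V w = 0.
Proof.
move=> iV hww rv v0 wv; have := esum_inv w iV (realg_halfturn rv).
by rewrite gdet_halfturn oppr_eq0 => /(_ v0); rewrite act_halfturn // esum_opp //; lia.
Qed.

Lemma real_perp r : cjv r = r ->
  exists v, [/\ cjv v = v, bil v v != 0 & bil r v = 0].
Proof.
case: r => [[a b] c] /cjv_entries /= [ra rb rc].
have [b0|b0] := eqVneq b 0.
  exists (0, 1, 0); split; rewrite /bil /= ?b0 ?(mulr0, mul0r, addr0, subr0, mulr1) ?oner_eq0 //.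
  by rewrite /cjv /= rmorph0 rmorph1.
have [c0|c0] := eqVneq c 0; last first.
  exists (1, 2 * c / b, 0); split.
  - by rewrite /cjv /= rmorph0 rmorph1 !rmorphM fmorphV rmorph_nat /= rb rc.
  - have -> : bil ((1, 2 * c / b, 0) : vec K) (1, 2 * c / b, 0) = (2 * c / b) ^+ 2.
      by rewrite /bil /=; ring.
    by rewrite expf_eq0 /= !mulf_eq0 invr_eq0 (negbTE b0) (negbTE c0) (negbTE two0).
  - by rewrite /bil /=; field.
have [a0|a0] := eqVneq a 0; last first.
  exists (0, 2 * a / b, 1); split.
  - by rewrite /cjv /= rmorph0 rmorph1 !rmorphM fmorphV rmorph_nat /= rb ra.
  - have -> : bil ((0, 2 * a / b, 1) : vec K) (0, 2 * a / b, 1) = (2 * a / b) ^+ 2.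
      by rewrite /bil /=; ring.
    by rewrite expf_eq0 /= !mulf_eq0 invr_eq0 (negbTE b0) (negbTE a0) (negbTE two0).
  - by rewrite /bil /=; field.
exists (1, 0, 1); split.
- by rewrite /cjv /= rmorph0 rmorph1.
- have -> : bil ((1, 0, 1) : vec K) (1, 0, 1) = - 4 by rewrite /bil /=; ring.
  by rewrite oppr_eq0 four_neq0.
- by rewrite /bil /= a0 c0; ring.
Qed.

(* Up to substitutions and factors of norm 1, the only form of norm -1 that is not orthogonal to
   a real form v with bil v v != 0; the half turn about such a v maps w to - w. *)
Definition wdeg : vec K := (tau, ii, 0).

Lemma real_null_normal r : cjv r = r -> r != vzero K -> bil r r = 0 ->
  exists g k, [/\ realg g, gdet g != 0, k != 0 & act g r = scv k (1, 0, 0)].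
Proof.
case: r => [[a b] c] /real_entries /= [ra rb rc] r0 Q.
have [a0|a0] := eqVneq a 0.
  have b0 : b = 0.
    move: Q; rewrite /bil /= a0 !(mulr0, mul0r, addr0, subr0) => /eqP.
    by rewrite mulf_eq0 orbb => /eqP.
  have c0 : c != 0 by apply: contraNneq r0 => c0; rewrite a0 b0 c0.
  exists (0, -1, 1, 0), c; split=> //.
  - by rewrite /= /real ?(rmorphN, rmorph0, rmorph1) !eqxx.
  - by rewrite /= mulr0 mulr1 sub0r opprK oner_eq0.
  - have e1 : (0 * 0 - -1 * 1)^-1 = 1 :> K by rewrite mulr0 mulr1 sub0r opprK invr1.
    by apply: vec_eqP; split; rewrite /= a0 b0 e1; ring.
exists (1, - (b / (2 * a)), 0, 1), a; split=> //.
- rewrite /= /real rmorphN rmorphM fmorphV rmorphM rmorph_nat rmorph0 rmorph1 /=.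
  by rewrite (realP _ ra) (realP _ rb) !eqxx.
- by rewrite /= mulr0 mulr1 subr0 oner_eq0.
- have {}Q : b ^+ 2 = 4 * a * c.
    by apply/eqP; rewrite -subr_eq0 -Q /bil /=; apply/eqP; ring.
  apply: vec_eqP; split; rewrite /= ?(mulr0, mul0r, mulr1, mul1r, addr0, add0r, subr0, invr1, expr1n) //.
  - by ring.
  - by field; rewrite two0 a0.
  transitivity ((4 * a * c - b ^+ 2) / (4 * a)); first by field; rewrite four_neq0 two0 a0.
  by rewrite Q subrr mul0r.
Qed.

(** The form v below is real and orthogonal to w. If [bil v v] is nonzero, its half turn gives k =
    0. If v = 0, then w is a multiple of a real form, which has another suitable perpendicular. If v
    is null and nonzero, either one more half turn applies or w is moved to [wdeg], and k is the
    sign of the scalar used. *)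
Lemma esum_degenerate w : her w w = -1 ->
  exists k : int, forall V, invariant V -> esum V w = k * esum V wdeg.
Proof.
move=> hww; pose v := scv tau^-1 (crs w (cjv w)).
have rv : cjv v = v.
  rewrite /v scv_cjv crs_cjv cjvK fmorphV /= cj_tau.
  by apply: vec_eqP; split; rewrite /=; field; rewrite oppr_eq0 tau0.
have wv : bil w v = 0 by rewrite bilC bil_scl bil_crs /det3 /=; ring.
have [Q|Q] := eqVneq (bil v v) 0; last first.
  by exists 0 => V iV; rewrite mul0r (esum_halfturn iV hww rv).
have [v0|v0] := eqVneq v (vzero K).
  have w0 : w != vzero K.
    by apply/negP=> /eqP w0; move/eqP: hww; rewrite w0 her0l eq_sym oppr_eq0 oner_eq0.
  have /crs_eq0 : crs w (cjv w) = vzero K.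
    by apply: (scv_inj (invr_neq0 tau0)); rewrite -/v v0 scv_vzero.
  case/(_ w0) => c /(cjv_scale w0)[s [r [s0 rr wE]]].
  have [u [ru u0 ur]] := real_perp rr.
  by exists 0 => V iV; rewrite mul0r (esum_halfturn iV hww ru) // wE bil_scl ur mulr0.
have [g [k [rg D k0 gv]]] := real_null_normal rv v0 Q.
have gw : (act g w).2 = 0.
  move: wv; rewrite -(bil_act _ _ D) gv bil_scr /bil /= => /eqP.
  rewrite mulf_eq0 (negbTE k0) /= !(mulr0, mulr1, add0r, sub0r) oppr_eq0 mulf_eq0 (negbTE two0).
  by move/eqP.
move: (her_act w w rg D) (fun V iV => @esum_inv V g w iV rg D); rewrite hww.
move: gw; case: (act g w) => [[be la] _] /= -> hla esum_w.
have la1 : la * cj la = -1.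
  by rewrite -hla /her /bil /= rmorph0; ring.
have la0 : la != 0.
  by apply/negP=> /eqP la0; move/eqP: la1; rewrite la0 mul0r eq_sym oppr_eq0 oner_eq0.
(* [ii] and [la] both have norm -1, so the quotient has norm 1 and only costs a sign [sg eta]. *)
pose eta := ii / la.
have Neta : eta * cj eta = 1.
  rewrite /eta rmorphM fmorphV /= cj_ii mulrACA -invfM la1 -expr2 ii_sq divff //.
  by rewrite oppr_eq0 oner_eq0.
pose b := eta * be.
have step1 V : esum V (be, la, 0) = sg eta * esum V (b, ii, 0).
  have -> : (b, ii, 0) = scv eta (be, la, 0) by apply: vec_eqP; rewrite /= mulr0 divfK.
  by rewrite esum_scv // mulrA sgx_sq mul1r.
have step2 V : invariant V -> esum V (b, ii, 0) = esum V (tau * im b, ii, 0).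
  (* The shear adds [ii ^+ 2 * re b], that is [- re b], to the first coefficient. *)
  move=> iV; pose g1 : K * K * K * K := (1, 0, ii * re b, 1).
  have D1 : gdet g1 = 1 by rewrite /= mul0r subr0 mulr1.
  rewrite -(@esum_inv _ g1) ?D1 ?oner_eq0 //; last first.
    by rewrite /= realM ?re_real /real ?cj_ii ?rmorph0 ?rmorph1 ?eqxx.
  congr (esum V _); apply: vec_eqP; split; rewrite /= mul0r mulr1 subr0 invr1 mul1r; [|ring|ring].
  transitivity (b + ii ^+ 2 * re b); first by ring.
  by rewrite ii_sq {1}(re_im b); ring.
have [b0|b0] := eqVneq (im b) 0.
  exists 0 => V iV; rewrite mul0r -esum_w // step1 step2 // b0 mulr0.
  rewrite (@esum_halfturn V _ (1, 0, 1)) ?mulr0 //.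
  - by rewrite /her /bil /= rmorph0 cj_ii -expr2 ii_sq; ring.
  - by rewrite /cjv /= rmorph0 rmorph1.
  - have -> : bil ((1, 0, 1) : vec K) (1, 0, 1) = - 4 by rewrite /bil /=; ring.
    by rewrite oppr_eq0 four_neq0.
  - by rewrite /bil /=; ring.
exists (sg eta) => V iV; rewrite -esum_w // step1 step2 //; congr (_ * _).
pose g2 : K * K * K * K := ((im b)^-1, 0, 0, 1).
have D2 : gdet g2 = (im b)^-1 by rewrite /= mul0r subr0 mulr1.
rewrite -(@esum_inv _ g2) ?D2 ?invr_eq0 //; last first.
  by rewrite /= realV ?im_real /real ?rmorph0 ?rmorph1 ?eqxx.
congr (esum V _); apply: vec_eqP; split; rewrite /= mulr1 mul0r subr0 invrK.
- by field.
- by field.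
- by ring.
Qed.

Definition scale_invariant (G : vec K -> int) :=
  forall c x, c != 0 -> iso x -> her wdeg x = 0 -> G (scv c x) = G x.

(** For t in F_q, and together with (1, 0, 0), these represent the q + 1 isotropic points orthogonal
    to [wdeg]. *)
Definition sideform t : vec K := (tau ^+ 2 + tau * t, 2 * ii * tau, 1).

Lemma her_sideform t : real t -> iso (sideform t) && (her wdeg (sideform t) == 0).
Proof.
move=> /realP rt; rewrite /iso /her /bil /= !(rmorph0, rmorph1, rmorphD, rmorphM, rmorphXn, rmorph_nat) /=.
rewrite cj_tau cj_ii rt.
have -> : 2 * ii * tau * (2 * ii * - tau) = 4 * tau ^+ 2.
  by transitivity (- 4 * ii ^+ 2 * tau ^+ 2); [ring | rewrite ii_sq; ring].
apply/andP; split; last first.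
  by apply/eqP; transitivity (- 2 * tau * (ii ^+ 2 + 1)); [ring | rewrite ii_sq; ring].
apply/andP; split; last by apply/eqP; ring.
by apply/negP=> /eqP[_ _ /eqP]; rewrite oner_eq0.
Qed.

Lemma wdeg_perp x : iso x -> her wdeg x = 0 ->
  x.2 = 0 \/ exists2 t, real t & x = scv x.2 (sideform t).
Proof.
move=> ix /eqP; rewrite her_eq0C; case: x ix => [[a b] c] ix; rewrite /her /bil /= rmorph0 cj_ii cj_tau.
move=> /eqP hw; have [->|c0] := eqVneq c 0; [by left | right].
have bE : b = c * (2 * ii * tau).
  apply: (mulIf ii0); transitivity (b * ii - 2 * (a * 0 + c * - tau) - 2 * c * tau); first ring.
  by rewrite hw; transitivity (2 * c * tau * ii ^+ 2); [rewrite ii_sq; ring | ring].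
have [al aE] : exists al, a = c * al by exists (a / c); rewrite mulrC divfK.
have : iso (scv c^-1 (a, b, c)) by rewrite iso_sc ?invr_eq0.
have -> : scv c^-1 (a, b, c) = (al, 2 * ii * tau, 1).
  by apply: vec_eqP; rewrite /= bE aE !mulrA !mulVf // !mul1r.
case/andP=> _ /eqP; rewrite /her /bil /= !(rmorph1, rmorphM, rmorph_nat) /= cj_tau cj_ii.
have -> : 2 * ii * tau * (2 * ii * - tau) = 4 * tau ^+ 2.
  by transitivity (- 4 * ii ^+ 2 * tau ^+ 2); [ring | rewrite ii_sq; ring].
move=> E; have Tr : al + cj al = 2 * tau ^+ 2.
  apply: (mulfI two0); transitivity (4 * tau ^+ 2 - (4 * tau ^+ 2 - 2 * (al * 1 + 1 * cj al))); first ring.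
  by rewrite E; ring.
exists (im al); first exact: im_real.
apply: vec_eqP; rewrite /= mulr1 aE bE; split=> //; congr (_ * _).
by rewrite {1}(re_im al) {1}/re Tr; congr (_ + _); field; exact: two0.
Qed.

Lemma sum_wdeg (G : vec K -> int) : scale_invariant G ->
  \sum_(x | iso x && (her wdeg x == 0)) G x =
  (q ^ 2 - 1)%N%:Z * (G (1, 0, 0) + \sum_(t | real t) G (sideform t)).
Proof.
move=> sG; rewrite (bigID (fun x : vec K => x.2 == 0)) /= mulrDr.
pose N := [set c : K | c != 0].
have cardN : #|N| = (q ^ 2 - 1)%N by exact: card_nonzero.
have iso1 : iso ((1, 0, 0) : vec K) && (her wdeg (1, 0, 0) == 0).
  rewrite /iso /her /bil /= !(rmorph0, rmorph1) !(mulr0, mul0r, addr0, subr0, mulr1) eqxx !andbT.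
  by apply/negP=> /eqP[/eqP]; rewrite oner_eq0.
congr (_ + _).
  pose f c : vec K := (c, 0, 0).
  have fI : {in N &, injective f} by move=> c d _ _ [].
  transitivity (\sum_(x in f @: N) G x); last first.
    rewrite big_imset //= (eq_bigr (fun=> G (1, 0, 0))) => [|c]; last first.
      rewrite inE => c0; have /andP[i1 /eqP h1] := iso1.
      by rewrite -(sG c _ c0 i1 h1); congr G; apply: vec_eqP; rewrite /= mulr1 !mulr0.
    by rewrite sumr_const cardN -mulr_natl natz.
  apply: eq_bigl => x; apply/idP/imsetP => [/andP[/andP[ix hw] /eqP x2]|[c]].
    case: x x2 ix hw => [[a b] c] /= -> /andP[x0].
    rewrite /her /bil /= rmorph0 !(mulr0, mul0r, addr0, subr0) mulf_eq0 cj_eq0 orbb => /eqP b0 _.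
    exists a; rewrite /f ?b0 // inE; apply: contraNneq x0 => a0.
    by rewrite a0 b0.
  rewrite inE => c0 ->; rewrite /= eqxx andbT.
  have -> : f c = scv c (1, 0, 0) by apply: vec_eqP; rewrite /= mulr1 !mulr0.
  by rewrite iso_sc // her_scr mulf_eq0; have /andP[-> ->] := iso1; rewrite orbT.
pose R := [set t : K | real t].
pose f (p : K * K) : vec K := scv p.1 (sideform p.2).
have fI : {in setX N R &, injective f}.
  move=> [c t] [d u]; rewrite !inE /= => /andP[c0 _] /andP[d0 _] [e1 _ e3].
  move: e3; rewrite !mulr1 => cd; rewrite -cd in e1 *; congr (_, _).
  by apply: (mulfI tau0); apply: (@addrI _ (tau ^+ 2)); apply: (mulfI c0).
transitivity (\sum_(x in f @: setX N R) G x); last first.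
  rewrite big_imset //= (eq_bigl (fun p => (p.1 \in N) && (p.2 \in R))) => [|p]; last by rewrite inE.
  rewrite -(pair_big (mem N) (mem R) (fun c t => G (f (c, t)))) /=.
  rewrite (eq_bigr (fun=> \sum_(t | real t) G (sideform t))) => [|c]; last first.
    rewrite inE => c0; apply: eq_big => [t|t]; rewrite inE // => rt.
    by have /andP[i1 /eqP h1] := her_sideform rt; rewrite /f sG.
  by rewrite sumr_const cardN -mulr_natl natz.
apply: eq_bigl => x; apply/idP/imsetP => [/andP[/andP[ix /eqP hw] x2]|[[c t]]].
  have [x20|[t rt xE]] := wdeg_perp ix hw; first by rewrite x20 eqxx in x2.
  by exists (x.2, t); rewrite // !inE /= x2.
rewrite !inE /= => /andP[c0 rt] ->; rewrite /f /= mulr1 c0 andbT.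
by rewrite iso_sc // her_scr mulf_eq0; have /andP[-> ->] := her_sideform rt; rewrite orbT.
Qed.

Lemma her_wdeg : her wdeg wdeg = -1.
Proof.
rewrite /her /bil /= rmorph0 cj_ii cj_tau -expr2 ii_sq; ring.
Qed.

Lemma scale_invariant_summand V : homog V -> scale_invariant (fun x => V x * sgL x wdeg).
Proof.
move=> hV c x c0 ix hw; by rewrite hV // sgL_scl ?her_wdeg // mulrACA chi_neq0 ?mul1r.
Qed.

Lemma sgL_sideform t : real t -> sgL (sideform t) wdeg = 1.
Proof.
move=> rt; have /andP[ix /eqP hw] := her_sideform rt.
rewrite /sgL (@LamE _ (1, 0, 0)) //; last first.
  rewrite /her /bil /= !(rmorph1) !(mul0r, sub0r, addr0, mul1r, mulr1, add0r) oppr_eq0 two0 //.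
have -> : her (1, 0, 0) (sideform t) = - 2 by rewrite /her /bil /= rmorph1; ring.
have -> : det3 wdeg (sideform t) (1, 0, 0) = ii by rewrite /det3 /=; ring.
have -> : 2 * ii * ii / (-2) = - ii ^+ 2 by field; rewrite oppr_eq0 two0.
rewrite ii_sq opprK.
by apply: sg_exp; rewrite expr1n.
Qed.

(** * Quartic character sums over an affine line *)

Definition C1 : int := \sum_(t : K | real t) psi (tau * (t + 2 * tau)).

Lemma esum_V1_wdeg : esum (@V1 K) wdeg = (q ^ 2 - 1)%N%:Z * C1.
Proof.
rewrite /esum (sum_wdeg (scale_invariant_summand (@V1_homog K))); congr (_ * _).
have -> : V1 ((1, 0, 0) : vec K) = 0.
  by rewrite /V1 /bil /= !(mulr0, mul0r, addr0, subr0) psi0.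
rewrite mul0r add0r; apply: eq_bigr => t rt; rewrite sgL_sideform // mulr1 /V1.
have -> : bil (sideform t) (sideform t) = (2 * ii) ^+ 2 * (tau * (t + 2 * tau)).
  rewrite exprMn ii_sq /bil /=.
  by transitivity (4 * ii ^+ 2 * tau ^+ 2 - 4 * (tau ^+ 2 + tau * t)); [ring | rewrite ii_sq; ring].
have n0 : 2 * ii != 0 by rewrite mulf_neq0 ?two0 ?ii0.
by rewrite psiM ?chi_sqr // psi_sqr chiM chi_ii chi_real ?real_nat ?two0 // !mul1r.
Qed.

Lemma esum_VO_wdeg : esum (@VO K) wdeg = (q ^ 2 - 1)%N%:Z * sgL (1, 0, 0) wdeg.
Proof.
rewrite /esum (sum_wdeg (scale_invariant_summand (@VO_homog K))); congr (_ * _).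
rewrite big1 => [|t rt].
  by rewrite addr0 /VO /bil /= !(mulr0, mul0r, addr0, subr0) eqxx oner_eq0 chi1 mul1r.
rewrite /VO; case: eqP => [|_]; last by rewrite mul0r.
have -> : bil (sideform t) (sideform t) = - 4 * tau * (t + tau * 2).
  rewrite /bil /=.
  by transitivity (4 * ii ^+ 2 * tau ^+ 2 - 4 * (tau ^+ 2 + tau * t)); [ring | rewrite ii_sq; ring].
move/eqP; rewrite !mulf_eq0 oppr_eq0 (negbTE (four_neq0 K)) (negbTE tau0) /= => /eqP E.
by have [_ /eqP] := real_tau_eq0 rt (real_nat K 2) E; rewrite (negbTE two0).
Qed.

Definition C2 : int := \sum_(t : K | real t) psi (t + 2 * tau).

Lemma side_neq0 t : real t -> t + 2 * tau != 0.
Proof.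
move=> rt; apply/negP=> /eqP E; have := real_tau_eq0 rt (real_nat K 2).
by rewrite mulrC => /(_ E) [_ /eqP]; rewrite (negbTE two0).
Qed.

(** Multiplication by [tau] exchanges squares and nonsquares, so at most one of the products is
    nonzero, and one is if y and z are in the same class. For nonsquares, [psi (tau ^+ 2) = -1]
    cancels [psi (z ^+ 2) = -1]. *)
Lemma psi_div (y z : K) : y != 0 -> z != 0 ->
  psi (tau * y) * psi (tau * z) + psi y * psi z = psi (y / z).
Proof.
move=> y0 z0; have tE : tau * y * (tau * z) = tau ^+ 2 * (y * z) by ring.
have ct : chi (tau ^+ 2) = 1 by rewrite chi_sqr ?tau0.
have [cy|cy] := eqVneq (chi y) 1.
  rewrite psi_nonsquare ?mul0r ?add0r; last by rewrite chiM chi_tau cy.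
  by rewrite psiM // psiV.
rewrite (psi_nonsquare cy) mul0r addr0.
have {}cy := chi_neq1 y0 cy.
have cty : chi (tau * y) = 1 by rewrite chiM chi_tau cy.
have [cz|cz] := eqVneq (chi z) 1.
  rewrite [X in _ * X]psi_nonsquare ?mulr0; last by rewrite chiM chi_tau cz.
  by rewrite psi_nonsquare // chiM chiV cy cz.
have {}cz := chi_neq1 z0 cz.
have cyz : chi (y / z) = 1 by rewrite chiM chiV cy cz.
rewrite -psiM // tE.
have -> : tau ^+ 2 * (y * z) = tau ^+ 2 * (z ^+ 2 * (y / z)) by field.
by rewrite psiM // psiM ?chi_sqr // !psi_sqr chi_tau cz mulrA mulrNN !mul1r.
Qed.

Lemma sum_psi (P : pred K) : (forall u : K, P (tau ^+ 2 * u) = P u) -> \sum_(u | P u) psi u = 0.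
Proof.
move=> hP; have t0 : tau ^+ 2 != 0 by rewrite expf_neq0 ?tau0.
suff : \sum_(u | P u) psi u = - \sum_(u | P u) psi u by lia.
rewrite {1}(reindex_inj (mulfI t0)) /= -sumrN; apply: eq_big => [u|u _]; first exact: hP.
by rewrite psiM ?chi_sqr ?tau0 // psi_tau2 mulN1r.
Qed.

(** By [psi_div] the left side is the sum of [psi (z s / z t)] over s, t in F_q. The diagonal gives
    q; off it, the quotients run once through the elements outside F_q, and multiplication by
    [tau ^+ 2] negates their sum. *)
Lemma C1C2 : C1 ^+ 2 + C2 ^+ 2 = q%:Z.
Proof.
pose z t : K := t + 2 * tau.
pose R := [set t : K | real t].
have z0 t : t \in R -> z t != 0 by rewrite inE; exact: side_neq0.
transitivity (\sum_(p in setX R R) psi (z p.1 / z p.2)).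
  rewrite !expr2 /C1 /C2 !big_distrlr /= -big_split /=.
  rewrite (eq_bigl (fun p => (p.1 \in R) && (p.2 \in R))) => [|p]; last by rewrite inE.
  rewrite -(pair_big (mem R) (mem R) (fun s t => psi (z s / z t))) /=.
  apply: eq_big => [t|s rs]; first by rewrite inE.
  rewrite -big_split /=; apply: eq_big => [t|t rt]; first by rewrite inE.
  by rewrite psi_div ?side_neq0.
have cdiag : #|[set p in setX R R | p.1 == p.2]| = q.
  have fI : injective (fun t : K => (t, t)) by move=> s t [].
  rewrite -(card_real K) -(card_imset _ fI); apply: eq_card => -[s t]; apply/idP/imsetP.
    by rewrite !inE /= => /andP[/andP[rs _] /eqP <-]; exists s; rewrite ?inE.
  by case=> u; rewrite inE => ru [-> ->]; rewrite !inE /= ru eqxx.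
rewrite (bigID (fun p => p.1 == p.2)) /=.
have -> : \sum_(p in setX R R | p.1 == p.2) psi (z p.1 / z p.2) = q%:Z.
  rewrite (eq_bigr (fun=> 1)) => [|p /andP[]]; last first.
    by rewrite inE => /andP[p1 p2] /eqP ->; rewrite divff ?psi1 ?z0.
  rewrite sumr_const -[in RHS]cdiag natz; congr Posz.
  by apply: eq_card => p; rewrite [LHS]unfold_in [RHS]inE.
pose D := [set p in setX R R | p.1 != p.2].
pose f (p : K * K) := z p.1 / z p.2.
rewrite (eq_bigl (mem D)) => [|p]; last by rewrite !inE.
have fI : {in D &, injective f}.
  move=> [s t] [s' t']; rewrite !inE /= => /andP[/andP[rs rt] nst] /andP[/andP[rs' rt'] _].
  rewrite /f /= => /eqP; rewrite eqr_div ?side_neq0 // => /eqP E.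
  have rM := realM; have rN := realN; have rD := realD.
  have [] := @real_tau_eq0 _ (s * t' - s' * t) (2 * (s + t' - (s' + t))).
  - by rewrite rD ?rN ?rM.
  - by rewrite rM ?real_nat // rD ?rN ?rD.
  - transitivity (z s * z t' - z s' * z t); last by rewrite E subrr.
    by rewrite /z; ring.
  move=> e1 /eqP; rewrite mulf_eq0 (negbTE two0) /= => /eqP e2.
  have kk : s - t != 0 by rewrite subr_eq0.
  have tt : t = t'.
    apply/eqP; rewrite -subr_eq0 -(mulrI_eq0 _ (mulfI kk)); apply/eqP.
    transitivity (- (s * t' - s' * t) + (s + t' - (s' + t)) * t); first by ring.
    by rewrite e1 e2 oppr0 mul0r addr0.
  rewrite -tt in e2 *; congr (_, _); apply/eqP; rewrite -subr_eq0 -e2; apply/eqP; ring.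
have imf : f @: D = [set u | ~~ real u].
  apply/eqP; rewrite eqEcard; apply/andP; split.
    apply/subsetP=> u /imsetP[[s t]]; rewrite !inE /= => /andP[/andP[rs rt] nst] {u}->.
    apply/negP=> ru; rewrite /f /= in ru; set u := z s / z t in ru.
    have [] := @real_tau_eq0 _ (s - u * t) (2 * (1 - u)).
    - exact: realD rs (realN (realM ru rt)).
    - exact: realM (real_nat K 2) (realD (real_nat K 1) (realN ru)).
    - transitivity (z s - u * z t); first by rewrite /z; ring.
      by rewrite divfK ?subrr ?side_neq0.
    move=> e1 /eqP; rewrite mulf_eq0 (negbTE two0) subr_eq0 /= => /eqP u1.
    by move: e1; rewrite -u1 mul1r => /eqP; rewrite subr_eq0 (negbTE nst).
  rewrite (card_in_imset fI); have cR : #|R| = q := card_real K.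
  have E1 : (#|[set u : K | ~~ real u]| + q = q ^ 2)%N.
    rewrite -card_quadext -(cardsC R) cR addnC; congr (_ + _)%N.
    by apply: eq_card => u; rewrite !inE.
  have E2 : (#|D| + q = q ^ 2)%N.
    rewrite -mulnn -{2 3}cR -cardsX -(cardsID [set p | p.1 == p.2] (setX R R)) addnC.
    congr (_ + _)%N.
      by rewrite -cdiag; apply: eq_card => p; rewrite !inE.
    by apply: eq_card => p; rewrite !inE andbC.
  by rewrite -(leq_add2r q) E1 E2.
rewrite -(big_imset (h := f) _ fI) /= imf.
rewrite sum_psi ?addr0 // => u; rewrite !inE; congr (~~ _); apply/realP/realP => [|ru].
  by rewrite rmorphM /= (realP _ (real_tau2 K)) => /(mulfI (expf_neq0 2 tau0)).
by rewrite rmorphM /= ru (realP _ (real_tau2 K)).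
Qed.

(** Conjugation shows that t and -t give equal terms, and the term at t = 0 is 1 or -1. *)
Lemma C1_odd (c : int) : C1 <> 2 * c.
Proof.
pose A := [set t : K | real t & t != 0].
pose F t := psi (tau * (t + 2 * tau)).
have Feq t : real t -> F (- t) = F t.
  move/realP=> rt; rewrite /F -[RHS]psi_cj !(rmorphM, rmorphD, rmorph_nat) /= cj_tau rt.
  by congr psi; ring.
have [] := @dvd_sum_orbits _ A (@GRing.opp K) F 2.
- exact: oppr_inj.
- by move=> t; rewrite !inE oppr_eq0 => /andP[rt ->]; rewrite realN.
- by move=> t; rewrite inE => /andP[rt _]; exact: Feq.
- move=> t; rewrite inE => /andP[_ t0].
  rewrite (@order_cycle _ _ [:: t; - t]) ?inE ?eqxx //=; first by rewrite opprK !eqxx.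
  by rewrite inE andbT -addr_eq0 -mulr2n -mulr_natl mulf_neq0 ?two0.
move=> k; rewrite (eq_bigl (fun t : K => real t && (t != 0))) => [E|t]; last by rewrite !inE.
have -> : C1 = F 0 + 2 * k.
  rewrite /C1 (bigD1 (0 : K)) /=; last by rewrite /real rmorph0.
  by rewrite -E.
have : F 0 * F 0 = 1.
  rewrite /F add0r; apply: psi_neq0.
  have -> : tau * (2 * tau) = 2 * tau ^+ 2 by ring.
  by rewrite chiM chi_sqr ?tau0 // chi_real ?real_nat ?two0.
move: (F 0) => f ff e; have fE : f = 2 * (c - k) by lia.
have : 4 * ((c - k) * (c - k)) = f * f by rewrite fE; ring.
by rewrite ff; lia.
Qed.

Lemma esum_invariant (a : int) : q%:Z = 1 + 4 * a ^+ 2 ->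
  exists2 e0 : int, e0 * e0 = 1 &
    forall w, her w w = -1 -> esum (fun x => V1 x + e0 * VO x) w = 0.
Proof.
move=> qE; have C1s := odd_two_squares (prime_q K) qE C1C2 C1_odd.
pose s := sgL (1, 0, 0) wdeg; exists (- C1 * s).
  by rewrite mulrACA sgL_sq mulrNN mulr1 -expr2.
move=> w hww; rewrite esumD esumZ; have [k kE] := esum_degenerate hww.
rewrite !kE; [|exact: inv_VO|exact: inv_V1].
rewrite esum_V1_wdeg esum_VO_wdeg -/s.
transitivity (k * (q ^ 2 - 1)%N%:Z * C1 * (1 - s * s)); first by ring.
by rewrite sgL_sq subrr mulr0.
Qed.

End InvariantPart.

(** * Forms whose discriminant is not a square *)

Lemma order_four (T : finType) (s : T -> T) x :
  injective s -> s (s (s (s x))) = x -> s (s x) != x -> fingraph.order s x = 4.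
Proof.
move=> sI s4 n2.
have n1 : s x != x by apply: contra n2 => /eqP e; rewrite !e.
have n3 : s (s (s x)) != x.
  by apply: contra n1 => /eqP e; rewrite -[X in _ == X]s4 e.
rewrite (@order_cycle _ _ [:: x; s x; s (s x); s (s (s x))]) ?inE ?eqxx //=; first by rewrite s4 !eqxx.
by rewrite !inE !(inj_eq sI) ![x == _]eq_sym (negbTE n1) (negbTE n2) (negbTE n3).
Qed.

(** A scalar class in S has one representative on which the homogeneous coordinate l is 1, and G is
    constant on the class; the factor counts the nonzero scalars. *)
Lemma sum_scalings (K : quadext) (I : finType) (A : {set I}) (f : I -> vec K)
    (l : vec K -> K) (S : pred (vec K)) (G : vec K -> int) :
    (forall c x, l (scv c x) = c * l x) -> {in A, forall i, l (f i) = 1} ->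
    {in A &, injective f} ->
    (forall x, S x -> l x != 0 /\ exists2 i, i \in A & x = scv (l x) (f i)) ->
    (forall c i, c != 0 -> i \in A -> S (scv c (f i)) /\ G (scv c (f i)) = G (f i)) ->
  \sum_(x | S x) G x = (ord_q K ^ 2 - 1)%N%:Z * \sum_(i in A) G (f i).
Proof.
move=> lS lf fI SA AS; pose N := [set c : K | c != 0].
have cardN : #|N| = (ord_q K ^ 2 - 1)%N by exact: card_nonzero.
pose F (p : K * I) := scv p.1 (f p.2).
have FI : {in setX N A &, injective F}.
  move=> [c i] [d j]; rewrite !inE /= => /andP[c0 Ai] /andP[d0 Aj] E.
  have cd : c = d by move/(congr1 l): E; rewrite /F !lS /= !lf // !mulr1.
  by rewrite -cd in E *; rewrite (fI _ _ Ai Aj (scv_inj c0 E)).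
transitivity (\sum_(x in F @: setX N A) G x).
  apply: eq_bigl => x; apply/idP/imsetP => [/SA[l0 [i Ai xE]]|[[c i]]].
    by exists (l x, i); rewrite // !inE /= l0.
  by rewrite !inE /= => /andP[c0 Ai] ->; have [] := AS c i c0 Ai.
rewrite big_imset //= (eq_bigl (fun p => (p.1 \in N) && (p.2 \in A))) => [|p]; last by rewrite inE.
rewrite -(pair_big (mem N) (mem A) (fun c i => G (F (c, i)))) /=.
rewrite (eq_bigr (fun=> \sum_(i in A) G (f i))) => [|c]; last first.
  by rewrite inE => c0; apply: eq_bigr => i Ai; have [] := AS c i c0 Ai.
by rewrite sumr_const cardN -mulr_natl natz.
Qed.

Section SpinorPart.
Variable K : quadext.
Implicit Types (x y z w v u r : vec K) (a b c d s e t k : K) (V : vec K -> int) (g : K * K * K * K).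
Local Notation q := (ord_q K).
Local Notation two0 := (two_neq0 K).
Local Notation four0 := (four_neq0 K).
Local Notation tau := (tau K).
Local Notation tau0 := (tau_neq0 K).
Local Notation ii := (ii K).
Local Notation ii0 := (ii_neq0 K).
Local Notation T := (twograph (@V2 K)).

Lemma twograph_V2_act g x : realg g -> gdet g != 0 -> T (act g x) = psi (gdet g) * T x.
Proof. by move=> rg D; apply: twograph_act => // y iy; rewrite V2_act. Qed.

Lemma psi_real_neq0 c : real c -> c != 0 -> psi c * psi c = 1.
Proof. by move=> rc c0; rewrite psi_neq0 ?chi_real. Qed.

(** The half turn about the real form v orthogonal to x maps x to -x, where T has the same value.
    Its determinant is the square of an element of character -1, so that equivariance also changes
    the sign of T. *)
Lemma twograph_V2_square x : iso x -> chi (bil x x) = 1 -> T x = 0.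
Proof.
move=> ix /chi_square[d d0 Q]; pose v := scv tau^-1 (crs x (cjv x)).
have rv : cjv v = v.
  rewrite /v scv_cjv crs_cjv cjvK fmorphV /= cj_tau.
  by apply: vec_eqP; split; rewrite /=; field; rewrite oppr_eq0 tau0.
have xv : bil x v = 0 by rewrite bilC bil_scl bil_crs /det3 /=; ring.
have Qv : - bil v v = (d * cj d / tau) ^+ 2.
  rewrite bil_scl bil_scr bil_crs_crs -/(her x x) (iso_her ix) mul0r subr0 -bil_cj Q rmorphXn /=.
  by field; rewrite tau0.
have v0 : bil v v != 0.
  by rewrite -oppr_eq0 Qv expf_eq0 /= !mulf_eq0 cj_eq0 invr_eq0 (negbTE d0) (negbTE tau0).
have := twograph_V2_act x (realg_halfturn rv).
rewrite gdet_halfturn oppr_eq0 => /(_ v0); rewrite act_halfturn // twograph_scv chiN chi1 mul1r.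
rewrite Qv psi_sqr chiM chiV chi_tau (chi_real (real_norm d)) ?mulf_neq0 ?cj_eq0 //; lia.
Qed.

(** After reduction to (1, 0, 0): the substitution of determinant [tau ^+ 2] scales this form by a
    square, which preserves T, while equivariance negates it. *)
Lemma twograph_V2_null x : iso x -> bil x x = 0 -> T x = 0.
Proof.
move=> ix Q; have [s [r [s0 rr r0 Qr ->]]] := null_real ix Q.
have [g [k [rg D k0 gr]]] := real_null_normal rr r0 Qr.
suff T1 : T (1, 0, 0) = 0.
  have := twograph_V2_act r rg D; rewrite gr !twograph_scv T1 mulr0 => /esym/eqP.
  rewrite mulf_eq0 => /orP[/eqP p0|/eqP ->]; last by rewrite mulr0.
  by have := psi_real_neq0 (real_gdet rg) D; rewrite p0.
pose h : K * K * K * K := (tau ^+ 2, 0, 0, 1).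
have Dh : gdet h = tau ^+ 2 by rewrite /= mulr1 mul0r subr0.
have h0 : gdet h != 0 by rewrite Dh expf_neq0 ?tau0.
have hE : act h (1, 0, 0) = scv (tau ^+ 2) (1, 0, 0).
  by apply: vec_eqP; split; rewrite /= mulr1 mul0r subr0; field; rewrite tau0.
have rh : realg h by rewrite /= real_tau2 /real rmorph0 rmorph1 !eqxx.
have := twograph_V2_act (1, 0, 0) rh h0.
by rewrite hE Dh psi_tau2 twograph_scv chi_sqr ?tau0 //; lia.
Qed.

Definition base2 : vec K := (1, 0, - (tau / 4)).

Lemma base2_form : bil base2 base2 = tau.
Proof. by rewrite /bil /=; field; exact: four0. Qed.

Lemma her_base2 : her base2 base2 = 0.
Proof.
by rewrite /her /bil /= !(rmorphN, rmorphM, fmorphV, rmorph_nat, rmorph1) /= cj_tau; field; exact: four0.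
Qed.

Lemma iso_base2 : iso base2.
Proof. by rewrite /iso her_base2 eqxx andbT; apply/negP=> /eqP[/eqP]; rewrite oner_eq0. Qed.

Lemma V2_base2 : V2 base2 = 1.
Proof.
rewrite (@V2E _ 1) ?oner_eq0 ?base2_form ?expr1n ?mulr1 //.
rewrite chi1 mul1r invr1 scv1 /theta /= /re rmorph1 -[1 + 1]/(2%:R) divff ?two0 //.
by rewrite oner_eq0 psi1.
Qed.

(* The eigenvalue of the two-graph at V2; its quadratic equation leaves two candidates, and
   kap mod 4 (q ^ 2 - 1) decides between them. *)
Definition kap : int := T base2.

Lemma twograph_V2_descent g y : iso y -> realg g -> gdet g != 0 ->
  T (act g y) = kap * V2 (act g y) -> T y = kap * V2 y.
Proof.
move=> iy rg D; rewrite twograph_V2_act // V2_act //.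
have p1 := psi_real_neq0 (real_gdet rg) D.
move/(congr1 (fun z : int => psi (gdet g) * z)); rewrite mulrCA [in RHS]mulrCA !mulrA.
by rewrite p1 mul1r -[kap * psi _ * psi _]mulrA p1 mulr1.
Qed.

(** Three real substitutions bring y to [base2]: one makes the real part a multiple of (1, 0, 0), a
    shear removes the middle coefficient, and a diagonal one normalises the first. Both sides pick
    up the same factors [psi (gdet g)]. *)
Lemma twograph_V2_normal y : iso y -> bil y y = tau -> T y = kap * V2 y.
Proof.
move=> iy Qy; have hy := iso_her iy; have [Qr Qu ru] := normalized_parts hy Qy.
have [g [k [rg D k0 gr]]] := real_null_normal (cjv_rev y) (rev_neq0 hy Qy) Qr.
apply: (twograph_V2_descent iy rg D).
have rk : real k.
  have := cjv_act (rev y) rg; rewrite gr cjv_rev gr => /cjv_entries[/= + _ _].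
  by rewrite mulr1 => /realP.
pose u := act g (imv y).
have ruu : cjv u = u by rewrite /u cjv_act // cjv_imv.
have yE : act g y = vadd (scv k (1, 0, 0)) (scv tau u).
  by rewrite {1}(rev_imv y) act_add act_scv gr.
have Qu' : bil u u = 0 by rewrite bil_act.
have uc : u.2 = - (4 * k)^-1.
  move: ru; rewrite -(bil_act _ _ D) gr -/u /bil /= => E.
  have -> : u.2 = - (2 * (k * 0 * u.1.2 - 2 * (k * 1 * u.2 + k * 0 * u.1.1))) / (4 * k).
    by field; rewrite four0 k0.
  by rewrite E mulN1r.
have iz : iso (act g y) by rewrite iso_act.
have [ra rb rc] := real_entries ruu.
have c0 : u.2 != 0 by rewrite uc oppr_eq0 invr_eq0 mulf_neq0 ?four0.
(* The shear parameter completes the square in the null form u, leaving only its last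
   coefficient. *)
pose s := - (u.1.2 / (2 * u.2)); pose h : K * K * K * K := (1, 0, s, 1).
have Dh : gdet h = 1 by rewrite /= mulr1 mul0r subr0.
have rs : real s by apply/realN/realM/realV/realM/rc/real_nat.
have rh : realg h by rewrite /= rs /real rmorph0 rmorph1 !eqxx.
apply: (@twograph_V2_descent h) => //; first by rewrite Dh oner_eq0.
have hE : act h (act g y) = (k, 0, - (tau / (4 * k))).
  rewrite yE; apply: vec_eqP; split; rewrite /= mulr1 mul0r subr0 invr1 mul1r.
  - have Q4 : u.1.1 = u.1.2 ^+ 2 / (4 * u.2).
      have -> : u.1.2 ^+ 2 = 4 * u.1.1 * u.2.
        by apply/eqP; rewrite -subr_eq0 -Qu' /bil; apply/eqP; ring.
      by field; rewrite four0 c0.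
    by rewrite Q4 /s; field; rewrite c0 two0 four0.
  - by rewrite /s; field; rewrite c0 two0.
  - by rewrite uc; field; rewrite k0 four0.
have i3 : iso (act h (act g y)) by rewrite iso_act // Dh oner_eq0.
rewrite hE in i3 *.
pose f : K * K * K * K := (k^-1, 0, 0, 1).
have Df : gdet f = k^-1 by rewrite /= mulr1 mul0r subr0.
have rf : realg f by rewrite /= realV // /real rmorph0 rmorph1 !eqxx.
apply: (@twograph_V2_descent f) => //; first by rewrite Df invr_eq0.
have -> : act f (k, 0, - (tau / (4 * k))) = base2.
  by apply: vec_eqP; split; rewrite /= mulr1 mul0r subr0 invrK; field; rewrite ?four0 k0.
by rewrite V2_base2 mulr1.
Qed.

Lemma twograph_V2 x : iso x -> T x = kap * V2 x.
Proof.
move=> ix; have [Q|Q] := eqVneq (bil x x) 0.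
  by rewrite twograph_V2_null // V2_square ?mulr0 // Q chi0.
have [cQ|cQ] := eqVneq (chi (bil x x)) 1.
  by rewrite twograph_V2_square // V2_square ?mulr0 // cQ.
have [d d0 Qd] := type2 (chi_neq1 Q cQ).
have -> : x = scv d (scv d^-1 x) by rewrite scvA mulfV // scv1.
have iy : iso (scv d^-1 x) by rewrite iso_sc ?invr_eq0.
rewrite twograph_scv V2_homog // twograph_V2_normal ?normalize //; ring.
Qed.

(** * The quadratic equation for [kap] *)

Lemma sum_chi_imaginary : \sum_(e : K | e + cj e == 0) chi e = - (q%:Z - 1).
Proof.
rewrite (bigD1 0) /=; last by rewrite rmorph0 addr0.
rewrite chi0 add0r (eq_bigr (fun=> -1)) => [|e /andP[/eqP te e0]]; last first.
  have -> : e = tau * (e / tau) by rewrite mulrC divfK ?tau0.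
  rewrite chiM chi_tau chi_real ?mulr1 ?mulf_neq0 ?invr_eq0 ?tau0 //.
  apply/realP; rewrite rmorphM fmorphV /= cj_tau.
  have -> : cj e = - e by apply/eqP; rewrite -addr_eq0 addrC te.
  by field; rewrite oppr_eq0 tau0.
rewrite sumr_const mulNrn natz; congr (- _).
have := card_trace (real_nat K 0); rewrite (cardsD1 (0 : K)) inE rmorph0 addr0 eqxx => <-.
rewrite PoszD addrC addKr; congr Posz; apply: eq_card => e.
by rewrite !inE andbC.
Qed.

(** Write z in the basis x, y, u with coordinates a, b, c and put e = [a * cj b * h]. Terms with b =
    0 vanish. Otherwise isotropy says that the norm of c is minus the trace of e over the norm of h,
    and the summand is [chi e * chi h]; only the imaginary e, with one c instead of q + 1, unbalance
    the sum. *)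
Lemma sum_chi_mul x y : iso x -> iso y -> her x y != 0 ->
  \sum_(z | iso z) chi (her x z) * chi (her z y) =
  ((q ^ 2 - 1) * (q ^ 2 - q))%N%:Z * chi (her x y).
Proof.
move=> ix iy hxy; pose u := nrm x y; have hx := iso_her ix; have hy := iso_her iy.
set h := her x y in hxy *.
have hu : her u u = h * cj h by exact: her_nrm_nrm.
have Nh0 : h * cj h != 0 by rewrite mulf_neq0 ?cj_eq0.
have D0 := det3_nrm hx hxy.
have hux : her u x = 0 := her_nrml x y; have huy : her u y = 0 := her_nrmr x y.
have hxu : her x u = 0 by rewrite -her_cj hux rmorph0.
have hyu : her y u = 0 by rewrite -her_cj huy rmorph0.
have hyx : her y x = cj h by rewrite her_cj.
transitivity (\sum_(z | her z z == 0) chi (her x z) * chi (her z y)).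
  rewrite [RHS](bigID (fun z => z == vzero K)) /= [X in _ = X + _]big1 => [|z /andP[_ /eqP->]].
    by rewrite add0r; apply: eq_bigl => z; rewrite andbC.
  by rewrite her0l chi0 mulr0.
rewrite (reindex_inj (comb_inj D0)) /= big_mkcond big_vec exchange_big /=.
rewrite (bigD1 0) //= big1 ?add0r => [|a _]; last first.
  apply: big1 => c _; rewrite !her_combr hx hxu /= rmorph0 !(mulr0, mul0r, addr0).
  by rewrite chi0 mul0r if_same.
have inner b : b != 0 ->
    \sum_a \sum_c (if her (comb x y u (a, b, c)) (comb x y u (a, b, c)) == 0 then
      chi (her x (comb x y u (a, b, c))) * chi (her (comb x y u (a, b, c)) y) else 0) =
    (q ^ 2 - q)%N%:Z * chi h.
  move=> b0; have cbh0 : (cj b * h)^-1 != 0 by rewrite invr_eq0 mulf_neq0 ?cj_eq0.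
  rewrite (reindex_inj (mulIf cbh0)) /=.
  transitivity (\sum_(e : K) chi e * (if e + cj e == 0 then 1 else q.+1%:Z) * chi h).
    apply: eq_bigr => e _; set a := e / (cj b * h).
    have aE : a * cj b * h = e by rewrite /a; field; rewrite cj_eq0 b0 hxy.
    clearbody a.
    have rc : real (- (e + cj e) / (h * cj h)).
      by apply/realM/realV/real_norm; apply/realN/real_trace.
    transitivity (\sum_(c | c * cj c == - (e + cj e) / (h * cj h)) chi e * chi h).
      rewrite [RHS]big_mkcond; apply: eq_bigr => c _.
      have -> : her (comb x y u (a, b, c)) (comb x y u (a, b, c)) = e + cj e + c * cj c * (h * cj h).
        rewrite her_comb !her_combr /= hx hy hxu hyu hux huy hu hyx -/h -aE.
        by rewrite !rmorphM /= cjK; ring.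
      rewrite addr_eq0 -[in RHS](inj_eq (mulIf Nh0)) divfK // [in RHS]eq_sym eqr_oppLR.
      case: eqP => // _; rewrite her_combr her_comb /= hx hxu huy hy !(mulr0, addr0, add0r).
      by rewrite -/h -[in RHS]aE !chiM chi_cj; ring.
    rewrite sumr_const; set n := #|_|.
    have -> : n = (if (e + cj e)%R == 0%R then 1 else q.+1)%N.
      transitivity #|[set s : K | s * cj s == - (e + cj e) / (h * cj h)]|.
        by apply: eq_card => s; rewrite !inE.
      by rewrite card_norm_eq // mulf_eq0 invr_eq0 (negbTE Nh0) orbF oppr_eq0.
    by rewrite -mulr_natr natz mulrAC; case: ifP.
  rewrite -mulr_suml; congr (_ * _).
  transitivity (\sum_(e : K) (q.+1%:Z * chi e - q%:Z * (if e + cj e == 0 then chi e else 0))).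
    apply: eq_bigr => e _; case: ifP => _; last by rewrite mulr0 subr0 mulrC.
    by rewrite mulr1 -mulrBl -addn1 PoszD addrC addKr mul1r.
  rewrite sumrB -!mulr_sumr sum_chi mulr0 sub0r -big_mkcond sum_chi_imaginary.
  have : (q <= q ^ 2)%N by rewrite -mulnn leq_pmulr ?q_gt0.
  by move=> q2; rewrite mulrN opprK -subzn // -mulnn PoszM; ring.
rewrite (eq_bigr (fun=> (q ^ 2 - q)%N%:Z * chi h)); last by move=> b; exact: inner.
by rewrite sumr_const cardC1 card_quadext -mulr_natl natz PoszM mulrA subn1.
Qed.

Lemma sum_chi_sqr x c : iso x -> c != 0 ->
  \sum_(z | iso z) chi (her x z) * chi (her z (scv c x)) = ((q ^ 2 - 1) * q ^ 3)%N%:Z * chi c.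
Proof.
move=> ix c0; rewrite (bigID (fun z => her x z == 0)) /= big1 ?add0r => [|z /andP[_ /eqP->]]; last first.
  by rewrite chi0 mul0r.
rewrite (eq_bigr (fun=> chi c)) => [|z /andP[_ hz]]; last first.
  by rewrite her_scr chiM chi_cj -[her z x]her_cj chi_cj mulrCA chi_neq0 // mulr1.
rewrite sumr_const -mulr_natl natz; congr (Posz _ * _).
have := card_iso K; rewrite -(cardsID [set z | her x z == 0] [set z | iso z]).
have -> : [set z | iso z] :&: [set z | her x z == 0] = [set z | iso z && (her x z == 0)].
  by apply/setP=> z; rewrite !inE.
rewrite card_scv_iso // mulnDr muln1 addnC => /eqP; rewrite eqn_add2r => /eqP <-.
by apply: eq_card => z; rewrite !inE andbC.
Qed.

(** The square of the matrix [chi (her x y)] is a combination of the matrix itself and of a block on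
    proportional pairs, which is scalar on homogeneous functions. Evaluating at [base2], where V2 is
    1, gives the equation. *)
Lemma kap_quadratic :
  (kap - ((q ^ 2 - 1) * q ^ 2)%N%:Z) * (kap + ((q ^ 2 - 1) * q)%N%:Z) = 0.
Proof.
have ib := iso_base2; pose N : int := (q ^ 2 - 1)%N%:Z.
have E : kap * kap = N * (q ^ 2 - q)%N%:Z * kap + N * N * (q ^ 3)%N%:Z.
  transitivity (\sum_(z | iso z) chi (her base2 z) * T z).
    rewrite {2}/kap [twograph _ base2]/twograph mulr_sumr; apply: eq_bigr => z iz.
    by rewrite twograph_V2 // mulrCA.
  transitivity (\sum_(y | iso y) (\sum_(z | iso z) chi (her base2 z) * chi (her z y)) * V2 y).
    rewrite /twograph; under eq_bigr => z _ do rewrite mulr_sumr.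
    rewrite exchange_big /=; apply: eq_bigr => y iy; rewrite mulr_suml.
    by apply: eq_bigr => z _; rewrite mulrA.
  rewrite (bigID (fun y => her base2 y == 0)) /= addrC; congr (_ + _).
    rewrite /kap /twograph mulr_sumr [RHS](bigID (fun y => her base2 y == 0)) /=.
    rewrite [X in _ = X + _]big1 ?add0r => [|y /andP[_ /eqP ->]]; last by rewrite chi0 mul0r mulr0.
    by apply: eq_bigr => y /andP[iy hy]; rewrite sum_chi_mul // PoszM -/N mulrA.
  rewrite (eq_bigr (fun=> N * (q ^ 3)%N%:Z)) => [|y /andP[iy /eqP hy]]; last first.
    have [c yE] := isotropic_dependent (iso_neq0 ib) (iso_her ib) (iso_her iy) hy.
    have c0 : c != 0 by apply: contraTneq iy => c0; rewrite yE c0 scv0 /iso eqxx.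
    rewrite yE sum_chi_sqr // V2_homog // V2_base2 mulr1 -mulrA chi_neq0 // mulr1.
    by rewrite PoszM.
  rewrite sumr_const -mulr_natl natz mulrA; congr (_ * _ * _).
  rewrite /N -(card_scv_iso ib); congr Posz.
  by apply: eq_card => y; rewrite !inE.
have q2 : (q <= q ^ 2)%N by rewrite -mulnn leq_pmulr ?q_gt0.
rewrite !PoszM -/N; transitivity (kap * kap - N * ((q ^ 2)%N%:Z - q%:Z) * kap - N * N * ((q ^ 2)%N%:Z * q%:Z)).
  by ring.
by rewrite E -subzn // -PoszM -expnSr; ring.
Qed.

(** * The residue of [kap] modulo 4 (q^2 - 1) *)

Lemma V2_cjv y : iso y -> V2 (cjv y) = psi ii * V2 y.
Proof.
move=> iy; have Qc : bil (cjv y) (cjv y) = cj (bil y y) by rewrite bil_cj.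
have [cQ|cQ] := eqVneq (chi (bil y y)) (-1); last first.
  by rewrite !V2_square ?mulr0 // Qc chi_cj.
(* Conjugation negates [tau]; the sign is absorbed into the square as [ii ^+ 2]. *)
have [d d0 Q] := type2 cQ; rewrite (V2E d0 Q) (@V2E _ (ii * cj d)); last 2 first.
- by rewrite mulf_neq0 ?ii0 ?cj_eq0.
- by rewrite Qc Q rmorphM rmorphXn /= cj_tau exprMn ii_sq; ring.
rewrite chiM chi_ii chi_cj mul1r mulrCA; congr (_ * _).
have -> : rev (scv (ii * cj d)^-1 (cjv y)) = scv ii^-1 (rev (scv d^-1 y)).
  have -> : scv (ii * cj d)^-1 (cjv y) = scv ii^-1 (cjv (scv d^-1 y)).
    by rewrite scv_cjv scvA fmorphV invfM.
  rewrite rev_scv_real; last by apply/realV/realP; rewrite cj_ii.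
  by congr (scv _ _); apply: vec_eqP; rewrite /= /re !cjK; split; congr (_ / _); rewrite addrC.
have hn : her (scv d^-1 y) (scv d^-1 y) = 0 by rewrite her_scl her_scr (iso_her iy) !mulr0.
have [r1 _ _] := normalized_parts hn (normalize d0 Q).
have [_ _ rc] := real_entries (cjv_rev (scv d^-1 y)).
have ri : real ii^-1 by apply/realV/realP; rewrite cj_ii.
have i0 : ii^-1 != 0 by rewrite invr_eq0 ii0.
by rewrite /theta /= mulf_eq0 (negbTE i0) /=; case: ifP => _; rewrite psi_realM // psiV.
Qed.

Definition summand2 y : int := chi (her base2 y) * V2 y.

Lemma summand2_scv c y : c != 0 -> iso y -> summand2 (scv c y) = summand2 y.
Proof.
move=> c0 iy; rewrite /summand2 V2_homog // her_scr chiM chi_cj mulrACA chi_neq0 //.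
by rewrite mul1r.
Qed.

(** Conjugation followed by the substitution S -> ii S, in the chart where the middle coefficient is
    1. Its square is p -> -p, so orbits other than that of 0 have length 4. *)
Definition quarter (p : K * K) : K * K := (ii * cj p.1, - ii * cj p.2).

(** Conjugation and the substitution each multiply V2 by [psi ii], and the two factors cancel;
    [base2] is mapped to its multiple by [ii], where [chi] is 1. *)
Lemma summand2_quarter p : iso (p.1, 1, p.2) ->
  let r := quarter p in iso (r.1, 1, r.2) /\ summand2 (r.1, 1, r.2) = summand2 (p.1, 1, p.2).
Proof.
case: p => a c /=; set y := (a, 1, c) => iy.
pose h : K * K * K * K := (ii, 0, 0, 1).
have Dh : gdet h = ii by rewrite /= mulr1 mul0r subr0.
have h0 : gdet h != 0 by rewrite Dh ii0.
have rh : realg h by rewrite /= /real cj_ii rmorph0 rmorph1 !eqxx.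
have -> : (ii * cj a, 1, - ii * cj c) = act h (cjv y).
  have iV : ii^-1 = - ii by apply: (mulfI ii0); rewrite mulfV ?ii0 // mulrN -expr2 ii_sq opprK.
  apply: vec_eqP; rewrite /= mulr1 mul0r subr0 iV rmorph1; split.
  - by transitivity (- ii ^+ 2 * ii * cj a); [rewrite ii_sq; ring | ring].
  - by transitivity (- ii ^+ 2); [rewrite ii_sq; ring | ring].
  - by ring.
have icy : iso (cjv y).
  have := iy; rewrite /iso /her cjvK => /andP[y0 /eqP hy]; apply/andP; split.
    by apply: contraNneq y0 => e; rewrite -(cjvK y) e /cjv /= !rmorph0.
  by rewrite bilC; apply/eqP.
split; first by rewrite iso_act.
rewrite /summand2 V2_act // V2_cjv // Dh [psi _ * (psi _ * _)]mulrA psi_real_neq0 ?ii0 //; last by apply/realP; rewrite cj_ii.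
rewrite mul1r; congr (_ * _).
have bE : scv ii base2 = act h (cjv base2).
  apply: vec_eqP; rewrite /= mulr1 mul0r subr0 !(rmorphN, rmorphM, fmorphV, rmorph1, rmorph0, rmorph_nat) /= cj_tau; split.
  - by field; rewrite four0 ii0.
  - by ring.
  - transitivity (ii^-1 * tau * ii ^+ 2 * - (1 / 4)); first by field; rewrite four0 ii0.
    by rewrite ii_sq; field; rewrite four0 ii0.
transitivity (chi (her (scv ii base2) (act h (cjv y)))).
  by rewrite her_scl chiM chi_ii mul1r.
by rewrite bE her_act // {1}/her -bil_cj chi_cj.
Qed.

Lemma sum_summand2_mod4 : exists c : int,
  \sum_(p : K * K | iso (p.1, 1, p.2)) summand2 (p.1, 1, p.2) = 4 * c.
Proof.
pose A := [set p : K * K | iso (p.1, 1, p.2)].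
have nz p : p \in A -> p.1 != 0 \/ p.2 != 0.
  rewrite inE => /andP[_ /eqP]; case: p => a c /=.
  have [->|] := eqVneq a 0; last by left.
  have [->|] := eqVneq c 0; last by right.
  by rewrite /her /bil /= !rmorph0 rmorph1 !(mulr0, addr0, subr0, mulr1) => /eqP; rewrite oner_eq0.
have qA p : p \in A -> quarter p \in A by rewrite !inE => /summand2_quarter[].
have q2 p : quarter (quarter p) = (- p.1, - p.2).
  rewrite /quarter /= !rmorphM rmorphN /= !cjK cj_ii !mulrA mulrNN -expr2 ii_sq.
  by rewrite !mulN1r.
have qI : injective quarter.
  move=> p p' /(congr1 quarter); rewrite !q2; case: p p' => [a c] [a' c'] /= [].
  by move=> /oppr_inj -> /oppr_inj ->.
have qneg p : p \in A -> (- p.1, - p.2) != p.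
  have neg0 a : (- a == a) = (a == 0).
    by rewrite eq_sym -addr_eq0 -mulr2n -mulr_natl mulf_eq0 (negbTE two0).
  move=> /nz; apply: contraPneq => /eqP; case: p => a c; rewrite xpair_eqE /= !neg0.
  by case/andP=> -> ->; case.
have [] := @dvd_sum_orbits _ A quarter (fun p => summand2 (p.1, 1, p.2)) 4 qI qA.
- by move=> p; rewrite inE => /summand2_quarter[].
- by move=> p Ap; apply: order_four; rewrite // !q2 ?qneg //= !opprK; case: (p).
by move=> c; rewrite (eq_bigl (fun p : K * K => iso (p.1, 1, p.2))) => [E|p]; [exists c | rewrite inE].
Qed.

Lemma iso_axis k : real k -> iso ((1, 0, tau * k) : vec K).
Proof.
move/realP=> rk; apply/andP; split; first by apply/negP=> /eqP[/eqP]; rewrite oner_eq0.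
by rewrite /her /bil /= !rmorphM /= rk cj_tau rmorph1 rmorph0; apply/eqP; ring.
Qed.

Lemma V2_axis k s : real k -> real s -> s != 0 ->
  V2 (1, 0, tau * (k / s ^+ 2)) = psi s * V2 (1, 0, tau * k).
Proof.
move=> rk rs s0; pose h : K * K * K * K := (s, 0, 0, 1).
have Dh : gdet h = s by rewrite /= mulr1 mul0r subr0.
have rh : realg h by rewrite /= rs /real rmorph0 rmorph1 !eqxx.
have := @V2_act K h (1, 0, tau * k) rh; rewrite Dh => /(_ s0 (iso_axis rk)) <-.
have -> : act h (1, 0, tau * k) = scv s (1, 0, tau * (k / s ^+ 2)).
  by apply: vec_eqP; split; rewrite /= mulr1 mul0r subr0; field.
rewrite V2_homog ?chi_real ?mul1r //.
by apply: iso_axis; apply/realM/realV; rewrite // expr2 realM.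
Qed.

(** Dividing k by the fourth power of [tau] negates each term, by [V2_axis] with s = [tau ^+ 2]. *)
Lemma sum_V2_axis : \sum_(k : K | real k) V2 (1, 0, tau * k) = 0.
Proof.
have t0 : tau ^+ 2 != 0 by rewrite expf_neq0 ?tau0.
have t4 : (tau ^+ 2 ^+ 2)^-1 != 0 by rewrite invr_eq0 expf_neq0.
have rt := real_tau2 K.
suff : \sum_(k : K | real k) V2 (1, 0, tau * k) = - \sum_(k : K | real k) V2 (1, 0, tau * k) by lia.
rewrite {1}(reindex_inj (mulIf t4)) /= -sumrN; apply: eq_big => [k|k].
  apply/realP/realP => [|rk]; rewrite rmorphM fmorphV rmorphXn /= (realP _ rt); last by rewrite rk.
  by move/(mulIf t4).
move=> rk; rewrite V2_axis ?psi_tau2 ?mulN1r //.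
by have := realM rk (realM rt rt); rewrite -expr2 divfK // expf_neq0.
Qed.

(** Forms with nonzero middle coefficient contribute the multiple of 4. The others with nonzero V2
    are multiples of (1, 0, tau k), k in F_q, where [chi (her base2 _)] is -1 except for the value 0
    at [base2]. As V2 sums to 0 on this axis, what remains is [V2 base2 = 1]. *)
Lemma kap_mod : exists c : int, kap = (q ^ 2 - 1)%N%:Z * (1 + 4 * c).
Proof.
have [c cE] := sum_summand2_mod4; exists c.
rewrite /kap /twograph -/summand2 (bigID (fun y : vec K => y.1.2 == 0)) /= mulrDr; congr (_ + _); last first.
  rewrite -cE (@sum_scalings K _ [set p : K * K | iso (p.1, 1, p.2)] (fun p => (p.1, 1, p.2)) (fun x => x.1.2)) //.
  - by congr (_ * _); apply: eq_bigl => p; rewrite inE.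
  - by move=> [a b] [a' b'] _ _ /= [-> ->].
  - case=> [[a b] d] /andP[iy b0]; split=> //.
    exists (a / b, d / b); last by apply: vec_eqP; rewrite /= mulr1 ![b * _]mulrC !divfK.
    rewrite inE /=; have <- : scv b^-1 (a, b, d) = (a / b, 1, d / b).
      by apply: vec_eqP; rewrite /= mulVf // ![b^-1 * _]mulrC.
    by rewrite iso_sc ?invr_eq0.
  - move=> d p d0; rewrite inE => ip; rewrite iso_sc // ip /= mulr1 d0; split=> //.
    exact: summand2_scv.
rewrite mulr1 (bigID (fun y : vec K => y.1.1 == 0)) /= big1 ?add0r => [|y]; last first.
  case/andP=> /andP[_ /eqP b0] /eqP a0; rewrite V2_square ?mulr0 //.
  by rewrite /bil a0 b0 !(mulr0, mul0r, addr0, subr0) chi0.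
rewrite (@sum_scalings K _ [set k : K | real k] (fun k => (1, 0, tau * k)) (fun x => x.1.1)) //.
- rewrite -[RHS]mulr1; congr (_ * _).
  transitivity (\sum_(k : K | real k) (V2 base2 * (k == - 4^-1)%:R - V2 (1, 0, tau * k))).
    apply: eq_big => [k|k]; first by rewrite inE.
    rewrite inE => rk; have -> : her base2 (1, 0, tau * k) = tau * (2 * (k + 4^-1)).
      rewrite /her /bil /= rmorphM rmorph1 rmorph0 /= cj_tau (realP _ rk); field; exact: four0.
    have [->|nk] := eqVneq k (- 4^-1).
      rewrite addNr !mulr0 chi0 mul0r mulr1; apply/esym/eqP; rewrite subr_eq0; apply/eqP.
      by congr V2; apply: vec_eqP; split=> //=; ring.
    rewrite mulr0 sub0r chiM chi_tau chi_real ?mulr1 ?mulN1r //.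
      apply: realM (real_nat K 2) (realD rk (realV (real_nat K 4))).
    by rewrite mulf_neq0 ?two0 // addr_eq0.
  rewrite sumrB sum_V2_axis subr0 V2_base2 (bigD1 (- 4^-1)) /=; last first.
    exact: realN (realV (real_nat K 4)).
  by rewrite eqxx mulr1 big1 ?addr0 // => k /andP[_ /negbTE->]; rewrite mulr0.
- by move=> k k' _ _ [] /(mulfI tau0).
- case=> [[a b] d] /andP[/andP[iy /eqP /= b0] a0]; split=> //.
  exists (d / a / tau); last first.
    by apply: vec_eqP; rewrite /= b0 mulr0 mulr1 [tau * _]mulrC divfK ?tau0 // [a * _]mulrC divfK.
  have : iso (scv a^-1 (a, b, d)) by rewrite iso_sc ?invr_eq0.
  have -> : scv a^-1 (a, b, d) = (1, 0, d / a).
    by apply: vec_eqP; rewrite /= mulVf // b0 mulr0 [a^-1 * _]mulrC.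
  rewrite inE => /andP[_]; rewrite /her /bil /= rmorph1 rmorph0 mulr0 sub0r oppr_eq0 mulf_eq0 (negbTE two0).
  rewrite mul1r mulr1 addr_eq0 /= => /eqP; move: (d / a) => z e; apply/realP.
  by rewrite rmorphM fmorphV /= e cj_tau; field; rewrite oppr_eq0 tau0.
- move=> d k d0; rewrite inE => rk; rewrite iso_sc // iso_axis //= mulr0 mulr1 eqxx d0; split=> //.
  by apply: summand2_scv => //; exact: iso_axis.
Qed.

(** The other root would give 1 + 4 c = -q, but -q is 3 modulo 4. *)
Lemma kapE : kap = ((q ^ 2 - 1) * q ^ 2)%N%:Z.
Proof.
have /eqP := kap_quadratic; rewrite mulf_eq0 subr_eq0 => /orP[/eqP //|].
have [c ->] := kap_mod; rewrite PoszM -mulrDr mulf_eq0 => /orP[|/eqP].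
  by rewrite eqz_nat -leqn0 leqNgt units_gt0.
by rewrite (qE K); lia.
Qed.

Lemma esum_V2 w : her w w = -1 -> esum (@V2 K) w = 0.
Proof.
move=> hww; have := sum_esum_sqr (@V2_homog K).
rewrite [RHS]big1 => [E|x ix]; last first.
  rewrite twograph_V2 // kapE !PoszM -addn1 PoszD; ring.
have : \sum_(w | her w w == -1) esum (@V2 K) w ^+ 2 == 0 by rewrite E.
rewrite psumr_eq0 => [/allP/(_ w)|v _]; last exact: sqr_ge0.
by rewrite mem_index_enum hww eqxx expf_eq0 /= => /(_ isT)/eqP.
Qed.

End SpinorPart.

(** * From signs to hemisystems *)

Lemma card_fibers (T T' : finType) (f : T -> T') (A : {set T}) k :
  {in A, forall x, #|[set y in A | f y == f x]| = k} -> #|A| = (#|f @: A| * k)%N.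
Proof.
move=> fk; rewrite -sum1_card (partition_big_imset f) /= -sum_nat_const.
apply: eq_bigr => _ /imsetP[x Ax ->]; rewrite -(fk x Ax) sum1dep_card.
by apply: eq_card => y; rewrite !inE.
Qed.

Lemma card_balanced (T : finType) (A : {set T}) (phi : T -> int) :
  {in A, forall x, phi x * phi x = 1} -> \sum_(x in A) phi x = 0 ->
  (#|[set x in A | phi x == 1]| * 2 = #|A|)%N.
Proof.
move=> phi2 phi0; apply/eqP; rewrite -eqz_nat PoszM -subr_eq0 -phi0.
have -> : #|[set x in A | phi x == 1]|%:Z = \sum_(x in A) (phi x == 1)%:R.
  rewrite -sum1dep_card -natz natr_sum big_mkcondr /=.
  by apply: eq_bigr => x _; case: ifP.
have -> : #|A|%:Z = \sum_(x in A) 1 by rewrite sumr_const natz.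
rewrite big_distrl -sumrB /=; apply/eqP/eq_bigr => x Ax.
have : (phi x - 1) * (phi x + 1) = 0 by rewrite -subr_sqr expr1n expr2 phi2 ?subrr.
move/eqP; rewrite mulf_eq0 subr_eq0 addr_eq0 => /orP[]/eqP-> //.
Qed.

Section Geometry.
Variable K : quadext.
Implicit Types (x y z w v : vec K) (a b c d s t : K) (V : vec K -> int) (P : point K).
Local Notation q := (ord_q K).
Local Notation two0 := (two_neq0 K).
Local Notation ii := (ii K).
Local Notation rV4 := 'rV[K]_4.
Implicit Types (u : rV4).

Lemma vaddC x y : vadd x y = vadd y x.
Proof. by apply: vec_eqP; rewrite /= ![x.1.1 + _]addrC ![x.1.2 + _]addrC ![x.2 + _]addrC. Qed.

(* Since ii ^ 2 = -1, (a - c) ^ 2 + (- ii (a + c)) ^ 2 = - 4 a c: the coordinates diagonalise the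
   discriminant. *)
Definition emb x t : rV4 :=
  \row_j [:: x.1.1 - x.2; - ii * (x.1.1 + x.2); x.1.2; t]`_j.

Definition fst3 u : vec K :=
  ((u 0 (inord 0) + ii * u 0 (inord 1)) / 2, u 0 (inord 2), (ii * u 0 (inord 1) - u 0 (inord 0)) / 2).

Definition fourth u : K := u 0 (inord 3).

Lemma row4P u u' : (forall j, (j < 4)%N -> u 0 (inord j) = u' 0 (inord j)) -> u = u'.
Proof.
by move=> E; apply/rowP=> j; rewrite -(inord_val j) E.
Qed.

Lemma embE x t j : (j < 4)%N ->
  emb x t 0 (inord j) = [:: x.1.1 - x.2; - ii * (x.1.1 + x.2); x.1.2; t]`_j.
Proof. by move=> j4; rewrite mxE inordK. Qed.

Lemma fst3_emb x t : fst3 (emb x t) = x.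
Proof.
have i2 := ii_sq K; apply: vec_eqP; rewrite /fst3 !embE //=; split=> //.
  transitivity ((x.1.1 - x.2 - ii ^+ 2 * (x.1.1 + x.2)) / 2); first by field; exact: two0.
  by rewrite i2; field; exact: two0.
transitivity ((x.2 - x.1.1 - ii ^+ 2 * (x.1.1 + x.2)) / 2); first by field; exact: two0.
by rewrite i2; field; exact: two0.
Qed.

Lemma fourth_emb x t : fourth (emb x t) = t.
Proof. by rewrite /fourth embE. Qed.

Lemma emb_parts u : u = emb (fst3 u) (fourth u).
Proof.
apply: row4P => -[|[|[|[|j]]]] // _; rewrite embE //=.
  by field; exact: two0.
transitivity (- ii ^+ 2 * u 0 (inord 1)); first by rewrite ii_sq opprK mul1r.
by field; exact: two0.
Qed.

Lemma emb_inj x t x' t' : emb x t = emb x' t' -> x = x' /\ t = t'.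
Proof.
by move=> E; split; [rewrite -(fst3_emb x t) E fst3_emb | rewrite -(fourth_emb x t) E fourth_emb].
Qed.

Lemma embZ c x t : c *: emb x t = emb (scv c x) (c * t).
Proof.
by apply: row4P => -[|[|[|[|j]]]] // _; rewrite mxE !embE //=; ring.
Qed.

Lemma embD x t y s : emb x t + emb y s = emb (vadd x y) (t + s).
Proof.
by apply: row4P => -[|[|[|[|j]]]] // _; rewrite mxE !embE //=; ring.
Qed.

Lemma emb_eq0 x t : (emb x t == 0) = (x == vzero K) && (t == 0).
Proof.
have E0 : emb (vzero K) 0 = 0.
  by apply: row4P => -[|[|[|[|j]]]] // _; rewrite embE ?mxE //= ?addr0 ?subrr ?mulr0.
apply/eqP/andP => [|[/eqP-> /eqP->] //].
by rewrite -E0 => /emb_inj[-> ->]; rewrite !eqxx.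
Qed.

Definition hform u : K := \sum_(i < 4) u 0 i ^+ q.+1.

Lemma hform_emb x t : hform (emb x t) = her x x + t * cj t.
Proof.
rewrite /hform !big_ord_recl big_ord0 addr0 !mxE /= !exprS -!cjE.
rewrite !(rmorphM, rmorphB, rmorphD, rmorphN) /= cj_ii /her /bil /=.
transitivity ((x.1.1 - x.2) * (cj x.1.1 - cj x.2) +
  ii ^+ 2 * ((x.1.1 + x.2) * (cj x.1.1 + cj x.2)) + x.1.2 * cj x.1.2 + t * cj t); first by ring.
by rewrite ii_sq; ring.
Qed.

Lemma hformZ c u : hform (c *: u) = c ^+ q.+1 * hform u.
Proof. by rewrite /hform mulr_sumr; apply: eq_bigr => i _; rewrite mxE exprMn. Qed.

Lemma point_vect P : exists2 u, u != 0 & val P = <[u]>%VS.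
Proof.
have d1 := valP P; exists (vpick (val P)).
  by rewrite vpick0 -dimv_eq0 (eqP d1).
apply/esym/eqP; rewrite -dimv_leqif_eq; last by rewrite -memvE memv_pick.
by rewrite dim_vline vpick0 -dimv_eq0 (eqP d1).
Qed.

Lemma pt_subproof u : \dim <[if u == 0%R then emb (vzero K) 1%R else u]>%VS == 1%N.
Proof.
rewrite dim_vline; case: (eqVneq u 0) => [_|-> //].
by rewrite emb_eq0 oner_eq0 andbF.
Qed.

(* The junk value at u = 0 is an arbitrary point. *)
Definition pt u : point K := Sub <[if u == 0%R then emb (vzero K) 1%R else u]>%VS (pt_subproof u).

Lemma val_pt u : u != 0 -> val (pt u) = <[u]>%VS.
Proof. by move=> u0; rewrite SubK (negbTE u0). Qed.

Lemma point_pt P : exists2 u, u != 0 & P = pt u.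
Proof.
by have [u u0 Pu] := point_vect P; exists u => //; apply: val_inj; rewrite val_pt.
Qed.

Lemma pt_eq u u' : u != 0 -> u' != 0 -> pt u = pt u' -> exists2 c, c != 0 & u' = c *: u.
Proof.
move=> u0 u'0 E; have /vlineP[c cE] : u' \in <[u]>%VS by rewrite -val_pt // E val_pt // memv_line.
by exists c => //; apply: contraNneq u'0 => c0; rewrite cE c0 scale0r.
Qed.

Lemma ptZ c u : c != 0 -> u != 0 -> pt (c *: u) = pt u.
Proof.
move=> c0 u0; apply: val_inj; rewrite !val_pt ?scaler_eq0 ?negb_or ?c0 //.
apply/eqP; rewrite eqEsubv -!memvE; apply/andP; split; first by rewrite memvZ ?memv_line.
by rewrite -[X in X \in _](scalerK c0) memvZ ?memv_line.
Qed.

Lemma mem_surface u : u != 0 -> (pt u \in hermitian_surface K q) = (hform u == 0).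
Proof.
move=> u0; rewrite inE val_pt //; apply/forallP/idP => [/(_ u)|/eqP h v].
  by rewrite memv_line.
apply/implyP => /vlineP[c ->]; have := hformZ c u; rewrite /hform => ->.
by rewrite -/(hform u) h mulr0.
Qed.

Lemma surface_cases P : P \in hermitian_surface K q ->
  (exists2 x, iso x & P = pt (emb x 0)) \/ (exists2 w, her w w = -1 & P = pt (emb w 1)).
Proof.
have [u u0 ->] := point_pt P; rewrite mem_surface // (emb_parts u).
move: (fst3 u) (fourth u) (emb_parts u) => x t uE; rewrite {}uE in u0 *.
rewrite hform_emb; have [t0|t0] := eqVneq t 0.
  rewrite t0 mul0r addr0 => hx; left; exists x => //; rewrite /iso hx andbT.
  by move: u0; rewrite emb_eq0 t0 eqxx andbT.
rewrite addr_eq0 => /eqP hx; right; exists (scv t^-1 x).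
  by rewrite her_scl her_scr hx fmorphV /=; field; rewrite cj_eq0 t0.
by rewrite -(ptZ (invr_neq0 t0) u0) embZ mulVf.
Qed.

Definition span2 x w : {vspace rV4} := (<[emb x 0%R]> + <[emb w 1%R]>)%VS.

Definition gline x w : {set point K} := [set P | (val P <= span2 x w)%VS].

Lemma mem_span2 x w v t :
  reflect (exists d, v = vadd (scv d x) (scv t w)) (emb v t \in span2 x w).
Proof.
apply: (iffP memv_addP) => [[_ /vlineP[d ->] [_ /vlineP[e ->]]]|[d ->]].
  rewrite !embZ embD mulr0 add0r mulr1 => /emb_inj[-> ->]; by exists d.
exists (d *: emb x 0); first by rewrite memvZ ?memv_line.
exists (t *: emb w 1); first by rewrite memvZ ?memv_line.
by rewrite !embZ embD mulr0 add0r mulr1.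
Qed.

Lemma mem_gline u x w : u != 0 -> (pt u \in gline x w) = (u \in span2 x w).
Proof. by move=> u0; rewrite inE val_pt // -memvE. Qed.

Lemma emb_neq0r w : emb w 1 != 0.
Proof. by rewrite emb_eq0 oner_eq0 andbF. Qed.

Lemma emb_neq0l x : iso x -> emb x 0 != 0.
Proof. by case/andP=> x0 _; rewrite emb_eq0 negb_and x0. Qed.

Definition adm x w := [&& iso x, her w x == 0 & her w w == -1].

Lemma dim_span2 x w : iso x -> \dim (span2 x w) = 2.
Proof.
move=> ix; have x0 := emb_neq0l ix.
rewrite dimv_disjoint_sum ?dim_vline ?x0 ?emb_neq0r //.
apply/eqP; rewrite -subv0; apply/subvP => v; rewrite memv_cap => /andP[/vlineP[c ->] /vlineP[d]].
rewrite !embZ mulr0 mulr1 => /emb_inj[E d0].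
rewrite memv0 emb_eq0 eqxx andbT E -d0 scv0 eqxx //.
Qed.

Lemma gline_generator x w : adm x w -> gline x w \in generators K q.
Proof.
case/and3P=> ix /eqP hwx /eqP hww; rewrite inE; apply/andP; split.
  by apply/imsetP; exists (span2 x w); rewrite // inE dim_span2.
apply/subsetP => P; have [u u0 ->] := point_pt P.
rewrite mem_gline // mem_surface // (emb_parts u) => /mem_span2[d ->].
have hxw : her x w = 0 by rewrite -her_cj hwx rmorph0.
rewrite hform_emb !her_addl !her_addr !her_scl !her_scr (iso_her ix) hwx hxw hww.
by apply/eqP; ring.
Qed.

(** The line meets the plane t = 0 only in x, up to scaling, and its vectors with t = 1 are the
    translates of w by multiples of x. Hence a generator comes from (q^2 - 1) q^2 pairs, the fibre
    size in all the counts below. *)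
Lemma gline_eq x w x' w' : iso x -> iso x' ->
  gline x' w' = gline x w -> exists c d, [/\ c != 0, x' = scv c x & w' = vadd w (scv d x)].
Proof.
move=> ix ix' E.
have : pt (emb x' 0) \in gline x w.
  rewrite -E mem_gline ?emb_neq0l //; apply/mem_span2; exists 1.
  by rewrite scv1 scv0; apply: vec_eqP; rewrite /= !addr0.
have : pt (emb w' 1) \in gline x w.
  rewrite -E mem_gline ?emb_neq0r //; apply/mem_span2; exists 0.
  by rewrite scv1 scv0; apply: vec_eqP; rewrite /= !add0r.
rewrite !mem_gline ?emb_neq0l ?emb_neq0r // => /mem_span2[d wE] /mem_span2[c xE].
have {}xE : x' = scv c x by rewrite xE scv0; apply: vec_eqP; rewrite /= !addr0.
exists c, d; split=> //.
  by apply: contraTneq ix' => c0; rewrite xE c0 scv0 /iso eqxx.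
by rewrite wE scv1 vaddC.
Qed.

Lemma gline_sub x w c d : c != 0 -> gline (scv c x) (vadd w (scv d x)) = gline x w.
Proof.
move=> c0; apply/setP => P; have [u u0 ->] := point_pt P; rewrite !mem_gline // (emb_parts u).
apply/mem_span2/mem_span2 => -[e ->].
  by exists (e * c + fourth u * d); apply: vec_eqP; split; rewrite /=; ring.
by exists ((e - fourth u * d) / c); apply: vec_eqP; split; rewrite /=; field.
Qed.

Section Hemisystem.
Variable V : vec K -> int.
Hypothesis homV : homog V.
Hypothesis sqrV : forall x, iso x -> V x * V x = 1.
Hypothesis esumV : forall w, her w w = -1 -> esum V w = 0.

Definition gsign x w := V x * sgL x w.

Definition chosen : {set vec K * vec K} := [set p | adm p.1 p.2 & gsign p.1 p.2 == 1].

Definition hemi : {set {set point K}} := [set gline p.1 p.2 | p in chosen].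

Lemma adm_shift x w c d : c != 0 -> adm (scv c x) (vadd w (scv d x)) = adm x w.
Proof.
move=> c0; rewrite /adm iso_sc //; case: (boolP (iso x)) => //= ix; have hx := iso_her ix.
rewrite her_addl her_scl !her_scr hx !mulr0 addr0 mulf_eq0 cj_eq0 (negbTE c0) /=.
have [hwx|//] := eqVneq (her w x) 0; have hxw : her x w = 0 by rewrite -her_cj hwx rmorph0.
by rewrite !her_addl !her_addr !her_scl !her_scr hwx hxw hx !mulr0 !addr0.
Qed.

(** The sign belongs to the line and not to the pair: [V] and [sgL] both change by [chi c], and
    [Lam] ignores multiples of x added to w. *)
Lemma gsign_shift x w c d : c != 0 -> adm x w -> gsign (scv c x) (vadd w (scv d x)) = gsign x w.
Proof.
move=> c0 /and3P[ix /eqP hwx /eqP hww]; have hx := iso_her ix.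
have : adm (scv c x) (vadd w (scv d x)) by rewrite adm_shift // /adm ix hwx hww !eqxx.
case/and3P=> _; rewrite her_scr mulf_eq0 cj_eq0 (negbTE c0) /= => /eqP h1 /eqP h2.
by rewrite /gsign homV // sgL_scl // /sgL Lam_addr mulrACA chi_neq0 // mul1r.
Qed.

Lemma gsign_sqr x w : iso x -> gsign x w * gsign x w = 1.
Proof. by move=> ix; rewrite /gsign mulrACA sqrV // sgL_sq. Qed.

Lemma vadd_scv_inj x w : x != vzero K -> injective (fun d => vadd w (scv d x)).
Proof.
move=> x0 d e [e1 e2 e3]; apply: (scv_injl x0); apply: vec_eqP.
by move: e1 e2 e3 => /addrI ? /addrI ? /addrI ?.
Qed.

Lemma card_signed_perp x : iso x ->
  (#|[set w | adm x w & gsign x w == 1]| * 2 = q ^ 2 * q.+1)%N.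
Proof.
move=> ix; rewrite -(card_perp_iso ix).
rewrite -(@card_balanced _ [set w | (her w x == 0) && (her w w == -1)] (gsign x)).
- by congr (_ * 2)%N; apply: eq_card => w; rewrite !inE /adm ix.
- by move=> w _; apply: gsign_sqr.
set A := [set w | _]; pose s := \sum_(w in A) gsign x w.
suff : s = - s by rewrite -/s; lia.
have n1 : -1 != 0 :> K by rewrite oppr_eq0 oner_eq0.
rewrite {1}/s (reindex_inj (scv_inj n1)) /s -sumrN; apply: eq_big => [w|w].
  rewrite !inE !her_scl her_scr mulrA !mulf_eq0 (negbTE n1) /=.
  by congr (_ && (_ == _)); ring.
rewrite inE !her_scl her_scr mulrA !mulf_eq0 (negbTE n1) /= => /andP[/eqP hwx /eqP hww].
rewrite /gsign sgL_opp ?mulrN // -hww; ring.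
Qed.

Lemma card_signed_iso w : her w w = -1 ->
  (#|[set x | adm x w & gsign x w == 1]| * 2 = (q ^ 2 - 1) * q.+1)%N.
Proof.
move=> hww; rewrite -(card_iso_perp hww) -(@card_balanced _ [set x | iso x && (her w x == 0)] (fun x => gsign x w)).
- by congr (_ * 2)%N; apply: eq_card => x; rewrite !inE /adm hww eqxx andbT.
- by move=> x; rewrite inE => /andP[ix _]; apply: gsign_sqr.
by rewrite -[RHS](esumV hww); apply: eq_bigl => x; rewrite inE.
Qed.

Lemma vadd_scv0 w x : vadd w (scv 0 x) = w.
Proof. by apply: vec_eqP; rewrite /= !mul0r !addr0. Qed.

Lemma chosen_shift x w c d : c != 0 ->
  ((scv c x, vadd w (scv d x)) \in chosen) = ((x, w) \in chosen).
Proof.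
move=> c0; rewrite !inE /= adm_shift //; case: (boolP (adm x w)) => //= ad.
by rewrite gsign_shift.
Qed.

Lemma mem_chosen x w : ((x, w) \in chosen) = adm x w && (gsign x w == 1).
Proof. by rewrite inE. Qed.

Lemma lines_at_vertex x : iso x ->
  (#|[set L in hemi | pt (emb x 0%R) \in L]| * 2 = q.+1)%N.
Proof.
move=> ix; have x0 := iso_neq0 ix; have ex0 := emb_neq0l ix.
pose A := [set w | (x, w) \in chosen].
have -> : [set L in hemi | pt (emb x 0) \in L] = gline x @: A.
  apply/setP => L; rewrite inE; apply/andP/imsetP => [[/imsetP[[y w] yw ->]]|[w]].
    rewrite mem_gline // => /mem_span2[c xE].
    have {}xE : x = scv c y by rewrite xE scv0; apply: vec_eqP; rewrite /= !addr0.
    have c0 : c != 0 by apply: contraNneq x0 => c0; rewrite xE c0 scv0.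
    exists w; last by rewrite -(vadd_scv0 w y) xE gline_sub ?vadd_scv0.
    by rewrite inE -(vadd_scv0 w y) xE chosen_shift.
  rewrite inE => xw ->; split; first by apply/imsetP; exists (x, w).
  rewrite mem_gline //; apply/mem_span2; exists 1.
  by apply: vec_eqP; rewrite /= !mul1r !mul0r !addr0.
have fib w : w \in A -> #|[set w' in A | gline x w' == gline x w]| = (q ^ 2)%N.
  rewrite inE => xw; rewrite -card_quadext -cardsT -(card_imset _ (@vadd_scv_inj x w x0)).
  apply: eq_card => w'; rewrite !inE /=; apply/andP/imsetP => [[xw' /eqP E]|[d _ ->]].
    by have [c [d [_ _ ->]]] := gline_eq ix ix E; exists d; rewrite ?inE.
  have := chosen_shift x w d (oner_neq0 K); have := gline_sub x w d (oner_neq0 K).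
  by rewrite scv1 xw mem_chosen => -> ->; rewrite eqxx.
have := card_signed_perp ix; rewrite (_ : [set w | adm x w & gsign x w == 1] = A); last first.
  by apply/setP => w; rewrite !inE.
rewrite (card_fibers fib) mulnAC [in RHS]mulnC => /eqP.
by rewrite eqn_pmul2r ?expn_gt0 ?q_gt0 // => /eqP.
Qed.

Lemma lines_at_affine w : her w w = -1 ->
  (#|[set L in hemi | pt (emb w 1%R) \in L]| * 2 = q.+1)%N.
Proof.
move=> hww; have ew0 := emb_neq0r w.
pose A := [set x | (x, w) \in chosen].
have isoA x : x \in A -> iso x by rewrite inE mem_chosen => /andP[/and3P[]].
have -> : [set L in hemi | pt (emb w 1) \in L] = gline^~ w @: A.
  apply/setP => L; rewrite inE; apply/andP/imsetP => [[/imsetP[[x v] xv ->]]|[x]].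
    rewrite mem_gline // => /mem_span2[d wE]; have n1 := oner_neq0 K.
    have {}wE : w = vadd v (scv d x) by rewrite wE scv1 vaddC.
    exists x; last by rewrite -[X in _ = gline X _](scv1 x) wE gline_sub.
    by rewrite inE -[X in (X, _)](scv1 x) wE chosen_shift.
  rewrite inE => xw ->; split; first by apply/imsetP; exists (x, w).
  rewrite mem_gline //; apply/mem_span2; exists 0.
  by apply: vec_eqP; rewrite /= !mul1r !mul0r !add0r.
have fib x : x \in A -> #|[set y in A | gline y w == gline x w]| = (q ^ 2 - 1)%N.
  move=> xA; have ix := isoA x xA; have x0 := iso_neq0 ix; move: xA; rewrite inE => xw.
  rewrite -card_nonzero -(card_imset _ (scv_injl x0)).
  apply: eq_card => y; rewrite !inE /=; apply/andP/imsetP => [[yw /eqP E]|[c]].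
    have /andP[/and3P[iy _ _] _] := yw.
    by have [c [d [c0 -> _]]] := gline_eq ix iy E; exists c; rewrite ?inE.
  rewrite inE => c0 ->; have := chosen_shift x w 0 c0; have := gline_sub x w 0 c0.
  by rewrite vadd_scv0 xw mem_chosen => -> ->; rewrite eqxx.
have := card_signed_iso hww; rewrite (_ : [set x | adm x w & gsign x w == 1] = A); last first.
  by apply/setP => x; rewrite !inE.
rewrite (card_fibers fib) mulnAC [in RHS]mulnC => /eqP.
by rewrite eqn_pmul2r ?units_gt0 // => /eqP.
Qed.

Lemma card_chosen : (#|chosen| * 2 = (q ^ 2 - 1) * (q ^ 3 + 1) * (q ^ 2 * q.+1))%N.
Proof.
rewrite -card_iso -sum1_card (eq_bigl (fun p : vec K * vec K => iso p.1 && (adm p.1 p.2 && (gsign p.1 p.2 == 1)))) => [|[x w]]; last first.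
  by rewrite inE /adm; case: (iso x).
rewrite -(pair_big_dep (fun x => iso x) (fun x w => adm x w && (gsign x w == 1)) (fun _ _ => 1%N)) /=.
rewrite big_distrl /= -[#|_|]sum1_card big_distrl /=.
apply: eq_big => [x|x ix]; first by rewrite inE.
by rewrite mul1n -(card_signed_perp ix) sum1dep_card.
Qed.

Lemma card_hemi : (#|hemi| * 2 = (q ^ 3 + 1) * q.+1)%N.
Proof.
have fib p : p \in chosen ->
    #|[set p' in chosen | gline p'.1 p'.2 == gline p.1 p.2]| = ((q ^ 2 - 1) * q ^ 2)%N.
  case: p => x w xw; have ix : iso x by move: xw; rewrite mem_chosen => /andP[/and3P[]].
  have x0 := iso_neq0 ix.
  rewrite -card_nonzero -card_quadext -cardsT -cardsX.
  pose f (cd : K * K) := (scv cd.1 x, vadd w (scv cd.2 x)).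
  have fI : injective f.
    by move=> [c d] [c' d'] E; have -> : c = c' := scv_injl x0 (congr1 fst E);
      have -> : d = d' := vadd_scv_inj x0 (congr1 snd E).
  rewrite -(card_imset _ fI); apply: eq_card => -[y v].
  rewrite inE /=; apply/andP/imsetP => [[yv /eqP E]|[[c d]]].
    have iy : iso y by move: yv; rewrite mem_chosen => /andP[/and3P[]].
    by have [c [d [c0 -> ->]]] := gline_eq ix iy E; exists (c, d); rewrite ?inE /= ?c0.
  by rewrite !inE /= andbT => c0 [-> ->]; rewrite gline_sub // -mem_chosen chosen_shift.
have := card_chosen; rewrite (card_fibers fib) -/hemi => E.
have q2 : (0 < (q ^ 2 - 1) * q ^ 2)%N.
  by rewrite muln_gt0 expn_gt0 q_gt0 units_gt0.
apply/eqP; rewrite -(eqn_pmul2r q2) mulnAC E; apply/eqP; lia.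
Qed.

Lemma hemi_hemisystem : is_hemisystem q hemi.
Proof.
have half n k : (n * 2 = k)%N -> n = k./2 by move=> <-; rewrite muln2 doubleK.
split.
- apply/subsetP => L /imsetP[[x w]]; rewrite mem_chosen => /andP[ad _] ->.
  exact: gline_generator.
- by apply: half; rewrite card_hemi addn1.
- move=> P /surface_cases[[x ix ->]|[w hww ->]]; apply: half.
    exact: lines_at_vertex.
  exact: lines_at_affine.
Qed.

End Hemisystem.

End Geometry.

(** * The group *)

Section Symmetry.
Variable K : quadext.
Implicit Types (x y z w v : vec K) (b c d s : K) (g h : K * K * K * K) (eps : int).
Local Notation q := (ord_q K).
Local Notation m := (qe_m K).
Local Notation rV4 := 'rV[K]_4.
Implicit Types (u : rV4).

Definition Vsum eps x : int := V1 x + eps * VO x + V2 x.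

Lemma Vsum_homog eps : homog (Vsum eps).
Proof.
by move=> c x c0 ix; rewrite /Vsum (V1_homog c0 ix) (VO_homog c0 ix) (V2_homog c0 ix); ring.
Qed.

Lemma Vsum_sqr eps x : eps * eps = 1 -> iso x -> Vsum eps x * Vsum eps x = 1.
Proof.
move=> e1 ix; rewrite /Vsum; have [Q|Q] := eqVneq (bil x x) 0.
  have [s [r [s0 rr r0 Qr xE]]] := null_real ix Q.
  rewrite V2_square ?Q ?chi0 // /V1 Q psi0 add0r addr0 mulrACA e1 mul1r.
  by rewrite xE VO_real // chi_neq0.
have -> : VO x = 0 by rewrite /VO (negbTE Q).
have [h|h] := eqVneq (chi (bil x x)) 1.
  by rewrite V2_square ?h // mulr0 !addr0 /V1 psi_neq0.
by rewrite /V1 psi_nonsquare // mulr0 !add0r V2_sqr // chi_neq1.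
Qed.

Lemma esum_Vsum eps w : her w w = -1 ->
  esum (fun x => V1 x + eps * VO x) w = 0 -> esum (Vsum eps) w = 0.
Proof. by move=> hww E; rewrite /Vsum esumD E esum_V2. Qed.

Lemma Vsum_act eps g x : realg g -> gdet g = 1 -> iso x -> Vsum eps (act g x) = Vsum eps x.
Proof.
move=> rg D ix; have D0 : gdet g != 0 by rewrite D oner_neq0.
by rewrite /Vsum V1_act // VO_act // V2_act // D psi1 mul1r.
Qed.

Definition gone : K * K * K * K := (1, 0, 0, 1).

Definition gmul g h : K * K * K * K :=
  let: (al, be, ga, de) := g in let: (al', be', ga', de') := h in
  (al * al' + be * ga', al * be' + be * de', ga * al' + de * ga', ga * be' + de * de').

Lemma realg_one : realg gone.
Proof. by rewrite /= /real rmorph0 rmorph1 !eqxx. Qed.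

Lemma gmul1l g : gmul gone g = g.
Proof. by case: g => [[[? ?] ?] ?]; rewrite /= !mul1r !mul0r !addr0 !add0r. Qed.

Lemma gmul1r g : gmul g gone = g.
Proof. by case: g => [[[? ?] ?] ?]; rewrite /= !mulr1 !mulr0 !addr0 !add0r. Qed.

Lemma gdet_mul g h : gdet (gmul g h) = gdet g * gdet h.
Proof. by case: g => [[[? ?] ?] ?]; case: h => [[[? ?] ?] ?] /=; ring. Qed.

Lemma gdet_one : gdet gone = 1. Proof. by rewrite /=; ring. Qed.

Lemma act_mul g h x : gdet g != 0 -> gdet h != 0 -> act (gmul g h) x = act h (act g x).
Proof.
move=> Dg Dh; have := gdet_mul g h; case: g Dg => [[[al be] ga] de]; case: h Dh => [[[al' be'] ga'] de'] /= Dh Dg E.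
rewrite E; apply: vec_eqP; split; rewrite /=; field; rewrite Dh Dg //.
Qed.

Lemma act_one x : act gone x = x.
Proof. by apply: vec_eqP; rewrite /= !(mulr1, mulr0, subr0, invr1); split; ring. Qed.

Definition collin g c u : rV4 := emb (act g (fst3 u)) (c * fourth u).

Lemma fst3_linear b u u' : fst3 (b *: u + u') = vadd (scv b (fst3 u)) (fst3 u').
Proof. by rewrite {1}(emb_parts u) {1}(emb_parts u') embZ embD fst3_emb. Qed.

Lemma fourth_linear b u u' : fourth (b *: u + u') = b * fourth u + fourth u'.
Proof. by rewrite /fourth !mxE. Qed.

Lemma collin_linear g c : linear (collin g c).
Proof.
move=> b u u'; rewrite /collin fst3_linear fourth_linear act_add act_scv embZ embD.
by congr emb; ring.
Qed.

HB.instance Definition _ g c := GRing.isLinear.Build K rV4 rV4 *:%R (collin g c) (collin_linear g c).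

Definition collmx g c : 'M[K]_4 := lin1_mx (collin g c).

Lemma mul_collmx u g c : u *m collmx g c = collin g c u.
Proof. exact: mul_rV_lin1. Qed.

Lemma collmx_mul g h c d : gdet g != 0 -> gdet h != 0 ->
  collmx g c *m collmx h d = collmx (gmul g h) (c * d).
Proof.
move=> Dg Dh; apply/row_matrixP=> i; rewrite !rowE mulmxA !mul_collmx.
by rewrite /collin fst3_emb fourth_emb act_mul // mulrA [d * c]mulrC.
Qed.

Lemma collmx_one : collmx gone 1 = 1%:M.
Proof.
apply/row_matrixP=> i; rewrite !rowE mul_collmx mulmx1 /collin act_one mul1r.
by rewrite -emb_parts.
Qed.

Lemma gdet_inv g : gdet (ginv g) = gdet g.
Proof. by case: g => [[[? ?] ?] ?] /=; ring. Qed.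

Lemma collmx_unit g c : gdet g != 0 -> c != 0 -> collmx g c \in unitmx.
Proof.
move=> D c0; suff /mulmx1_unit[] : collmx g c *m collmx (ginv g) c^-1 = 1%:M by [].
apply/row_matrixP=> i; rewrite !rowE mulmxA !mul_collmx mulmx1.
by rewrite /collin fst3_emb fourth_emb actK // mulKf // -emb_parts.
Qed.

Lemma collin_neq0 g c u : gdet g != 0 -> c != 0 -> u != 0 -> collin g c u != 0.
Proof.
move=> D c0; rewrite -mul_collmx; apply: contraNneq => E.
by rewrite -[u](mulmxK (collmx_unit D c0)) E mul0mx.
Qed.

(** [insubd] would return the identity for a singular matrix; a nonzero determinant and a nonzero c
    exclude this case in [coll_pt]. *)
Definition coll g c : {perm point K} :=
  actperm (point_action K) (insubd (1%g : {'GL_4[K]}) (collmx g c)).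

Lemma coll_pt g c u : gdet g != 0 -> c != 0 -> u != 0 -> coll g c (pt u) = pt (collin g c u).
Proof.
move=> D c0 u0; rewrite /coll actpermE; apply: val_inj.
rewrite (val_pt (collin_neq0 D c0 u0)) /= insubdK; last exact: collmx_unit.
rewrite (_ : (if u == 0 then _ else u) = u) ?(negbTE u0) // limg_line lfunE /=.
by rewrite mul_collmx.
Qed.

Lemma hform_collin g c u : realg g -> gdet g != 0 -> c * cj c = 1 ->
  hform (collin g c u) = hform u.
Proof.
move=> rg D c1; rewrite [in RHS](emb_parts u) !hform_emb her_act // rmorphM /=.
by rewrite mulrACA c1 mul1r.
Qed.

Lemma coll_mul g h c d : gdet g = 1 -> gdet h = 1 -> c != 0 -> d != 0 ->
  (coll g c * coll h d)%g = coll (gmul g h) (c * d).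
Proof.
move=> Dg Dh c0 d0; apply/permP=> P; have [u u0 ->] := point_pt P.
rewrite permM !coll_pt ?collin_neq0 ?gdet_mul ?Dg ?Dh ?mulr1 ?oner_neq0 ?mulf_neq0 //.
by rewrite -!mul_collmx -mulmxA collmx_mul ?Dg ?Dh ?oner_neq0.
Qed.

Lemma coll_one : coll gone 1 = 1%g.
Proof.
apply/permP=> P; have [u u0 ->] := point_pt P.
by rewrite coll_pt ?gdet_one ?oner_neq0 // perm1 -mul_collmx collmx_one mulmx1.
Qed.

Lemma gmul_inv g : gdet g = 1 -> gmul (ginv g) g = gone.
Proof.
case: g => [[[al be] ga] de] /= D; rewrite /gone; congr (_, _, _, _); rewrite -?D; ring.
Qed.

Lemma coll_PGL g c : coll g c \in PGL4 K.
Proof. by apply: mem_morphim; rewrite inE. Qed.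

Lemma coll_PGU g c : realg g -> gdet g = 1 -> c != 0 -> c * cj c = 1 -> coll g c \in PGU4 K q.
Proof.
move=> rg D c0 c1; have D0 : gdet g != 0 by rewrite D oner_neq0.
rewrite inE coll_PGL /= !inE; apply/subsetP=> P; have [u u0 ->] := point_pt P.
move=> uS; rewrite inE /= apermE coll_pt //; move: uS; rewrite !mem_surface ?collin_neq0 //.
by rewrite hform_collin.
Qed.

Lemma coll_gline_sub g c x w P : gdet g = 1 -> c != 0 -> P \in gline x w ->
  coll g c P \in gline (act g x) (scv c^-1 (act g w)).
Proof.
move=> D c0; have D0 : gdet g != 0 by rewrite D oner_neq0.
have [u u0 ->] := point_pt P; rewrite mem_gline // coll_pt //.
rewrite mem_gline ?collin_neq0 // {1}(emb_parts u) => /mem_span2[d E].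
apply/mem_span2; exists d; rewrite E act_add !act_scv scvA.
by congr (vadd _ (scv _ _)); field.
Qed.

Lemma coll_gline g c x w : gdet g = 1 -> c != 0 ->
  coll g c @: gline x w = gline (act g x) (scv c^-1 (act g w)).
Proof.
move=> D c0; apply/setP=> P; apply/imsetP/idP=> [[R Rl ->]|Pl]; first exact: coll_gline_sub.
exists (coll (ginv g) c^-1 P); last first.
  by rewrite -permM coll_mul ?gdet_inv ?invr_eq0 // gmul_inv // mulVf // coll_one perm1.
have -> : gline x w = gline (act (ginv g) (act g x)) (scv c^-1^-1 (act (ginv g) (scv c^-1 (act g w)))).
  by rewrite act_scv scvA mulVf ?invr_eq0 // scv1 !actK ?D ?oner_neq0.
by rewrite coll_gline_sub ?gdet_inv ?invr_eq0.
Qed.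

(** The scalar moves w to [c^-1] times its image, and such c form the subgroup of index 2 in the
    norm 1 group, where [sg] is 1. Determinant 1 is what preserves the summand V2. *)
Lemma coll_hemi eps g c : realg g -> gdet g = 1 -> c ^+ (2 * m + 1) = 1 ->
  coll g c \in 'N(hemi (Vsum eps) | 'P^*)%g.
Proof.
move=> rg D ce; have D0 : gdet g != 0 by rewrite D oner_neq0.
have c0 : c != 0 by apply: contra_eqN ce => /eqP->; rewrite addn1 expr0n eq_sym oner_eq0.
have c1 : c * cj c = 1.
  by rewrite cjE -exprS qE (_ : _.+2 = (2 * m + 1) * 2)%N ?exprM ?ce ?expr1n //; lia.
rewrite !inE /=; apply/subsetP=> L /imsetP[[x w] /=]; rewrite mem_chosen.
case/andP=> /and3P[ix /eqP hw /eqP hww] /eqP Vg ->.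
rewrite inE /= setactE.
rewrite (_ : [set _ | _ in _] = coll g c @: gline x w); last first.
  by apply: eq_imset => P; rewrite /= apermE.
rewrite coll_gline //; apply/imsetP; exists (act g x, scv c^-1 (act g w)) => //.
have ci : c^-1 * cj c^-1 = 1 by rewrite fmorphV -invfM c1 invr1.
rewrite mem_chosen /adm /gsign iso_act // ix !(her_scl, her_scr) !her_act // hw hww mulrA ci.
rewrite mulr0 mul1r !eqxx /= -Vg /gsign Vsum_act // /sgL Lam_scr sgM ?Lam_norm ?iso_act ?her_act //.
by rewrite sg_exp ?exprVn ?ce ?invr1 // mul1r -!/(sgL _ _) sgL_act.
Qed.

(* A homothety of the binary forms that is an isometry and preserves orientation is the identity. *)
Lemma act_scalar g d : gdet g = 1 -> (forall w, act g w = scv d w) -> d = 1.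
Proof.
move=> D H; have D0 : gdet g != 0 by rewrite D oner_neq0.
have d2 : d * d = 1.
  have := bil_act (0, 1, 0) (0, 1, 0) D0; rewrite !H bil_scl bil_scr /bil /=.
  by rewrite !(mulr0, mulr1, addr0, subr0).
have := det3_act (1, 0, 0) (0, 1, 0) (0, 0, 1) D0; rewrite !H /det3 /=.
rewrite !(mulr0, mulr1, addr0, subr0, add0r, mul0r) d2 mulr1 //.
Qed.

Lemma act_trivial al be ga de : gdet (al, be, ga, de) = 1 ->
  (forall w, act (al, be, ga, de) w = w) <-> [/\ be = 0, ga = 0 & al = de].
Proof.
move=> /= D; split=> [H|[b0 g0 ad] w]; last first.
  move: D; rewrite b0 g0 ad mul0r subr0 => D.
  apply: vec_eqP; rewrite /= !expr2 D invr1; split; ring.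
have := H (1, 0, 0); have := H (0, 0, 1); have := H (0, 1, 0).
rewrite /act D invr1 /scv /= !(mul1r, mul0r, mulr0, add0r, addr0, mulr1).
case=> _ ad _ [/eqP gg _ _] [aa _ /eqP bb]; move: gg bb; rewrite !expf_eq0 /= => /eqP g0 /eqP b0.
by move: ad; rewrite b0 mul0r addr0 => ad; split=> //; rewrite -[LHS]mulr1 -ad mulrA -expr2 aa mul1r.
Qed.

(** The images of the points (w, 1) show that g acts on the forms as the scalar [c^-1], so
    [act_scalar] applies. This yields both the kernel of [slcoll] and the trivial intersection with
    the cyclic factor. *)
Lemma coll_eq g c : gdet g = 1 -> c != 0 -> coll g 1 = coll gone c ->
  c = 1 /\ forall w, act g w = w.
Proof.
move=> D c0 E; have D0 : gdet g != 0 by rewrite D oner_neq0.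
have D1 : gdet gone != 0 by rewrite gdet_one oner_neq0.
have H w : act g w = scv c^-1 w.
  have E1 : pt (collin g 1 (emb w 1)) = pt (collin gone c (emb w 1)).
    by rewrite -!coll_pt ?emb_neq0r ?oner_neq0 // E.
  have [k k0] := pt_eq (collin_neq0 D0 (oner_neq0 K) (emb_neq0r w)) (collin_neq0 D1 c0 (emb_neq0r w)) E1.
  rewrite /collin !fst3_emb !fourth_emb embZ act_one !mulr1 => /emb_inj[E2 ->].
  by rewrite [in RHS]E2 scvA mulVf // scv1.
have c1 := act_scalar D H; split=> [|w]; first by rewrite -[c]invrK c1 invr1.
by rewrite H c1 scv1.
Qed.

End Symmetry.

Lemma sum_ord2 (V : nmodType) (F : 'I_2 -> V) : \sum_i F i = F 0 + F 1.
Proof. by rewrite !big_ord_recl big_ord0 addr0; congr (_ + F _); apply: val_inj. Qed.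

Lemma det_mx22 (R : comNzRingType) (M : 'M[R]_2) : \det M = M 0 0 * M 1 1 - M 0 1 * M 1 0.
Proof.
rewrite (expand_det_row _ 0) sum_ord2 /cofactor !det_mx11 !mxE /= expr0 expr1 mul1r mulN1r mulrN.
by congr (_ * M _ _ - _ * M _ _); apply: val_inj.
Qed.

Lemma mx22P (T : Type) (A B : 'M[T]_2) :
  [/\ A 0 0 = B 0 0, A 0 1 = B 0 1, A 1 0 = B 1 0 & A 1 1 = B 1 1] -> A = B.
Proof.
have ord2 (i : 'I_2) : i = 0 \/ i = 1 by case: i => [[|[|]] //= h]; [left|right]; apply: val_inj.
by case=> ? ? ? ?; apply/matrixP=> i j; case: (ord2 i) => ->; case: (ord2 j) => ->.
Qed.

(** * The factors PSL(2, q) and C_(q+1)/2 *)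

Section Group.
Variable K : quadext.
Local Notation q := (ord_q K).
Local Notation m := (qe_m K).
Local Notation L2 := (SL2 'F_q).

Definition lift_Fp (a : 'F_q) : K := (a : nat)%:R.

Lemma lift_natr n : lift_Fp n%:R = n%:R.
Proof. by rewrite /lift_Fp val_Fp_nat ?prime_q // (GRing.natr_mod_pchar (pchar_quadext K)). Qed.

Lemma lift_Fp_additive : additive lift_Fp.
Proof.
suff H : {morph lift_Fp : a b / a + b >-> a + b}.
  by move=> a b; apply: (canRL (addrK _)); rewrite -H subrK.
move=> a b; rewrite -(natr_Zp a) -(natr_Zp b) -natrD !lift_natr natrD //.
Qed.

Lemma lift_Fp_multiplicative : multiplicative lift_Fp.
Proof.
split=> [a b|]; last exact: (lift_natr 1).
by rewrite -(natr_Zp a) -(natr_Zp b) -natrM !lift_natr natrM.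
Qed.

HB.instance Definition _ := GRing.isAdditive.Build _ _ lift_Fp lift_Fp_additive.
HB.instance Definition _ := GRing.isMultiplicative.Build _ _ lift_Fp lift_Fp_multiplicative.

Definition coefs (g : {'GL_2['F_q]}) : K * K * K * K :=
  let M := val g in
  (lift_Fp (M 0 0), lift_Fp (M 0 1), lift_Fp (M 1 0), lift_Fp (M 1 1)).

Lemma realg_coefs g : realg (coefs g).
Proof. by rewrite /= !real_nat. Qed.

Lemma gdet_coefs g : g \in L2 -> gdet (coefs g) = 1.
Proof.
rewrite inE => /eqP D; rewrite -[RHS](rmorph1 lift_Fp) -D det_mx22.
by rewrite rmorphB !rmorphM.
Qed.

Lemma coefs_mul g h : coefs (g * h)%g = gmul (coefs g) (coefs h).
Proof.
by rewrite /coefs /= !mxE !sum_ord2 !rmorphD !rmorphM.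
Qed.

Definition slcoll g := coll (coefs g) 1.

Lemma slcollM : {in L2 &, {morph slcoll : g h / (g * h)%g}}.
Proof.
move=> g h Lg Lh; rewrite /slcoll coll_mul ?gdet_coefs ?oner_neq0 //.
by rewrite coefs_mul mulr1.
Qed.
Canonical slcoll_morphism := Morphism slcollM.

Lemma lift_Fp_inj : injective lift_Fp. Proof. exact: fmorph_inj. Qed.

Lemma slcoll_eq1 g : g \in L2 ->
  slcoll g = 1%g <-> [/\ val g 0 1 = 0, val g 1 0 = 0 & val g 0 0 = val g 1 1].
Proof.
move=> Lg; have D := gdet_coefs Lg; split=> [E|[b0 g0 ad]].
  have [_ /(act_trivial D)[b0 g0 ad]] := coll_eq D (oner_neq0 K) (etrans E (esym (coll_one K))).
  by split; apply: lift_Fp_inj; rewrite ?rmorph0.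
have /(act_trivial D) H : [/\ lift_Fp (val g 0 1) = 0, lift_Fp (val g 1 0) = 0
    & lift_Fp (val g 0 0) = lift_Fp (val g 1 1)] by rewrite b0 g0 ad rmorph0.
apply/permP=> P; have [u u0 ->] := point_pt P; rewrite perm1.
by rewrite coll_pt ?D ?oner_neq0 // /collin H mul1r -emb_parts.
Qed.

Lemma center_SL2 (F : finFieldType) (g : {'GL_2[F]}) : g \in SL2 F ->
  (g \in 'Z(SL2 F))%g <-> [/\ val g 0 1 = 0, val g 1 0 = 0 & val g 0 0 = val g 1 1].
Proof.
move=> Lg; split=> [/centerP[_ Z]|[b0 g0 ad]]; last first.
  apply/centerP; split=> // h _; apply: val_inj; apply: mx22P.
  by rewrite /= !mxE !sum_ord2 b0 g0 ad; split; ring.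
have Zt (M : 'M[F]_2) : \det M = 1 -> val g *m M = M *m val g.
  move=> D; have MU : M \in unitmx by rewrite unitmxE D unitr1.
  have := Z (insubd (1%g : {'GL_2[F]}) M); rewrite inE /= insubdK // D eqxx => /(_ isT).
  by move/(congr1 val); rewrite /= insubdK.
(* Commuting with the upper and the lower elementary unipotent matrix already forces a scalar
   matrix. *)
have := Zt (\matrix_(i, j) (i <= j)%:R); have := Zt (\matrix_(i, j) (j <= i)%:R).
rewrite !det_mx22 !mxE /= !(mulr1, mulr0, mul0r, subr0) => /(_ erefl)E1 /(_ erefl)E2.
have := congr1 (fun M : 'M_2 => M 0 0) E1; have := congr1 (fun M : 'M_2 => M 1 0) E1.
have := congr1 (fun M : 'M_2 => M 0 0) E2.
rewrite /= !mxE !sum_ord2 !mxE /= !(mulr1, mulr0, mul1r, mul0r, addr0, add0r).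
move=> e1 e2 /(canRL (addKr _)); rewrite addNr => b0.
have g0 : val g 1 0 = 0 by apply: (addrI (val g 0 0)); rewrite addr0 -e1.
by split=> //; move: e2; rewrite g0 add0r addr0.
Qed.

Lemma ker_slcoll : ('ker slcoll = 'Z(L2))%g.
Proof.
apply/setP=> g; have [Lg|Lg] := boolP (g \in L2); last first.
  by apply/idP/idP => [/dom_ker|/(subsetP (center_sub _))]; rewrite (negbTE Lg).
have H1 := slcoll_eq1 Lg; have H2 := center_SL2 Lg.
by apply/idP/idP => [/mker/H1/H2|/H2/H1 E] //; apply/kerP.
Qed.

Lemma exists_zeta : exists c : K, (2 * m + 1).-primitive_root c.
Proof.
have n0 : (0 < #|K|.-1)%N by rewrite card_quadext -subn1 units_gt0.
have /hasP[z _ zp] : has #|K|.-1.-primitive_root (enum [pred c : K | c != 0]).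
  apply: has_prim_root => //; rewrite ?enum_uniq //.
    apply/allP=> c; rewrite mem_enum inE => c0; rewrite unity_rootE.
    by rewrite card_quadext -subn1 card_units expf_units.
  by rewrite -cardE -(cardC1 (0 : K)) subset_leq_card //; apply/subsetP=> c; rewrite !inE.
exists (z ^+ (#|K|.-1 %/ (2 * m + 1))); apply: dvdn_prim_root => //.
by rewrite card_quadext -subn1 card_units dvdn_mull.
Qed.

Section Rotation.
Variable c : K.
Hypothesis cp : (2 * m + 1).-primitive_root c.

Lemma zeta_exp : c ^+ (2 * m + 1) = 1. Proof. exact: prim_expr_order. Qed.

Lemma zeta_neq0 : c != 0.
Proof. by apply: contra_eqN zeta_exp => /eqP->; rewrite addn1 expr0n eq_sym oner_eq0. Qed.

Lemma coll_expg k : (coll (gone K) c ^+ k)%g = coll (gone K) (c ^+ k).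
Proof.
elim: k => [|k IH]; first by rewrite expg0 expr0 coll_one.
rewrite expgS IH coll_mul ?gdet_one ?expf_neq0 ?zeta_neq0 // exprS.
by rewrite gmul1l.
Qed.

Lemma order_coll : #[coll (gone K) c]%g = (2 * m + 1)%N.
Proof.
apply/eqP; rewrite eqn_dvd order_dvdn coll_expg zeta_exp coll_one eqxx /=.
have := expg_order (coll (gone K) c); rewrite coll_expg => E.
have [] := coll_eq (gdet_one K) _ (etrans (coll_one K) (esym E)).
  by rewrite expf_neq0 ?zeta_neq0.
by move=> c1 _; rewrite (prim_order_dvd cp) c1.
Qed.

Definition hgroup : {group {perm point K}} := (slcoll @* L2 <*> <[coll (gone K) c]>)%G.

Lemma hgroup_dprod : ((slcoll @* L2) \x <[coll (gone K) c]> = hgroup)%g.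
Proof.
apply: dprodEY.
  rewrite centsC /= cent_cycle; apply/subsetP=> _ /morphimP[g _ Lg ->]; apply/cent1P.
  rewrite /commute /slcoll !coll_mul ?gdet_one ?gdet_coefs ?oner_neq0 ?zeta_neq0 //.
  by rewrite gmul1l gmul1r mulr1 mul1r.
apply/trivgP/subsetP=> _ /setIP[/morphimP[g _ Lg ->] /cycleP[k]]; rewrite coll_expg => E.
have [] := coll_eq (gdet_coefs Lg) _ E; first by rewrite expf_neq0 ?zeta_neq0.
by move=> c1 _; rewrite inE /= E c1 coll_one.
Qed.

Lemma hgroup_isog : hgroup \isog setX (PSL2 'F_q) (Zp (q.+1)./2).
Proof.
apply: isog_dprod hgroup_dprod (setX_dprod _ _) _ _.
  have E : PSL2 'F_q \isog slcoll @* L2 by rewrite /PSL2 /= -ker_slcoll first_isog.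
  by rewrite -(isog_transl _ E) isog_setX1.
have E : Zp (q.+1)./2 \isog <[coll (gone K) c]>.
  have -> : (q.+1)./2 = #[coll (gone K) c]%g by rewrite order_coll qE; lia.
  exact: Zp_isog.
by rewrite -(isog_transl _ E) isog_set1X.
Qed.

Lemma hgroup_PGU : hgroup \subset PGU4 K q.
Proof.
have c1 : c * cj c = 1.
  by rewrite cjE -exprS qE (_ : _.+2 = (2 * m + 1) * 2)%N ?exprM ?zeta_exp ?expr1n //; lia.
rewrite join_subG cycle_subG coll_PGU ?gdet_one ?zeta_neq0 //; last exact: realg_one.
rewrite andbT; apply/subsetP=> _ /morphimP[g _ Lg ->].
by rewrite coll_PGU ?realg_coefs ?gdet_coefs ?oner_neq0 // rmorph1 mulr1.
Qed.

Lemma hgroup_acts eps : [acts hgroup, on hemi (Vsum eps) | 'P^*]%g.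
Proof.
rewrite join_subG cycle_subG coll_hemi ?gdet_one ?zeta_exp //; last exact: realg_one.
rewrite andbT; apply/subsetP=> _ /morphimP[g _ Lg ->].
by rewrite coll_hemi ?realg_coefs ?gdet_coefs ?expr1n.
Qed.
End Rotation.
End Group.

Theorem theorem1 (p : nat) (a : int) (p_prime : prime p)
    (p_def : p%:Z = 1 + 4 * a ^+ 2)
    (F : finFieldType) (cardF : #|F| = (p ^ 2)%N) :
  exists (S : {set {set point F}}) (H : {group {perm point F}}),
    [/\ is_hemisystem p S,
        H \subset PGU4 F p,
        H \isog setX (PSL2 'F_p) (Zp (p.+1)./2)
      & [acts H, on S | 'P^*] ].
Proof.
(* The parameter [qe_m] of the field is the square of a. *)
have pE : p = (4 * `|a| ^ 2 + 1)%N by apply/eqP; rewrite -eqz_nat p_def; apply/eqP; lia.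
subst p; pose K := QuadExt p_prime cardF.
have [eps eps1 E] := @esum_invariant K a p_def.
have [c cp] := exists_zeta K.
exists (hemi (@Vsum K eps)), (hgroup c); split.
- apply: (@hemi_hemisystem K) => [|x|w hw]; first exact: Vsum_homog.
    exact: Vsum_sqr.
  by rewrite esum_Vsum ?E.
- exact: (hgroup_PGU cp).
- exact: (hgroup_isog cp).
- exact: (hgroup_acts cp).
Qed.
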